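(* Consider the setting and asymptotic regime described in the context. Define $$\bar Q\equiv\left(\frac nT\frac{\Phi}{1+\delta}+\gamma I_T\right)^{-1},$$ where $\delta$ is implicitly defined as the unique positive solution to $\delta=\frac1T\operatorname{tr}\Phi\bar Q$. Then, for all $\varepsilon>0$, there exists $c>0$ (independent of $n$) such that $$\left\|\mathbb{E}[Q]-\bar Q\right\|\le c\,n^{-\frac12+\varepsilon}.$$
   Context: Setting. $\varphi:\mathbb{R}\to\mathbb{R}$ is $\lambda_\varphi$-Lipschitz and $\sigma:\mathbb{R}\to\mathbb{R}$ is $\lambda_\sigma$-Lipschitz; both are applied entry-wise to vectors and matrices. $W=\varphi(\tilde W)\in\mathbb{R}^{n\times p}$, where $\tilde W\in\mathbb{R}^{n\times p}$ has i.i.d. $\mathcal N(0,1)$ entries. $X\in\mathbb{R}^{p\times T}$ is deterministic. $\Sigma=\sigma(WX)\in\mathbb{R}^{n\times T}$ and, for $\gamma>0$, $Q=(\frac1T\Sigma^{\top}\Sigma+\gamma I_T)^{-1}$. The matrix $\Phi\in\mathbb{R}^{T\times T}$ is $\Phi=\mathbb{E}[\sigma(w^{\top}X)^{\top}\sigma(w^{\top}X)]$, where $w=\varphi(\tilde w)\in\mathbb{R}^p$, $\tilde w\sim\mathcal N(0,I_p)$. Asymptotic regime. $n\to\infty$, with $p=p(n)$, $T=T(n)$, $X=X_n$ such that $0<\liminf_n\min\{p/n,T/n\}\le\limsup_n\max\{p/n,T/n\}<\infty$ and $\limsup_n\|X\|<\infty$, while $\sigma,\varphi$ (with $\lambda_\sigma,\lambda_\varphi>0$)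 and $\gamma>0$ are kept fixed. $\|\cdot\|$ is the operator norm for matrices. *)

(* Defs.v *)
(* MathComp-Analysis; real numbers are an arbitrary [R : realType]. *)
From HB Require Import structures.
From mathcomp Require Import all_boot all_order all_algebra.
From mathcomp Require Import all_classical all_reals all_analysis.

Set Implicit Arguments.
Unset Strict Implicit.
Unset Printing Implicit Defensive.

Import Order.TTheory GRing.Theory Num.Theory.
Import numFieldNormedType.Exports.

Local Open Scope classical_set_scope.
Local Open Scope ring_scope.

Definition l2norm (R : realType) (m : nat) (v : 'cV[R]_m) : R :=
  Num.sqrt (\sum_(i < m) v i 0 ^+ 2).

(* Spectral norm; the library's norm on matrices is the entrywise maximum. The
   closed unit ball, rather than the sphere, keeps the set nonempty when the
   dimension is 0. *)
Definition opnorm (R : realType) (m k : nat) (A : 'M[R]_(m, k)) : R :=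
  sup [set l2norm (A *m v) | v in [set v : 'cV[R]_k | l2norm v <= 1]].

Definition mutually_independent (R : realType) (d : measure_display)
    (Om : measurableType d) (P : probability Om R) (I : finType)
    (Z : I -> {RV P >-> R}) : Prop :=
  forall (J : {set I}) (B : I -> set R), (forall i, measurable (B i)) ->
    P (\bigcap_(i in [set` J]) (Z i @^-1` B i)) =
    (\prod_(i in J) P (Z i @^-1` B i))%E.

(* Laws are compared on Borel sets only: off the sigma-algebra the values of a
   measure are unspecified. *)
Definition iid_std_normal (R : realType) (d : measure_display)
    (Om : measurableType d) (P : probability Om R) (I : finType)
    (Z : I -> {RV P >-> R}) : Prop :=
  mutually_independent Z /\
  forall i (B : set R), measurable B ->
    distribution P (Z i) B = normal_prob 0 1 B.

Definition Emx (R : realType) (d : measure_display) (Om : measurableType d)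
    (P : probability Om R) (m k : nat) (M : Om -> 'M[R]_(m, k)) : 'M[R]_(m, k) :=
  \matrix_(i, j) fine 'E_P[fun om => M om i j].

Definition weights (R : realType) (d : measure_display) (Om : measurableType d)
    (P : probability Om R) (phi : R -> R) (n p : nat)
    (Wt : 'I_n -> 'I_p -> {RV P >-> R}) (om : Om) : 'M[R]_(n, p) :=
  map_mx phi (\matrix_(i, j) Wt i j om).

Definition weight_vec (R : realType) (d : measure_display)
    (Om : measurableType d) (P : probability Om R) (phi : R -> R) (p : nat)
    (wt : 'I_p -> {RV P >-> R}) (om : Om) : 'cV[R]_p :=
  map_mx phi (\col_i wt i om).

Definition features (R : realType) (sigma : R -> R) (n p T : nat)
    (W : 'M[R]_(n, p)) (X : 'M[R]_(p, T)) : 'M[R]_(n, T) :=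
  map_mx sigma (W *m X).

Definition resolvent (R : realType) (gamma : R) (n T : nat)
    (S : 'M[R]_(n, T)) : 'M[R]_T :=
  invmx (T%:R^-1 *: (S^T *m S) + gamma%:M).

Definition Phi_mx (R : realType) (d : measure_display) (Om : measurableType d)
    (P : probability Om R) (phi sigma : R -> R) (p T : nat)
    (wt : 'I_p -> {RV P >-> R}) (X : 'M[R]_(p, T)) : 'M[R]_T :=
  Emx P (fun om => let s := features sigma (weight_vec phi wt om)^T X in
                   s^T *m s).

Definition Qbar_at (R : realType) (gamma : R) (n T : nat) (Phi : 'M[R]_T)
    (delta : R) : 'M[R]_T :=
  invmx ((n%:R / T%:R) *: ((1 + delta)^-1 *: Phi) + gamma%:M).

Definition is_delta (R : realType) (gamma : R) (n T : nat) (Phi : 'M[R]_T)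
    (delta : R) : Prop :=
  0 < delta /\ delta = T%:R^-1 * \tr (Phi *m Qbar_at gamma n Phi delta).

(* If [Phi = 0] there is no positive solution; the default value 0 is then the
   solution of the equation, and [Qbar_at] does not depend on [delta]. *)
Definition delta_of (R : realType) (gamma : R) (n T : nat)
    (Phi : 'M[R]_T) : R :=
  xget 0 [set delta | is_delta gamma n Phi delta].

Definition Qbar (R : realType) (gamma : R) (n T : nat) (Phi : 'M[R]_T) :
    'M[R]_T :=
  Qbar_at gamma n Phi (delta_of gamma n Phi).

(* Main.v *)
(* Write s_i for the i-th row of Sigma, Q_i for the resolvent with that row set
   to zero, D_i = s_i^T Q_i s_i / T and alpha = tr(Phi E[Q]) / T.

   The only probabilistic input is the Gaussian Poincare inequality. It bounds
   the variance of a function of sigma(phi(g) X) by a constant times the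
   expected squared gradient in the entries of sigma(phi(g) X), the constant
   depending on the Lipschitz constants only. Hence D_i is within O(T^(-1/2)) of
   its conditional mean tr(Phi Q_i) / T, and the latter is within O(T^(-1/2))
   of alpha, up to biases e_i with sum_i e_i = O(1).

   The Sherman-Morrison identity (1 + D_i) Q s_i = Q_i s_i and the independence
   of s_i and Q_i give, for Qt the ridge inverse at alpha and b' = Qt b,
     u^T (E[Q] - Qt) b = (T (1 + alpha))^-1 sum_i
       E[(u^T Q s_i) ((s_i^T b') (D_i - alpha) - s_i^T Q_i Phi b' / T)],
   which the Cauchy-Schwarz inequality bounds by O(n^(-1/2)) because
   sum_i (u^T Q s_i)^2 <= T |u|^2 / gamma.

   Finally, with h(x) = tr(Phi Qbar(x)) / T, the map h(x) / (1 + x) is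
   nonincreasing. So h has at most one fixed point delta, and
   |alpha - delta| <= (1 + delta) |alpha - h(alpha)|, while
   alpha - h(alpha) = tr(Phi (E[Q] - Qt)) / T is O(n^(-1/2)) by the above. *)
Require Import Defs.
From mathcomp Require Import ring lra measurable_realfun.
From HB Require Import structures.
From mathcomp Require Import all_boot all_order all_algebra.
From mathcomp Require Import all_classical all_reals all_analysis.

Set Implicit Arguments.
Unset Strict Implicit.
Unset Printing Implicit Defensive.

Import Order.TTheory GRing.Theory Num.Theory.
Import numFieldNormedType.Exports.

Local Open Scope classical_set_scope.
Local Open Scope ring_scope.

(** * Expectation of functions with finite moments *)

Section tame.
Context (R : realType) (d : measure_display) (Om : measurableType d)
  (P : probability Om R).
Implicit Types f g : Om -> R.

(** The features are not centred, so nothing bounds the norm of [Phi]; only [tr Phi = O(T)] is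
    available, and this shapes the estimates. [Phi] enters through its trace, or through [Phi b'],
    which is bounded because [Phi] is a multiple of the matrix that [Qt] inverts up to [gamma]. In
    the second moment of the bracket, the weight [(s_i^T b')^2] has bounded mean [b'^T Phi b'] but
    is itself unbounded. The variance of [D_i] is then not enough, and the Poincare inequality is
    applied once more, to the product of the linear form and the centred quadratic form. The biases
    [e_i] have a bounded sum because the rank-one changes of the trace add up to at most a multiple
    of the trace itself.

    The other obstacle is regularity: [phi] and [sigma] are merely Lipschitz. The Poincare
    inequality is proved for functions with a second-order Taylor bound of polynomial growth, a
    class closed under composition. Only the two scalar functions are then mollified; the bound
    depends on them through their Lipschitz constants. *)

Definition Ex f : R := \int[P]_x f x.

(* Finite moments of every order, so that products stay in the class. *)
Definition tame f : Prop := measurable_fun setT f /\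
  forall k : nat, (\int[P]_x (`|f x| ^+ k)%:E < +oo)%E.

Lemma tame_measurable f : tame f -> measurable_fun setT f.
Proof. by case. Qed.

Lemma tame_dom f g : measurable_fun setT f -> tame g ->
  (forall x, `|f x| <= `|g x|) -> tame f.
Proof.
move=> mf [mg ig] fg; split => // k; apply: le_lt_trans (ig k).
apply: ge0_le_integral => //.
- by apply/measurable_EFinP; apply: measurable_funX; exact: measurableT_comp.
- by apply/measurable_EFinP; apply: measurable_funX; exact: measurableT_comp.
- by move=> x _; rewrite lee_fin lerXn2r ?nnegrE.
Qed.

Lemma tame_integrable f : tame f -> P.-integrable setT (EFin \o f).
Proof.
move=> [mf /(_ 1%N) i1]; apply/integrableP; split; first exact/measurable_EFinP.
exact: i1.
Qed.

Lemma tame_cst r : tame (fun=> r).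
Proof.
split=> [|k]; first exact: measurable_cst.
by rewrite integral_cst//= probability_setT mule1 ltry.
Qed.

(** From [(a + b)^k <= 2^k max(a, b)^k <= 2^k (a^k + b^k)]. The function [|f| + |g|] dominates the
    sum, and its square dominates the product, hence the closure properties below. *)
Lemma tame_max f g : tame f -> tame g -> tame (fun x => `|f x| + `|g x|).
Proof.
move=> [mf fi] [mg gi]; split.
  by apply: measurable_funD; exact: measurableT_comp.
move=> k.
have mk (h : Om -> R) : measurable_fun setT h ->
    measurable_fun [set: Om] (fun x => (`|h x| ^+ k)%:E).
  by move=> mh; apply/measurable_EFinP; apply: measurable_funX;
    exact: measurableT_comp.
apply: (@le_lt_trans _ _ (\int[P]_x ((2 ^+ k)%:E * ((`|f x| ^+ k)%:E + (`|g x| ^+ k)%:E)))%E).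
  apply: ge0_le_integral => //.
  - by apply: mk; apply: measurable_funD; exact: measurableT_comp.
  - apply: emeasurable_funM => //; apply: emeasurable_funD; exact: mk.
  move=> x _; rewrite -EFinD -EFinM lee_fin ger0_norm ?addr_ge0//.
  wlog fg : f g mf mg fi gi mk/ `|g x| <= `|f x|.
    move=> H; have [fg|/ltW fg] := lerP `|g x| `|f x|; first exact: H.
    by rewrite addrC [X in _ * X]addrC; exact: H.
  apply: (@le_trans _ _ ((2 * `|f x|) ^+ k)).
    by rewrite lerXn2r ?nnegrE ?addr_ge0 ?mulr_ge0// mulrDl mul1r lerD2l.
  by rewrite exprMn ler_pM2l ?exprn_gt0// lerDl exprn_ge0.
rewrite ge0_integralZl//; last 2 first.
  - by apply: emeasurable_funD; exact: mk.
  - by move=> x _; rewrite -EFinD lee_fin addr_ge0// exprn_ge0.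
rewrite ge0_integralD//; [|exact: mk|exact: mk].
by apply: lte_mul_pinfty; rewrite ?lee_fin ?exprn_ge0// lte_add_pinfty.
Qed.

Lemma tameD f g : tame f -> tame g -> tame (fun x => f x + g x).
Proof.
move=> tf tg; apply: tame_dom (tame_max tf tg) _.
  by apply: measurable_funD; exact: tame_measurable.
by move=> x; rewrite [leRHS]ger0_norm ?addr_ge0// ler_normD.
Qed.

Lemma tameN f : tame f -> tame (fun x => - f x).
Proof.
move=> tf; apply: tame_dom (tf) _; last by move=> x; rewrite normrN.
exact: measurableT_comp (tame_measurable tf).
Qed.

Lemma tameB f g : tame f -> tame g -> tame (fun x => f x - g x).
Proof. by move=> tf tg; apply: tameD => //; exact: tameN. Qed.

Lemma tame_sqr f : tame f -> tame (fun x => f x ^+ 2).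
Proof.
move=> [mf fi]; split=> [|k]; first exact: measurable_funX.
rewrite (eq_integral (fun x => (`|f x| ^+ (2 * k))%:E)); first exact: fi.
by move=> x _; rewrite normrX exprM.
Qed.

Lemma tameM f g : tame f -> tame g -> tame (fun x => f x * g x).
Proof.
move=> tf tg; apply: tame_dom (tame_sqr (tame_max tf tg)) _.
  by apply: measurable_funM; exact: tame_measurable.
move=> x; rewrite normrM [leRHS]ger0_norm ?sqr_ge0//.
have := normr_ge0 (f x); have := normr_ge0 (g x); nra.
Qed.

Lemma tameZ r f : tame f -> tame (fun x => r * f x).
Proof. by apply: tameM; exact: tame_cst. Qed.

Lemma tame_sum (I : Type) (s : seq I) (Q : pred I) (F : I -> Om -> R) :
  (forall i, tame (F i)) -> tame (fun x => \sum_(i <- s | Q i) F i x).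
Proof.
move=> tF; elim: s => [|i s IH].
  by under eq_fun do rewrite big_nil; exact: tame_cst.
under eq_fun do rewrite big_cons.
by case: (Q i) => //; exact: tameD.
Qed.

Lemma tameX k f : tame f -> tame (fun x => f x ^+ k).
Proof.
move=> tf; elim: k => [|k IH]; first exact: tame_cst.
by under eq_fun do rewrite exprS; exact: tameM.
Qed.

Lemma tame_abs f : tame f -> tame (fun x => `|f x|).
Proof.
move=> tf; apply: tame_dom (tf) _; last by move=> x; rewrite normr_id.
exact: measurableT_comp (tame_measurable tf).
Qed.

Lemma tame_bnd f r : measurable_fun setT f -> (forall x, `|f x| <= r) -> tame f.
Proof.
move=> mf fr; apply: tame_dom (tame_cst r) _ => // x.
by rewrite (le_trans (fr x))// ler_norm.
Qed.

Lemma ExD f g : tame f -> tame g ->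
  Ex (fun x => f x + g x) = Ex f + Ex g.
Proof. by move=> tf tg; apply: RintegralD => //; exact: tame_integrable. Qed.

Lemma ExB f g : tame f -> tame g ->
  Ex (fun x => f x - g x) = Ex f - Ex g.
Proof. by move=> tf tg; apply: RintegralB => //; exact: tame_integrable. Qed.

Lemma ExZ r f : tame f -> Ex (fun x => r * f x) = r * Ex f.
Proof. by move=> tf; apply: RintegralZl => //; exact: tame_integrable. Qed.

Lemma ExZr r f : tame f -> Ex (fun x => f x * r) = Ex f * r.
Proof. by move=> tf; apply: RintegralZr => //; exact: tame_integrable. Qed.

Lemma Ex_cst r : Ex (fun=> r) = r.
Proof.
by rewrite /Ex Rintegral_cst//= [X in fine X]probability_setT mulr1.
Qed.

Lemma ExN f : tame f -> Ex (fun x => - f x) = - Ex f.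
Proof.
by move=> tf; under eq_fun do rewrite -mulN1r; rewrite ExZ// mulN1r.
Qed.

Lemma Ex_sum (I : Type) (s : seq I) (Q : pred I) (F : I -> Om -> R) :
  (forall i, tame (F i)) ->
  Ex (fun x => \sum_(i <- s | Q i) F i x) = \sum_(i <- s | Q i) Ex (F i).
Proof.
move=> tF; elim: s => [|i s IH].
  by under eq_fun do rewrite big_nil; rewrite big_nil Ex_cst.
under eq_fun do rewrite big_cons; rewrite big_cons.
by case: (Q i) => //; rewrite ExD ?IH//; exact: tame_sum.
Qed.

Lemma Ex_le f g : tame f -> tame g -> (forall x, f x <= g x) -> Ex f <= Ex g.
Proof.
by move=> tf tg fg; apply: le_Rintegral => //; exact: tame_integrable.
Qed.

Lemma Ex_ge0 f : (forall x, 0 <= f x) -> 0 <= Ex f.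
Proof. by move=> f0; apply: Rintegral_ge0. Qed.

Lemma Ex_abs f : tame f -> `|Ex f| <= Ex (fun x => `|f x|).
Proof. by move=> tf; apply: le_normr_Rintegral => //; exact: tame_integrable. Qed.

Lemma Ex_CS f g : tame f -> tame g ->
  Ex (fun x => f x * g x) ^+ 2 <= Ex (fun x => f x ^+ 2) * Ex (fun x => g x ^+ 2).
Proof.
move=> tf tg.
set a := Ex (fun x => g x ^+ 2); set b := Ex (fun x => f x * g x).
set c := Ex _.
have tff := tame_sqr tf; have tgg := tame_sqr tg; have tfg := tameM tf tg.
have H (t u : R) : 0 <= t ^+ 2 * c - 2 * t * u * b + u ^+ 2 * a.
  have : 0 <= Ex (fun x => (t * f x - u * g x) ^+ 2).
    by apply: Ex_ge0 => x; exact: sqr_ge0.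
  suff -> : Ex (fun x => (t * f x - u * g x) ^+ 2) =
    t ^+ 2 * c - 2 * t * u * b + u ^+ 2 * a by [].
  have t1 := tameZ (t ^+ 2) tff; have t2 := tameZ (2 * t * u) tfg.
  have t3 := tameZ (u ^+ 2) tgg.
  rewrite -(ExZ (t ^+ 2) tff) -(ExZ (2 * t * u) tfg) -(ExZ (u ^+ 2) tgg).
  rewrite -(ExB t1 t2) -(ExD (tameB t1 t2) t3).
  by congr Ex; apply/funext => x; ring.
have a0 : 0 <= a by apply: Ex_ge0 => x; exact: sqr_ge0.
have c0 : 0 <= c by apply: Ex_ge0 => x; exact: sqr_ge0.
have := H a b; have [a0'|an0] := eqVneq a 0.
  (* In the degenerate case [a = 0], [H b (c + 1)] reads [0 <= - (c + 2) * b ^+ 2], which forces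
     [b = 0]. *)
  have := H b (c + 1); have := H b (- (c + 1)); rewrite a0'; nra.
have ap : 0 < a by rewrite lt_def an0.
by move=> H1; rewrite -(ler_pM2l ap); nra.
Qed.

Definition Var f := Ex (fun x => (f x - Ex f) ^+ 2).

Lemma VarE f : tame f -> Var f = Ex (fun x => f x ^+ 2) - Ex f ^+ 2.
Proof.
move=> tf; rewrite /Var.
have tff := tame_sqr tf.
rewrite (_ : (fun x => _) = fun x => f x ^+ 2 - ((2 * Ex f) * f x - Ex f ^+ 2)).
  have t1 := tameZ (2 * Ex f) tf; have t2 := tame_cst (Ex f ^+ 2).
  by rewrite (ExB tff (tameB t1 t2)) (ExB t1 t2) ExZ// Ex_cst; ring.
by apply/funext => x; ring.
Qed.

Lemma Var_le f c : tame f -> Var f <= Ex (fun x => (f x - c) ^+ 2).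
Proof.
move=> tf; rewrite (VarE tf).
have t1 := tame_sqr tf; have t2 := tameZ (2 * c) tf; have t3 := tame_cst (c ^+ 2).
rewrite [X in _ <= Ex X](_ : _ = fun x => f x ^+ 2 - (2 * c * f x - c ^+ 2)).
  rewrite (ExB t1 (tameB t2 t3)) (ExB t2 t3) ExZ// Ex_cst.
  by have := sqr_ge0 (Ex f - c); lra.
by apply/funext => x; ring.
Qed.

End tame.

(** * Independent standard normal families *)

Section gauss.
Context (R : realType) (I : finType).

(** Independence and the marginal laws in a single product formula. The members are plain functions,
    so that rotated families and families on product spaces fit directly. *)
Definition gauss (d : measure_display) (Om : measurableType d)
    (P : probability Om R) (Z : I -> Om -> R) : Prop :=
  (forall i, measurable_fun setT (Z i)) /\
  forall B : I -> set R, (forall i, measurable (B i)) ->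
    P [set om | forall i, B i (Z i om)] = (\prod_i normal_prob 0 1 (B i))%E.

(* [I -> R] carries no sigma-algebra here: measurability of a function on it is
   tested along families of measurable functions. *)
Definition mfunI (F : (I -> R) -> R) : Prop :=
  forall (d : measure_display) (Om : measurableType d) (Z : I -> Om -> R),
    (forall i, measurable_fun setT (Z i)) ->
    measurable_fun setT (fun om => F (Z^~ om)).

Definition rects : set (set (I -> R)) :=
  [set A | exists2 B : I -> set R, (forall i, measurable (B i)) &
           A = [set g | forall i, B i (g i)]].

Lemma measurable_rect (d : measure_display) (Om : measurableType d)
    (Z : I -> Om -> R) (B : I -> set R) :
  (forall i, measurable_fun setT (Z i)) -> (forall i, measurable (B i)) ->
  measurable [set om | forall i, B i (Z i om)].
Proof.
move=> mZ mB.
rewrite (_ : [set om | _] = \bigcap_(i in [set: I]) (Z i @^-1` B i)).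
  apply: fin_bigcap_measurable => [|i _]; first exact: finite_finset.
  by rewrite -[X in measurable X]setTI; exact: mZ.
by apply/seteqP; split => om /= H i => [_|]; exact: H.
Qed.

Lemma measurable_to_canon (d : measure_display) (Om : measurableType d)
    (Z : I -> Om -> R) :
  (forall i, measurable_fun setT (Z i)) ->
  measurable_fun setT ((fun om => Z^~ om) : Om -> g_sigma_algebraType rects).
Proof.
move=> mZ; apply: (@measurability _ _ _ (g_sigma_algebraType rects) setT _ rects) => //.
by move=> _ [_ [B mB ->] <-]; rewrite setTI; exact: measurable_rect.
Qed.

Lemma measurable_coord i :
  measurable_fun setT ((fun g => g i) : g_sigma_algebraType rects -> R).
Proof.
move=> _ B mB; rewrite setTI; apply: sub_sigma_algebra.
exists (fun j => if j == i then B else setT).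
  by move=> j; case: ifP.
apply/seteqP; split => g /= => [gB j|/(_ i)]; last by rewrite eqxx.
by case: eqP => // ->.
Qed.

Section law.
Context (d : measure_display) (Om : measurableType d) (P : probability Om R)
  (d' : measure_display) (Om' : measurableType d') (P' : probability Om' R)
  (Z : I -> Om -> R) (Z' : I -> Om' -> R).
Hypotheses (gZ : gauss P Z) (gZ' : gauss P' Z').

(** Both integrals are pushed to the canonical space [I -> R]. The two image measures agree on
    measurable rectangles, which are stable under intersection, contain the whole space and generate
    the sigma-algebra; so they agree everywhere. *)
Lemma gauss_law_ge0 F : mfunI F -> (forall g, 0 <= F g) ->
  (\int[P]_om (F (Z^~ om))%:E = \int[P']_om (F (Z'^~ om))%:E)%E.
Proof.
move=> mF F0; have [mZ lZ] := gZ; have [mZ' lZ'] := gZ'.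
pose T := g_sigma_algebraType rects.
have mC := measurable_to_canon mZ; have mC' := measurable_to_canon mZ'.
have mFT : measurable_fun [set: T] (EFin \o F).
  by apply/measurable_EFinP; exact: (mF _ T (fun i g => g i) measurable_coord).
transitivity (\int[pushforward P ((fun om => Z^~ om) : Om -> T)]_g (F g)%:E)%E.
  by rewrite ge0_integral_pushforward// => g _; rewrite lee_fin.
transitivity (\int[pushforward P' ((fun om => Z'^~ om) : Om' -> T)]_g (F g)%:E)%E;
  last by rewrite ge0_integral_pushforward// => g _; rewrite lee_fin.
apply: eq_measure_integral => A mA _.
apply: (@measure_unique _ R T rects (fun=> setT)) => //.
- move=> _ _ [B mB ->] [C mC0 ->]; exists (fun i => B i `&` C i).
    by move=> i; exact: measurableI.
  apply/seteqP; split => g /= => [[H1 H2] i|H]; first by split.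
  by split => i; have [] := H i.
- move=> _; exists (fun=> setT) => //; apply/seteqP; split => //.
- by rewrite bigcup_const//; exists 0%N.
- by move=> _ [B mB ->]; rewrite /pushforward/= [LHS](lZ B mB) [RHS](lZ' B mB).
- move=> _; suff: (P setT < +oo)%E by [].
  by rewrite probability_setT ltry.
Qed.

Lemma tame_law F : mfunI F -> tame P (fun om => F (Z^~ om)) ->
  tame P' (fun om => F (Z'^~ om)).
Proof.
move=> mF [_ tF]; split => [|k]; first by apply: mF; case: gZ'.
rewrite -(gauss_law_ge0 (F := fun g => `|F g| ^+ k)) => //.
  move=> ? Om1 Z1 /mF mF1.
  by apply: measurable_funX; exact: measurableT_comp mF1.
Qed.

End law.

(** The nonnegative case is applied to [|F|] and to [|F| - F]. *)
Lemma Ex_law (d : measure_display) (Om : measurableType d) (P : probability Om R)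
  (d' : measure_display) (Om' : measurableType d') (P' : probability Om' R)
  (Z : I -> Om -> R) (Z' : I -> Om' -> R) F :
  gauss P Z -> gauss P' Z' -> mfunI F -> tame P (fun om => F (Z^~ om)) ->
  Ex P (fun om => F (Z^~ om)) = Ex P' (fun om => F (Z'^~ om)).
Proof.
move=> gZ gZ' mF tF; have tF' := tame_law gZ gZ' mF tF.
have H (G : (I -> R) -> R) : mfunI G -> (forall g, 0 <= G g) ->
    Ex P (fun om => G (Z^~ om)) = Ex P' (fun om => G (Z'^~ om)).
  by move=> mG G0; rewrite /Ex /Rintegral (gauss_law_ge0 gZ gZ').
have mabs : mfunI (fun g => `|F g|).
  by move=> ? Om1 Z1 /mF mF1; exact: measurableT_comp mF1.
have mdif : mfunI (fun g => `|F g| - F g).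
  by move=> ? Om1 Z1 mZ1; apply: measurable_funB; [exact: mabs|exact: mF].
have := H _ mabs; have := H _ mdif.
rewrite !ExB//; try exact: tame_abs.
move=> H2 H1; have E1 := H1 (fun=> normr_ge0 _).
have : (forall g, 0 <= `|F g| - F g) by move=> g; rewrite subr_ge0 ler_norm.
by move=> /H2; rewrite E1 => /addrI /oppr_inj.
Qed.

End gauss.

(** * Rotation invariance of the Gaussian measure of the plane *)

Section normal_rotation.
Context (R : realType).
Local Notation gam := (@normal_prob R 0 1).
Local Notation leb := (@lebesgue_measure R).
Local Notation rho := (@normal_pdf R 0 1).

Lemma integral_normal_integrable (f : R -> \bar R) :
  gam.-integrable setT f ->
  (\int[gam]_x f x = \int[leb]_x (f x * (rho x)%:E))%E.
Proof.
move=> fi; have mf := measurable_int _ fi.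
have dom := normal_prob_dominates (0 : R) 1.
have mrho : measurable_fun setT (EFin \o rho).
  by apply/measurable_EFinP; exact: measurable_normal_pdf.
rewrite -(Radon_Nikodym_change_of_variables dom)//=.
apply: ae_eq_integral => //.
- apply: (emeasurable_funM mf); apply: (measurable_int leb).
  by apply: Radon_Nikodym_integrable; exact: dom.
- exact: (emeasurable_funM mf mrho).
- apply: ae_eqe_mul2l => /=.
  rewrite Radon_NikodymE//=; case: cid => /= h [h1 h2 h3].
  apply: integral_ae_eq => //=.
  + by move=> E _ mE; rewrite -h3.
Qed.

Lemma integral_normal_bnd (f : R -> R) (M : R) :
  measurable_fun setT f -> (forall x, `|f x| <= M) ->
  (\int[gam]_x (f x)%:E = \int[leb]_x ((f x)%:E * (rho x)%:E))%E.
Proof.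
move=> mf fM; apply: integral_normal_integrable.
apply/integrableP; split; first exact/measurable_EFinP.
apply: (@le_lt_trans _ _ (\int[gam]_x (cst M%:E) x)%E).
  apply: ge0_le_integral => //.
  - by apply/measurable_EFinP; exact: measurableT_comp.
  - by move=> x _; rewrite lee_fin.
by rewrite integral_cst//= probability_setT mule1 ltry.
Qed.

(** Truncation at level [n] reduces to bounded functions, and monotone convergence on both sides
    removes it. Integrability of [f] cannot be assumed, since this formula is what later proves that
    the Gaussian moments are finite. *)
Lemma integral_normal_ge0 (f : R -> R) :
  measurable_fun setT f -> (forall x, 0 <= f x) ->
  (\int[gam]_x (f x)%:E = \int[leb]_x ((f x)%:E * (rho x)%:E))%E.
Proof.
move=> mf f0.
pose g (n : nat) x := Num.min (f x) n%:R.
have mg n : measurable_fun setT (g n) by exact: measurable_minr.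
have g0 n x : 0 <= g n x by rewrite /g le_min f0 ler0n.
have ndg n m x : (n <= m)%N -> g n x <= g m x.
  by move=> nm; rewrite /g le_min ge_min lexx/= ge_min ler_nat nm orbT.
have limg x : limn (fun n => (g n x)%:E) = (f x)%:E.
  apply/cvg_lim => //; apply: (@cvg_near_cst _ _ _ _ _).
  near=> n; congr EFin; apply/min_idPl.
  rewrite (le_trans (ltW (truncnS_gt (f x))))// ler_nat.
  by near: n; exact: nbhs_infty_ge.
have rho0 x : 0 <= rho x by exact: normal_pdf_ge0.
have mrho : measurable_fun setT rho by exact: measurable_normal_pdf.
transitivity (limn (fun n => \int[gam]_x (g n x)%:E)%E).
  rewrite -(@monotone_convergence _ _ _ gam setT measurableT (fun n x => (g n x)%:E)).
  - by apply: eq_integral => x _; rewrite limg.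
  - by move=> n; apply/measurable_EFinP; exact: mg.
  - by move=> n x _; rewrite lee_fin.
  - by move=> x _ n m nm; rewrite lee_fin; exact: ndg.
transitivity (limn (fun n => \int[leb]_x ((g n x)%:E * (rho x)%:E))%E).
  congr (limn _); apply/funext => n.
  apply: (@integral_normal_bnd _ n%:R) => // x.
  by rewrite ger0_norm// /g ge_min lexx orbT.
rewrite -(@monotone_convergence _ _ _ leb setT measurableT
  (fun n x => ((g n x)%:E * (rho x)%:E)%E)).
- apply: eq_integral => x _.
  apply/cvg_lim => //; apply: cvgeZr => //.
  apply: (@cvg_near_cst _ _ _ _ _).
  near=> n; congr EFin; apply/min_idPl.
  rewrite (le_trans (ltW (truncnS_gt (f x))))// ler_nat.
  by near: n; exact: nbhs_infty_ge.
- by move=> n; apply: emeasurable_funM; apply/measurable_EFinP; [exact: mg|].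
- by move=> n x _; rewrite -EFinM lee_fin mulr_ge0.
- by move=> x _ n m nm; rewrite -!EFinM lee_fin ler_wpM2r// ndg.
Unshelve. all: by end_near. Qed.

Lemma integral_translate (f : R -> \bar R) (a : R) :
  measurable_fun setT f -> (forall x, 0 <= f x)%E ->
  (\int[leb]_x f (x + a)%R = \int[leb]_x f x)%E.
Proof.
move=> mf f0.
pose tr : measurableTypeR R -> measurableTypeR R := fun x : R => x + a.
have mt : measurable_fun setT tr by exact: measurable_funD.
transitivity (\int[pushforward leb tr]_x f x)%E.
  by rewrite ge0_integral_pushforward.
apply: eq_measure_integral => A mA _; apply/esym.
apply: lebesgue_measure_unique => // _ [[x y] _ <-] /=.
rewrite /pushforward (_ : _ @^-1` _ = `](x - a), (y - a)]%classic).
  rewrite !lebesgue_measure_itv/= !lte_fin ltrD2r; case: ifP => // _.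
  by rewrite -!EFinB; congr EFin; ring.
by apply/seteqP; split => z /=; rewrite !in_itv/= ltrBlDr lerBrDr.
Qed.

Lemma iterated_shearr (K : R * R -> \bar R) (t : R) :
  measurable_fun setT K -> (forall z, 0 <= K z)%E ->
  (\int[leb]_x \int[leb]_y K (x, y + t * x)%R = \int[leb]_x \int[leb]_y K (x, y))%E.
Proof.
move=> mK K0; apply: eq_integral => x _.
rewrite (integral_translate (f := fun y => K (x, y)))//.
exact: measurable_fun_pair2.
Qed.

Lemma iterated_shearl (K : R * R -> \bar R) (t : R) :
  measurable_fun setT K -> (forall z, 0 <= K z)%E ->
  (\int[leb]_x \int[leb]_y K (x + t * y, y)%R = \int[leb]_x \int[leb]_y K (x, y))%E.
Proof.
move=> mK K0.
have mshl : measurable_fun setT (fun z : R * R => (z.1 + t * z.2, z.2)).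
  apply: measurable_fun_pair => //.
  by apply: measurable_funD => //; exact: measurable_funM.
have E1 := @fubini_tonelli _ _ _ _ R leb leb _ (measurableT_comp mK mshl)
  (fun z => K0 _).
have E2 := @fubini_tonelli _ _ _ _ R leb leb _ mK K0.
apply: (etrans E1); apply: etrans (esym E2); apply: eq_integral => y _ /=.
apply: (integral_translate (f := fun x => K (x, y))) => //.
exact: measurable_fun_pair1.
Qed.

(* A rotation is a product of three shears, and a shear preserves the iterated
   integral by translation invariance in one variable. *)
Lemma iterated_rotation (K : R * R -> \bar R) (c s : R) :
  c ^+ 2 + s ^+ 2 = 1 -> s != 0 ->
  measurable_fun setT K -> (forall z, 0 <= K z)%E ->
  (\int[leb]_x \int[leb]_y K (c * x + s * y, c * y - s * x)%R
   = \int[leb]_x \int[leb]_y K (x, y))%E.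
Proof.
(* With [c] and [s] the cosine and sine of an angle, [a] is the tangent of the half angle; the three
   shears have slopes [a], [- s] and [a]. *)
move=> cs s0 mK K0; pose a := (1 - c) / s.
have as_ : a * s = 1 - c by rewrite /a divfK.
have aas : 2 * a - a * a * s = s.
  apply: (mulIf s0).
  rewrite (_ : _ * s = 2 * (a * s) - (a * s) ^+ 2); last by ring.
  by rewrite as_; move: cs; nra.
have mshl : measurable_fun setT (fun z : R * R => (z.1 + a * z.2, z.2)).
  apply: measurable_fun_pair => //.
  by apply: measurable_funD => //; exact: measurable_funM.
have mshr : measurable_fun setT (fun z : R * R => (z.1, z.2 + (- s) * z.1)).
  apply: measurable_fun_pair => //.
  by apply: measurable_funD => //; exact: measurable_funM.
have E1 := iterated_shearl a mK K0.
have mK2 := measurableT_comp mK mshl.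
have E2 := iterated_shearr (- s) mK2 (fun z => K0 _).
have E3 := iterated_shearl a (measurableT_comp mK2 mshr) (fun z => K0 _).
apply: etrans (etrans E3 (etrans E2 E1)).
apply: eq_integral => x _; apply: eq_integral => y _; congr (K _) => /=.
congr pair.
  rewrite -[in X in _ + X * _]aas.
  rewrite (_ : c = 1 - a * s); last by rewrite as_; ring.
  by ring.
by rewrite (_ : c = 1 - a * s); last (by rewrite as_; ring); ring.
Qed.

(** The joint density is a function of [x ^ 2 + y ^ 2]. Once both sides are written as iterated
    Lebesgue integrals against it, rotation invariance of the latter concludes. *)
Lemma normal2_rotation (c s : R) (C : set (R * R)) :
  c ^+ 2 + s ^+ 2 = 1 -> s != 0 -> measurable C ->
  (gam \x gam)%E [set z | C (c * z.1 + s * z.2, c * z.2 - s * z.1)] =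
  (gam \x gam)%E C.
Proof.
move=> cs s0 mC.
have rho0 x : 0 <= rho x by exact: normal_pdf_ge0.
have mrho : measurable_fun setT rho by exact: measurable_normal_pdf.
have key (D : set (R * R)) : measurable D -> (gam \x gam)%E D =
    (\int[leb]_x \int[leb]_y ((\1_D (x, y) * (rho x * rho y))%:E))%E.
  move=> mD.
  have mI : measurable_fun setT (fun z : R * R => (\1_D z : R)).
    exact: measurable_indic.
  have mIx x : measurable_fun setT (fun y : R => (\1_D (x, y) : R)).
    exact: measurable_fun_pair2.
  have I1 z : `|\1_D z : R| <= 1.
    by rewrite ger0_norm// indicE; case: (_ \in _).
  have -> : (gam \x gam)%E D = (\int[gam \x gam]_z (\1_D z)%:E)%E.
    have := @integral_indic _ _ R (gam \x gam)%E setT measurableT D mD.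
    by rewrite setIT => ->.
  have mEI : measurable_fun setT (fun z : R * R => (\1_D z : R)%:E).
    exact/measurable_EFinP.
  have EI0 z : (0 <= (\1_D z : R)%:E)%E by rewrite lee_fin.
  rewrite (@fubini_tonelli1 _ _ _ _ R gam gam _ mEI EI0) /fubini_F.
  have E x : (\int[gam]_y (\1_D (x, y))%:E =
      (Ex gam (fun y => \1_D (x, y)))%:E)%E.
    rewrite /Ex /Rintegral fineK// ge0_fin_numE; last first.
      by apply: integral_ge0 => y _; rewrite lee_fin.
    have [_ /(_ 1%N)] := tame_bnd gam (mIx x) (fun y => I1 (x, y)).
    apply: le_lt_trans; apply: ge0_le_integral => //.
    - by apply/measurable_EFinP; exact: mIx.
    - by apply/measurable_EFinP; apply: measurable_funX; exact: measurableT_comp (mIx x).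
    - by move=> y _; rewrite expr1 ger0_norm.
  under eq_integral do rewrite E.
  rewrite integral_normal_ge0; last 2 first.
  - have H := @measurable_fun_fubini_tonelli_F _ _ _ _ R gam _ mEI EI0.
    apply/measurable_EFinP; rewrite (_ : EFin \o _ = fubini_F gam
      (fun z : R * R => (\1_D z : R)%:E)); first exact: H.
    by apply/funext => x; exact: esym (E x).
  - by move=> x; exact: Ex_ge0.
  apply: eq_integral => x _; rewrite -E integral_normal_ge0//.
  rewrite -ge0_integralZr//; last 3 first.
  - by apply: emeasurable_funM; apply/measurable_EFinP; [exact: mIx|exact: mrho].
  - by move=> y _; rewrite -EFinM lee_fin mulr_ge0.
  - by rewrite lee_fin.
  by apply: eq_integral => y _; rewrite -!EFinM; congr EFin; ring.
have mT : measurable_fun setT (fun z : R * R => (c * z.1 + s * z.2, c * z.2 - s * z.1)).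
  apply: measurable_fun_pair.
    by apply: measurable_funD => //; exact: measurable_funM.
  by apply: measurable_funB => //; exact: measurable_funM.
have mTC : measurable [set z | C (c * z.1 + s * z.2, c * z.2 - s * z.1)].
  by rewrite -[X in measurable X]setTI; exact: mT.
pose K (z : R * R) := (\1_C z * (rho z.1 * rho z.2))%:E.
have mK : measurable_fun setT K.
  apply/measurable_EFinP; apply: measurable_funM; first exact: measurable_indic.
  by apply: measurable_funM; exact: measurableT_comp.
have K0 z : (0 <= K z)%E by rewrite lee_fin !mulr_ge0.
apply: (etrans (key _ mTC)); apply: etrans (esym (key _ mC)).
apply: etrans (iterated_rotation cs s0 mK K0).
apply: eq_integral => x _; apply: eq_integral => y _; congr EFin => /=.
congr (_ * _).
rewrite normal_pdfE ?oner_neq0//.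
rewrite [LHS]mulrACA [RHS]mulrACA; congr (_ * _).
rewrite /normal_fun -!expRD; congr expR.
rewrite !subr0 -!mulrDl; congr (_ / _).
rewrite -!opprD; congr (- _).
rewrite -[LHS]mul1r -cs; ring.
Qed.

End normal_rotation.

(** * Sums, reindexing and plane rotations of Gaussian families *)

Section gauss_constructions.
Context (R : realType).
Local Notation gam := (@normal_prob R 0 1).

Lemma gauss_iid (d : measure_display) (Om : measurableType d)
    (P : probability Om R) (I : finType) (Z : I -> {RV P >-> R}) :
  iid_std_normal Z -> gauss P (fun i => Z i : Om -> R).
Proof.
move=> [ind lZ]; split=> [i|B mB]; first exact: measurable_funP.
rewrite (_ : [set om | _] = \bigcap_(i in [set` [set: I]%SET]) (Z i @^-1` B i)).
  rewrite ind//; apply: eq_big => [i|i _]; first by rewrite inE.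
  exact: lZ.
by apply/seteqP; split => om /= H i => [_|]; [exact: H|apply: (H i); rewrite /= inE].
Qed.

Lemma gauss_sum (d : measure_display) (Om : measurableType d)
    (P : probability Om R) (d' : measure_display) (Om' : measurableType d')
    (P' : probability Om' R) (I J : finType) (Z : I -> Om -> R)
    (Z' : J -> Om' -> R) :
  gauss P Z -> gauss P' Z' ->
  gauss (P \x P')%E (fun k : I + J => match k with
    inl i => fun xy => Z i xy.1 | inr j => fun xy => Z' j xy.2 end).
Proof.
move=> [mZ lZ] [mZ' lZ']; split=> [[i|j]|B mB].
- exact: (measurableT_comp (mZ i) measurable_fst).
- exact: (measurableT_comp (mZ' j) measurable_snd).
rewrite (_ : [set om | _] =
  [set om | forall i, B (inl i) (Z i om)] `*`
  [set om | forall j, B (inr j) (Z' j om)]); last first.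
  apply/seteqP; split => om /= => [H|[H1 H2]].
    by split => [i|j]; [exact: (H (inl i))|exact: (H (inr j))].
  by move=> [i|j]; [exact: H1|exact: H2].
have mA : measurable [set om | forall i, B (inl i) (Z i om)].
  exact: (measurable_rect mZ (fun i => mB (inl i))).
have mA' : measurable [set om | forall j, B (inr j) (Z' j om)].
  exact: (measurable_rect mZ' (fun i => mB (inr i))).
apply: etrans (@product_measure1E _ _ _ _ R P P' _ _ mA mA') _.
by rewrite big_sumType/= -lZ// -lZ'.
Qed.

Lemma gauss_reindex (d : measure_display) (Om : measurableType d)
    (P : probability Om R) (I J : finType) (f : J -> I) (Z : I -> Om -> R) :
  injective f -> gauss P Z -> gauss P (fun j => Z (f j)).
Proof.
move=> fI [mZ lZ]; split=> [j|B mB]; first exact: mZ.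
pose C i := if [pick j | f j == i] is Some j then B j else setT.
have CE j : C (f j) = B j.
  rewrite /C; case: pickP => [k /eqP /fI ->//|/(_ j)]; by rewrite eqxx.
have mC i : measurable (C i) by rewrite /C; case: pickP.
rewrite (_ : [set om | _] = [set om | forall i, C i (Z i om)]); last first.
  apply/seteqP; split => om /= H k; last by rewrite -CE.
  by rewrite /C; case: pickP => // j /eqP <-.
rewrite lZ// (bigID (fun i => i \in codom f))/= [X in (_ * X)%E]big1 ?mule1; last first.
  move=> i iN; rewrite /C; case: pickP => [j /eqP fj|_].
    by rewrite -fj codom_f in iN.
  exact: probability_setT.
rewrite (reindex_omap f (fun i => [pick j | f j == i])) => [|i /codomP[j ->]].
  apply: eq_big => [j|j _]; last by rewrite CE.
  rewrite codom_f/=; case: pickP => [k /eqP /fI ->|/(_ j)]; by rewrite eqxx.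
by case: pickP => [k /eqP /= ->//|/(_ j)]; rewrite eqxx.
Qed.

Lemma gauss_normal : gauss gam (fun (_ : unit) (x : R) => x).
Proof.
split=> [i|B mB]; first exact: measurable_id.
rewrite (big_pred1 tt) => [|[]//].
by congr normal_prob; apply/seteqP; split => x /=; [exact|move=> H []].
Qed.

Lemma mfunI_comp (I J : finType) (F : (I -> R) -> R) (h : (J -> R) -> (I -> R)) :
  mfunI F -> (forall i, mfunI (fun g => h g i)) -> mfunI (F \o h).
Proof.
move=> mF mh d Om Z mZ; apply: (mF d Om (fun i om => h (Z^~ om) i)) => i.
exact: mh.
Qed.

Definition rotg (J : eqType) (a b : J) (c s : R) (g : J -> R) (j : J) : R :=
  if j == a then c * g a + s * g b
  else if j == b then c * g b - s * g a else g j.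

(** Replacing the coordinates [a] and [b] by a fresh pair living on the plane does not change the
    law of the family. Rotating the fresh pair concerns [gam \x gam] alone, where [normal2_rotation]
    applies. *)
Lemma gauss_rot (d : measure_display) (Om : measurableType d)
    (P : probability Om R) (J : finType) (Z : J -> Om -> R) (a b : J) (c s : R) :
  a != b -> c ^+ 2 + s ^+ 2 = 1 -> s != 0 ->
  gauss P Z -> gauss P (fun j om => rotg a b c s (Z^~ om) j).
Proof.
move=> ab cs s0 gZ; have [mZ lZ] := gZ.
have mrot j : mfunI (fun g : J -> R => rotg a b c s g j).
  move=> d1 Om1 Z1 mZ1; rewrite /rotg; case: eqP => _.
    by apply: measurable_funD => //; exact: measurable_funM.
  case: eqP => _ //.
  by apply: measurable_funB => //; exact: measurable_funM.
split=> [j|B mB]; first exact: mrot.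
have g2 : gauss (gam \x gam)%E (fun k : unit + unit =>
    match k with inl _ => fun z => z.1 | inr _ => fun z => z.2 end).
  have := gauss_sum gauss_normal gauss_normal.
  by congr (gauss _ _); apply/funext => -[].
have g2r : gauss (gam \x gam)%E (fun k : unit + unit => match k with
    inl _ => fun z => c * z.1 + s * z.2 | inr _ => fun z => c * z.2 - s * z.1 end).
  split=> [[]|B2 mB2] => [[]|[]|].
  - by apply: measurable_funD => //; exact: measurable_funM.
  - by apply: measurable_funB => //; exact: measurable_funM.
  pose D := [set z : R * R | B2 (inl tt) z.1 /\ B2 (inr tt) z.2].
  have mD : measurable D.
    rewrite (_ : D = B2 (inl tt) `*` B2 (inr tt)); first exact: measurableX.
    by apply/seteqP; split.
  have E1 : [set z : R * R | forall k : unit + unit, B2 k (match k with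
      inl _ => c * z.1 + s * z.2 | inr _ => c * z.2 - s * z.1 end)] =
      [set z | D (c * z.1 + s * z.2, c * z.2 - s * z.1)].
    by apply/seteqP; split => z /= => [H|[H1 H2] [[]|[]]//];
      split; [exact: (H (inl tt))|exact: (H (inr tt))].
  have E2 : [set z : R * R | forall k : unit + unit, B2 k (match k with
      inl _ => z.1 | inr _ => z.2 end)] = D.
    by apply/seteqP; split => z /= => [H|[H1 H2] [[]|[]]//];
      split; [exact: (H (inl tt))|exact: (H (inr tt))].
  rewrite (_ : [set om | _] = [set z | D (c * z.1 + s * z.2, c * z.2 - s * z.1)]); last first.
    by rewrite -E1; apply/seteqP; split => z /= H [[]|[]];
      [exact: (H (inl tt))|exact: (H (inr tt))|exact: (H (inl tt))|exact: (H (inr tt))].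
  apply: etrans (normal2_rotation cs s0 mD) _.
  have := g2.2 B2 mB2; rewrite (_ : [set om | _] = D) //.
  by rewrite -E2; apply/seteqP; split => z /= H [[]|[]];
      [exact: (H (inl tt))|exact: (H (inr tt))|exact: (H (inl tt))|exact: (H (inr tt))].
(* [f] sends [a] and [b] to the two fresh coordinates and keeps the others. [G1] then has the fresh
   pair unrotated, [G2] has it rotated, and rotating [G1] gives [G2]. *)
pose f (j : J) : J + (unit + unit) :=
  if j == a then inr (inl tt) else if j == b then inr (inr tt) else inl j.
have fI : injective f.
  move=> j k; rewrite /f.
  case: (eqVneq j a) => [->|ja]; case: (eqVneq k a) => [->|ka] //.
  - by case: ifP.
  - by case: ifP.
  case: (eqVneq j b) => [->|jb]; case: (eqVneq k b) => [->|kb] //.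
  by case.
have G1 := gauss_reindex fI (gauss_sum gZ g2).
have G2 := gauss_reindex fI (gauss_sum gZ g2r).
pose A := [set g : J -> R | forall j, B j (rotg a b c s g j)].
have mA : mfunI (fun g => \1_A g : R).
  move=> d1 Om1 Z1 mZ1.
  rewrite (_ : (fun om => _) = \1_[set om | forall j, B j (rotg a b c s (Z1^~ om) j)]).
    by apply: measurable_indic; apply: measurable_rect => // j; exact: mrot.
  by apply/funext => om; rewrite !indicE; congr ((nat_of_bool _)%:R); apply/idP/idP;
    rewrite !inE.
have PA (d1 : measure_display) (Om1 : measurableType d1) (P1 : probability Om1 R)
    (Z1 : J -> Om1 -> R) : (forall j, measurable_fun setT (Z1 j)) ->
    P1 [set om | forall j, B j (rotg a b c s (Z1^~ om) j)] =
    (\int[P1]_om (\1_A (Z1^~ om))%:E)%E.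
  move=> mZ1.
  have mS : measurable [set om | forall j, B j (rotg a b c s (Z1^~ om) j)].
    by apply: measurable_rect => // j; exact: mrot.
  have := @integral_indic _ _ R P1 setT measurableT _ mS; rewrite setIT => <-.
  by apply: eq_integral => om _; rewrite !indicE; congr ((nat_of_bool _)%:R%:E);
    apply/idP/idP; rewrite !inE.
rewrite PA// (gauss_law_ge0 gZ G1 mA); last by move=> g; rewrite indicE.
rewrite -PA; last by case: G1.
have GB := G2.2 B mB.
rewrite (_ : [set om | forall j, B j (rotg a b c s _ j)] =
  [set om | forall j, B j (match f j with
    | inl i => fun xy : Om * (R * R) => Z i xy.1
    | inr k => fun xy => (match k with
        inl _ => fun z : R * R => c * z.1 + s * z.2
      | inr _ => fun z => c * z.2 - s * z.1 end) xy.2 end om)]) //.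
have fa : f a = inr (inl tt) by rewrite /f eqxx.
have fb : f b = inr (inr tt) by rewrite /f eq_sym (negbTE ab) eqxx.
apply/seteqP; split => z /= H j; move: (H j); rewrite /rotg fa fb /f;
  by case: (j == a) => //; case: (j == b).
Qed.

End gauss_constructions.

(** * Moments of Gaussian coordinates and simultaneous rotations *)

Section gauss_moments.
Context (R : realType).
Local Notation gam := (@normal_prob R 0 1).

Lemma exprn_le_expR (k : nat) (y : R) : 0 <= y -> y ^+ k <= k%:R ^+ k * expR y.
Proof.
move=> y0; case: k => [|k]; first by rewrite !expr0 mul1r -expR0 ler_expR.
have -> : y = k.+1%:R * (y / k.+1%:R) by rewrite mulrC divfK.
rewrite exprMn ler_pM2l ?exprn_gt0// expRM_natl.
rewrite lerXn2r ?nnegrE ?divr_ge0 ?expR_ge0//.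
by apply: le_trans (expR_ge1Dx _); rewrite lerDr.
Qed.

Lemma tame_normal : tame gam (fun x : R => x).
Proof.
split=> [|k]; first exact: measurable_id.
have mk : measurable_fun setT (fun x : R => `|x| ^+ k).
  by apply: measurable_funX.
rewrite integral_normal_ge0//.
(* The integrand is dominated by [C] times the density of standard deviation 2. The inequality
   [|x| - x^2/2 <= 2 - x^2/8] comes from the square of [3 |x| - 4], and the quotient of the peaks
   exchanges the normalisations. *)
pose C : R := k%:R ^+ k * expR 2 * (normal_peak 1 / normal_peak 2).
have mpdf s : measurable_fun setT (fun x : R => normal_pdf 0 s x).
  exact: measurable_normal_pdf.
have C0 : 0 <= C.
  by rewrite !mulr_ge0 ?exprn_ge0 ?expR_ge0 ?invr_ge0 ?normal_peak_ge0.
apply: (@le_lt_trans _ _ (\int[lebesgue_measure]_x (C%:E * (normal_pdf 0 2 x)%:E))%E).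
  apply: ge0_le_integral => //.
  - by move=> x _; rewrite -EFinM lee_fin mulr_ge0 ?exprn_ge0// normal_pdf_ge0.
  - by apply: emeasurable_funM; apply/measurable_EFinP; [exact: mk|exact: mpdf].
  - by apply: emeasurable_funM; apply/measurable_EFinP => //; exact: mpdf.
  move=> x _; rewrite -!EFinM lee_fin.
  rewrite !normal_pdfE ?oner_neq0 ?pnatr_eq0// /C.
  rewrite -[leRHS]mulrA [X in _ <= _ * X]mulrA divfK; last first.
    by rewrite gt_eqF// normal_peak_gt0 ?pnatr_eq0.
  rewrite mulrCA [leRHS]mulrCA ler_pM2l ?normal_peak_gt0 ?oner_neq0//.
  apply: (@le_trans _ _ (k%:R ^+ k * expR `|x| * normal_fun 0 1 x)).
    by rewrite ler_wpM2r ?expR_ge0// exprn_le_expR.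
  rewrite -!mulrA ler_wpM2l ?exprn_ge0// -!expRD ler_expR.
  have x2 : `|x| ^+ 2 = x ^+ 2 by rewrite real_normK ?num_real.
  have e1 : (1 ^+ 2 *+ 2 : R)^-1 = 2^-1 by rewrite expr1n.
  have e2 : (2 ^+ 2 *+ 2 : R)^-1 = 8^-1 by rewrite expr2 -natrM -mulrnA.
  have := sqr_ge0 (3 * `|x| - 4); rewrite !subr0 -x2 e1 e2; lra.
rewrite ge0_integralZl//; last 2 first.
- by apply/measurable_EFinP; exact: mpdf.
- by move=> x _; rewrite lee_fin normal_pdf_ge0.
by rewrite integral_normal_pdf mule1 ltry.
Qed.

Lemma tame_coord (d : measure_display) (Om : measurableType d)
    (P : probability Om R) (I : finType) (Z : I -> Om -> R) (i : I) :
  gauss P Z -> tame P (Z i).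
Proof.
move=> gZ.
have fI : injective (fun _ : unit => i) by case=> -[].
have gZi := gauss_reindex fI gZ.
have m1 : mfunI (fun g : unit -> R => g tt) by move=> ? ? ?; apply.
exact: (tame_law (gauss_normal R) gZi m1 tame_normal).
Qed.

Definition rotall (I : Type) (c s : R) (g : I + I -> R) (k : I + I) : R :=
  match k with
  | inl i => c * g (inl i) + s * g (inr i)
  | inr i => c * g (inr i) - s * g (inl i)
  end.

(** The planes of [inl i] and [inr i] are disjoint for distinct [i], so they are rotated one after
    the other along a list of indices. *)
Lemma gauss_rotall (d : measure_display) (Om : measurableType d)
    (P : probability Om R) (I : finType) (Z : I + I -> Om -> R) (c s : R) :
  c ^+ 2 + s ^+ 2 = 1 -> s != 0 ->
  gauss P Z -> gauss P (fun k om => rotall c s (Z^~ om) k).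
Proof.
move=> cs s0 gZ.
pose part (l : seq I) (k : I + I) om :=
  if (match k with inl i => i | inr i => i end) \in l
  then rotall c s (Z^~ om) k else Z k om.
suff H (l : seq I) : uniq l -> gauss P (part l).
  have -> : (fun k om => rotall c s (Z^~ om) k) = part (enum I).
    by apply/funext => k; apply/funext => om; rewrite /part; case: k => i; rewrite mem_enum.
  by apply: H; exact: enum_uniq.
elim: l => [_|i l IH /= /andP[il ul]]; first by rewrite (_ : part [::] = Z).
have ab : inl i != inr i :> I + I by [].
have := gauss_rot ab cs s0 (IH ul).
congr (gauss _ _); apply/funext => k; apply/funext => om; rewrite /rotg /part (negbTE il).
case: k => j; rewrite !inE.
  rewrite (_ : (inl j == inl i :> I + I) = (j == i)) // orbC.
  by case: (eqVneq j i) => [->|_]; rewrite ?orbT ?orbF.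
rewrite (_ : (inr j == inr i :> I + I) = (j == i)) // orbC.
by case: (eqVneq j i) => [->|_]; rewrite ?orbT ?orbF.
Qed.

End gauss_moments.

(** * Product spaces and Fubini *)

Section products.
Context (R : realType) (d : measure_display) (Om : measurableType d)
  (P : probability Om R) (d' : measure_display) (Om' : measurableType d')
  (P' : probability Om' R).
Local Notation PP := (P \x P')%E.

Lemma tame_fst f : tame P f -> tame PP (fun z => f z.1).
Proof.
move=> [mf fi]; split=> [|k]; first exact: (measurableT_comp mf measurable_fst).
have m1 : measurable_fun setT (fun z : Om * Om' => (`|f z.1| ^+ k)%:E).
  apply/measurable_EFinP; apply: measurable_funX; apply: measurableT_comp => //.
  exact: (measurableT_comp mf measurable_fst).
rewrite (@fubini_tonelli1 _ _ _ _ R P P' _ m1); last by move=> z; rewrite lee_fin exprn_ge0.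
rewrite /fubini_F/=; under eq_integral do rewrite integral_cst//= probability_setT mule1.
exact: fi.
Qed.

Lemma tame_snd f : tame P' f -> tame PP (fun z => f z.2).
Proof.
move=> [mf fi]; split=> [|k]; first exact: (measurableT_comp mf measurable_snd).
have m1 : measurable_fun setT (fun z : Om * Om' => (`|f z.2| ^+ k)%:E).
  apply/measurable_EFinP; apply: measurable_funX; apply: measurableT_comp => //.
  exact: (measurableT_comp mf measurable_snd).
rewrite (@fubini_tonelli1 _ _ _ _ R P P' _ m1); last by move=> z; rewrite lee_fin exprn_ge0.
by rewrite /fubini_F/= integral_cst//= probability_setT mule1; exact: fi.
Qed.

(** The inner expectation is asserted to be integrable rather than tame; that is enough to compare
    outer integrals. *)
Lemma Ex_fubini F : tame PP F -> (forall x, tame P' (fun y => F (x, y))) ->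
  P.-integrable setT (EFin \o (fun x => Ex P' (fun y => F (x, y)))) /\
  Ex PP F = Ex P (fun x => Ex P' (fun y => F (x, y))).
Proof.
move=> tF tFx.
have iF := tame_integrable tF.
have E x : (Ex P' (fun y => F (x, y)))%:E = fubini_F P' (EFin \o F) x.
  rewrite /Ex /Rintegral fineK//; apply: integrable_fin_num => //.
  exact: tame_integrable (tFx x).
have Ef : EFin \o (fun x => Ex P' (fun y => F (x, y))) = fubini_F P' (EFin \o F).
  by apply/funext => x; rewrite -E.
split; first by rewrite Ef; exact: (@integrable_fubini_F _ _ _ _ R P P' _ iF).
rewrite {1}/Ex /Rintegral -(@integral12_prod_meas1 _ _ _ _ R P P' _ iF).
by rewrite [RHS]/Ex /Rintegral -Ef.
Qed.

Lemma Ex_fubini_le F r : tame PP F -> (forall x, tame P' (fun y => F (x, y))) ->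
  (forall x, Ex P' (fun y => F (x, y)) <= r) -> Ex PP F <= r.
Proof.
move=> tF tFx Fr; have [iF ->] := Ex_fubini tF tFx.
rewrite -[leRHS](Ex_cst P); apply: le_Rintegral => //.
exact: tame_integrable (tame_cst P r).
Qed.

Lemma Ex_indep f g : tame P f -> tame P' g ->
  Ex PP (fun z => f z.1 * g z.2) = Ex P f * Ex P' g.
Proof.
move=> tf tg.
have [_ ->] := Ex_fubini (tameM (tame_fst tf) (tame_snd tg))
  (fun x => tameZ (f x) tg).
by under eq_fun do rewrite /= ExZ//; rewrite ExZr.
Qed.

Lemma Ex_fst f : tame P f -> Ex PP (fun z => f z.1) = Ex P f.
Proof.
move=> tf; rewrite -[RHS]mulr1 -(Ex_cst P' 1) -(Ex_indep tf (tame_cst P' 1)).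
by congr Ex; apply/funext => z; rewrite mulr1.
Qed.

Lemma Ex_snd f : tame P' f -> Ex PP (fun z => f z.2) = Ex P' f.
Proof.
move=> tf; rewrite -[RHS]mul1r -(Ex_cst P 1) -(Ex_indep (tame_cst P 1) tf).
by congr Ex; apply/funext => z; rewrite mul1r.
Qed.

End products.

Section trig.
Context (R : realType).

Lemma sin_le_id (h : R) : 0 <= h -> sin h <= h.
Proof.
move=> h0.
have [x _] := @MVT_segment R sin cos 0 h h0 (fun x _ => is_derive_sin x)
  (continuous_subspaceT (@continuous_sin R)).
by rewrite sin0 !subr0 => ->; rewrite ler_piMl// cos_le1.
Qed.

Lemma onem_cos_le (h : R) : 0 <= h <= 1 -> 0 <= 1 - cos h <= h ^+ 2.
Proof.
move=> /andP[h0 h1]; rewrite subr_ge0 cos_le1/=.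
have hh : 0 <= h / 2 by rewrite divr_ge0.
have := sin_le_id hh.
have := sin_ge0_pi (x := h / 2).
have -> : cos h = 1 - 2 * sin (h / 2) ^+ 2.
  rewrite [in LHS](_ : h = h / 2 + h / 2); last by field.
  by have := cos2Dsin2 (h / 2); rewrite cosD; lra.
have := pi_ge2 R; move=> p2 H /[dup] sl; rewrite hh/= in H.
have := H; case: leP => //= [_ /(_ isT) s0 _|hp _ _]; last by lra.
nra.
Qed.

End trig.

Section second_moments.
Context (R : realType) (d : measure_display) (Om : measurableType d)
  (P : probability Om R) (I : finType) (Z : I -> Om -> R).
Hypothesis gZ : gauss P Z.

(** Its value is 1; it is carried as a symbol inside the constants. *)
Definition normal_var : R := Ex (@normal_prob R 0 1) (fun x => x ^+ 2).

Lemma Ex_coord_sqr i : Ex P (fun om => Z i om ^+ 2) = normal_var.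
Proof.
have fI : injective (fun _ : unit => i) by case=> -[].
have gZi := gauss_reindex fI gZ.
have m1 : mfunI (fun g : unit -> R => g tt ^+ 2).
  by move=> d1 Om1 Z1 mZ1; apply: measurable_funX.
exact: (Ex_law gZi (gauss_normal R) m1 (tame_sqr (tame_coord i gZ))).
Qed.

(** A quarter turn sends the pair of coordinates [(x, y)] to [(y, - x)], preserving the law and
    changing the sign of the product. *)
Lemma Ex_coord_mul i j : i != j -> Ex P (fun om => Z i om * Z j om) = 0.
Proof.
move=> ij.
have cs : (0 : R) ^+ 2 + 1 ^+ 2 = 1 by rewrite expr0n expr1n add0r.
have gZr := gauss_rot ij cs (oner_neq0 _) gZ.
have m1 : mfunI (fun g : I -> R => g i * g j).
  by move=> d1 Om1 Z1 mZ1; apply: measurable_funM.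
have tZ := tameM (tame_coord i gZ) (tame_coord j gZ).
have := Ex_law gZ gZr m1 tZ.
have -> : (fun om : Om => rotg i j 0 1 (Z^~ om) i * rotg i j 0 1 (Z^~ om) j) =
          (fun om => - (Z i om * Z j om)).
  apply/funext => om; rewrite /rotg !eqxx eq_sym (negbTE ij).
  ring.
by rewrite ExN//; set e := Ex _ _; lra.
Qed.

End second_moments.

Lemma sqr_sum_le (R : realType) (n : nat) (a : 'I_n -> R) :
  (\sum_i a i) ^+ 2 <= n%:R * \sum_i a i ^+ 2.
Proof.
elim: n a => [a|n IH a]; first by rewrite !big_ord0 expr0n mulr0.
rewrite !big_ord_recr/=; have := IH (fun i => a (widen_ord (leqnSn n) i)).
set S := \sum_i _; set Q := \sum_i _; set x := a _ => SQ.
have Q0 : 0 <= Q by apply: sumr_ge0 => i _; exact: sqr_ge0.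
rewrite -natr1; have [n0|n0] := posnP n.
  by rewrite n0 mul0r in SQ *; nra.
have n1 : 0 < n%:R :> R by rewrite ltr0n.
rewrite -(ler_pM2l n1); have := sqr_ge0 (S - n%:R * x); nra.
Qed.

(** * Gaussian Poincare inequality *)

Section poincare.
Context (R : realType) (I : finType).

Definition wt1 (x : I -> R) : R := 1 + \sum_i x i ^+ 2.

Lemma wt1_ge1 x : 1 <= wt1 x.
Proof. by rewrite lerDl sumr_ge0// => i _; exact: sqr_ge0. Qed.

Lemma wt1_ge0 x : 0 <= wt1 x.
Proof. exact: le_trans ler01 (wt1_ge1 x). Qed.

Variables (F : (I -> R) -> R) (G : I -> (I -> R) -> R) (K : R) (k : nat).
Hypotheses (mF : mfunI F) (mG : forall i, mfunI (G i)).
Hypothesis (K0 : 0 <= K).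
Hypothesis (Gb : forall i x, `|G i x| <= K * wt1 x ^+ k).
Hypothesis (FG : forall x y, `|F y - F x - \sum_i G i x * (y i - x i)| <=
  K * (wt1 x + wt1 y) ^+ k * \sum_i (y i - x i) ^+ 2).
Context (d : measure_display) (Om : measurableType d)
  (P : probability Om R) (Z : I -> Om -> R).
Hypothesis gZ : gauss P Z.

Lemma tame_wt1 (d1 : measure_display) (Om1 : measurableType d1)
    (P1 : probability Om1 R) (Z1 : I -> Om1 -> R) :
  (forall i, tame P1 (Z1 i)) -> tame P1 (fun om => wt1 (Z1^~ om)).
Proof.
move=> tZ; apply: tameD; first exact: tame_cst.
by apply: tame_sum => i; exact: tame_sqr.
Qed.

Lemma tame_poincare_fun (d1 : measure_display) (Om1 : measurableType d1)
    (P1 : probability Om1 R) (Z1 : I -> Om1 -> R) :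
  (forall i, tame P1 (Z1 i)) -> tame P1 (fun om => F (Z1^~ om)).
Proof.
move=> tZ; have tw := tame_wt1 tZ.
pose B om := `|F 0| + (\sum_i `|G i 0| * `|Z1 i om|
  + K * (wt1 0 + wt1 (Z1^~ om)) ^+ k * wt1 (Z1^~ om)).
have tB : tame P1 B.
  apply: tameD; first exact: tame_cst.
  apply: tameD; first by apply: tame_sum => i; apply: tameZ; exact: tame_abs.
  by apply: tameM => //; apply: tameZ; apply: tameX; apply: tameD => //; exact: tame_cst.
apply: tame_dom tB _; first by apply: mF => i; exact: tame_measurable.
move=> om; apply: le_trans (ler_norm _).
have := FG 0 (Z1^~ om).
set S := \sum_i G i 0 * _; set Q := \sum_i (_ - _) ^+ 2 => H.
have -> : F (Z1^~ om) = F 0 + (S + (F (Z1^~ om) - F 0 - S)) by ring.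
apply: le_trans (ler_normD _ _) _; rewrite lerD2l.
apply: le_trans (ler_normD _ _) _; apply: lerD.
  apply: le_trans (ler_norm_sum _ _ _) _; apply: ler_sum => i _.
  by rewrite normrM subr0.
apply: le_trans H _; apply: ler_wpM2l.
  by rewrite mulr_ge0// exprn_ge0// addr_ge0// wt1_ge0.
rewrite /wt1 -[leLHS]add0r lerD//; apply: ler_sum => i _; by rewrite subr0.
Qed.

Let PP := (P \x P)%E.

Lemma tame_poincare_grad i (d1 : measure_display) (Om1 : measurableType d1)
    (P1 : probability Om1 R) (Z1 : I -> Om1 -> R) :
  (forall i, tame P1 (Z1 i)) -> tame P1 (fun om => G i (Z1^~ om)).
Proof.
move=> tZ; apply: tame_dom (tameZ K (tameX k (tame_wt1 tZ))) _.
  by apply: mG => j; exact: tame_measurable.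
by move=> om; apply: le_trans (Gb _ _) (ler_norm _).
Qed.

Let tZ i : tame P (Z i) := tame_coord i gZ.
Let Z1 i (z : Om * Om) : R := Z i z.1.
Let Z2 i (z : Om * Om) : R := Z i z.2.
Let tZ1 i : tame PP (Z1 i) := tame_fst P (tZ i).
Let tZ2 i : tame PP (Z2 i) := tame_snd P (tZ i).

(** The gradient is evaluated at the first copy and the direction is the second one. By independence
    the expectation factors term by term, and the off-diagonal terms vanish with [E (Z_i Z_j)]. *)
Lemma Ex_grad_dir :
  Ex PP (fun z => (\sum_i G i (Z1^~ z) * Z2 i z) ^+ 2) =
  normal_var R * Ex P (fun om => \sum_i G i (Z^~ om) ^+ 2).
Proof.
have tG i := tame_poincare_grad i tZ.
rewrite (_ : (fun z => _) = fun z => \sum_i \sum_j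
  (G i (Z^~ z.1) * G j (Z^~ z.1)) * (Z i z.2 * Z j z.2)); last first.
  apply/funext => z; rewrite expr2 big_distrlr/=.
  by apply: eq_bigr => i _; apply: eq_bigr => j _; rewrite mulrACA.
have tGG i j := tameM (tG i) (tG j).
have tZZ i j := tameM (tZ i) (tZ j).
have tT i j := tameM (tame_fst P (tGG i j)) (tame_snd P (tZZ i j)).
rewrite Ex_sum; last by move=> i; exact: tame_sum.
rewrite Ex_sum; last by move=> i; exact: tame_sqr.
rewrite mulr_sumr; apply: eq_bigr => i _.
rewrite Ex_sum// (bigD1 i)//= big1 ?addr0; last first.
  move=> j ji; apply: etrans (Ex_indep (tGG i j) (tZZ i j)) _.
  by rewrite (Ex_coord_mul gZ) ?mulr0// eq_sym.
apply: etrans (Ex_indep (tGG i i) (tZZ i i)) _.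
by rewrite mulrC; congr (_ * _); rewrite -(Ex_coord_sqr gZ i).
Qed.

Let increment (h : R) (z : Om * Om) :=
  F (fun i => cos h * Z1 i z + sin h * Z2 i z) - F (Z1^~ z).

(** What multiplies [h ^ 2] in the increment. The first term comes from [1 - cos h], the second from
    the Taylor remainder: [1 + 2 (wt1 Z1 + wt1 Z2)] bounds the weight of the rotated point, and
    [2 (wt1 Z1 + wt1 Z2) h ^ 2] bounds the squared displacement. *)
Let step_remainder (z : Om * Om) : R :=
  `|\sum_i G i (Z1^~ z) * Z1 i z| +
  K * (wt1 (Z1^~ z) + (1 + 2 * (wt1 (Z1^~ z) + wt1 (Z2^~ z)))) ^+ k *
  (2 * (wt1 (Z1^~ z) + wt1 (Z2^~ z))).

Let tame_step_remainder : tame PP step_remainder.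
Proof.
have tw1 := tame_wt1 tZ1; have tw2 := tame_wt1 tZ2.
have tG i := tame_poincare_grad i tZ1.
have t12 := tameZ 2 (tameD tw1 tw2).
apply: tameD.
  by apply: tame_abs; apply: tame_sum => i; exact: tameM.
apply: tameM => //; apply: tameZ; apply: tameX; apply: tameD => //.
by apply: tameD => //; exact: tame_cst.
Qed.

(** The increment is [sin h] times the directional derivative along [Z2], up to [h ^ 2] times the
    remainder; then [(a + b)^2 <= 2 a^2 + 2 b^2]. *)
Let increment_bound h z : 0 <= h <= 1 ->
  increment h z ^+ 2 <= 2 * h ^+ 2 * (\sum_i G i (Z1^~ z) * Z2 i z) ^+ 2 +
    2 * h ^+ 4 * step_remainder z ^+ 2.
Proof.
move=> /[dup] h01 /andP[h0 h1].
have /andP[c0 c1] := onem_cos_le h01.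
have s1 := sin_le_id h0.
have s0 : 0 <= sin h.
  by apply: sin_ge0_pi; rewrite h0 (le_trans h1)// (le_trans _ (pi_ge2 R))// ler1n.
set B := \sum_i G i _ * Z2 i z; set V := step_remainder z.
pose y i := cos h * Z1 i z + sin h * Z2 i z.
pose A := \sum_i G i (Z1^~ z) * Z1 i z.
have yE i : y i - Z1 i z = - (1 - cos h) * Z1 i z + sin h * Z2 i z by rewrite /y; ring.
have SE : \sum_i G i (Z1^~ z) * (y i - Z1 i z) = - (1 - cos h) * A + sin h * B.
  rewrite !mulr_sumr -big_split/=; apply: eq_bigr => i _; rewrite yE; ring.
have h2 : 0 <= h ^+ 2 by exact: sqr_ge0.
have h21 : h ^+ 2 <= 1 by rewrite exprn_ile1.
have w1 := wt1_ge1 (Z1^~ z); have w2 := wt1_ge1 (Z2^~ z).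
have sq i : (y i - Z1 i z) ^+ 2 <= 2 * h ^+ 2 * (Z1 i z ^+ 2 + Z2 i z ^+ 2).
  rewrite yE; apply: (@le_trans _ _ (2 * ((1 - cos h) ^+ 2 * Z1 i z ^+ 2 + sin h ^+ 2 * Z2 i z ^+ 2))).
    have := sqr_ge0 ((1 - cos h) * Z1 i z + sin h * Z2 i z); nra.
  rewrite -mulrA ler_wpM2l// mulrDr lerD// ler_wpM2r ?sqr_ge0//.
    by apply: (@le_trans _ _ (1 - cos h)); nra.
  by rewrite lerXn2r ?nnegrE.
have sqS : \sum_i (y i - Z1 i z) ^+ 2 <= h ^+ 2 * (2 * (wt1 (Z1^~ z) + wt1 (Z2^~ z))).
  apply: (@le_trans _ _ (2 * h ^+ 2 * (\sum_i Z1 i z ^+ 2 + \sum_i Z2 i z ^+ 2))).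
    by rewrite -big_split mulr_sumr; apply: ler_sum => i _; exact: sq.
  rewrite [leRHS]mulrCA [leRHS]mulrA ler_wpM2l ?mulr_ge0//.
  by rewrite /wt1; lra.
have wy : wt1 y <= 1 + 2 * (wt1 (Z1^~ z) + wt1 (Z2^~ z)).
  rewrite [leLHS]/wt1 lerD2l.
  apply: (@le_trans _ _ (2 * (\sum_i Z1 i z ^+ 2 + \sum_i Z2 i z ^+ 2))).
    rewrite -big_split mulr_sumr; apply: ler_sum => i _ /=.
    have e : cos h ^+ 2 + sin h ^+ 2 = 1 := cos2Dsin2 h.
    rewrite /y; have := sqr_ge0 (cos h * Z1 i z - sin h * Z2 i z).
    have := sqr_ge0 (Z1 i z); have := sqr_ge0 (Z2 i z).
    have := sqr_ge0 (cos h); have := sqr_ge0 (sin h); nra.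
  by rewrite ler_wpM2l// /wt1; lra.
have incE : `|increment h z - sin h * B| <= h ^+ 2 * V.
  have := FG (Z1^~ z) y; rewrite SE -/(increment h z) => H.
  have -> : increment h z - sin h * B =
    (increment h z - (- (1 - cos h) * A + sin h * B)) + - (1 - cos h) * A by ring.
  apply: le_trans (ler_normD _ _) _; rewrite addrC /V /step_remainder mulrDr lerD//.
    by rewrite normrM normrN (ger0_norm c0) -/A ler_wpM2r.
  apply: le_trans H _.
  apply: (@le_trans _ _ (K * (wt1 (Z1^~ z) + (1 + 2 * (wt1 (Z1^~ z) + wt1 (Z2^~ z)))) ^+ k *
     (h ^+ 2 * (2 * (wt1 (Z1^~ z) + wt1 (Z2^~ z)))))); last by rewrite mulrCA.
  apply: ler_pM => //.
  - by rewrite mulr_ge0// exprn_ge0// addr_ge0// wt1_ge0.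
  - by apply: sumr_ge0 => i _; exact: sqr_ge0.
  have wy1 := wt1_ge1 y.
  by rewrite ler_wpM2l//; apply: lerXn2r; rewrite ?nnegrE; lra.
have V0 : 0 <= V.
  rewrite /V /step_remainder addr_ge0// mulr_ge0//; last by lra.
  by rewrite mulr_ge0// exprn_ge0//; lra.
move: incE; set X := increment h z => incE.
pose r := X - sin h * B; have rV : `|r| <= h ^+ 2 * V by exact: incE.
have -> : X = sin h * B + r by rewrite /r; ring.
have r2 : r ^+ 2 <= (h ^+ 2 * V) ^+ 2.
  by rewrite -[leLHS]real_normK ?num_real// lerXn2r ?nnegrE ?mulr_ge0.
have sB : (sin h * B) ^+ 2 <= h ^+ 2 * B ^+ 2.
  by rewrite exprMn ler_wpM2r ?sqr_ge0// lerXn2r ?nnegrE.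
have := sqr_ge0 (sin h * B - r).
have e4 : (h ^+ 2 * V) ^+ 2 = h ^+ 4 * V ^+ 2 by rewrite exprMn -exprM.
rewrite e4 in r2; lra.
Qed.

Let fam0 (k : I + I) (z : Om * Om) : R :=
  match k with inl i => Z1 i z | inr i => Z2 i z end.

Let gauss_fam0 : gauss PP fam0.
Proof.
have := gauss_sum gZ gZ; congr (gauss _ _).
by apply/funext => -[].
Qed.

Let gauss_angle (t : R) : 0 <= t < pi ->
  gauss PP (fun k z => rotall (cos t) (sin t) (fam0^~ z) k).
Proof.
rewrite le_eqVlt => /andP[/predU1P[<- _|t0 tpi]].
  (* The angle 0 is excluded from [gauss_rotall], where the sine must not vanish; the rotation is
     then the identity. *)
  move: gauss_fam0; congr (gauss _ _).
  apply/funext => l; apply/funext => z; rewrite cos0 sin0.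
  by case: l => i /=; rewrite mul1r mul0r (addr0, subr0).
apply: gauss_rotall gauss_fam0; first exact: cos2Dsin2.
by rewrite gt_eqF// sin_gt0_pi// t0.
Qed.

Let X (t : R) (z : Om * Om) := F (fun i => cos t * Z1 i z + sin t * Z2 i z).

Let tame_X t : tame PP (X t).
Proof. by apply: tame_poincare_fun => i; apply: tameD; exact: tameZ. Qed.

(** By the addition formulas, [X (t + h) - X t] is the increment of angle [h] evaluated at the
    family rotated by [t], which has the law of the original one. *)
Let Ex_step (t h : R) : 0 <= t < pi ->
  Ex PP (fun z => (X (t + h) z - X t z) ^+ 2) = Ex PP (fun z => increment h z ^+ 2).
Proof.
move=> tpi; pose H (g : I + I -> R) :=
  (F (fun i => cos h * g (inl i) + sin h * g (inr i)) - F (fun i => g (inl i))) ^+ 2.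
have mH : mfunI H.
  move=> d1 Om1 Y mY; apply: measurable_funX; apply: measurable_funB.
    apply: (mF (Z := fun i om => cos h * Y (inl i) om + sin h * Y (inr i) om)) => i.
    by apply: measurable_funD; exact: measurable_funM.
  exact: (mF (Z := fun i om => Y (inl i) om)).
have tH : tame PP (fun z => H (fam0^~ z)).
  apply: tame_sqr; apply: tameB; first exact: (tame_X h).
  exact: tame_poincare_fun tZ1.
rewrite [RHS](Ex_law gauss_fam0 (gauss_angle tpi) mH tH).
congr Ex; apply/funext => z; rewrite /H /X; congr ((F _ - F _) ^+ 2).
by apply/funext => i; rewrite /= cosD sinD; ring.
Qed.

Let Ex_increment h : 0 <= h <= 1 -> Ex PP (fun z => increment h z ^+ 2) <=
  2 * h ^+ 2 * (normal_var R * Ex P (fun om => \sum_i G i (Z^~ om) ^+ 2)) +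
  2 * h ^+ 4 * Ex PP (fun z => step_remainder z ^+ 2).
Proof.
move=> h01.
have tB : tame PP (fun z => (\sum_i G i (Z1^~ z) * Z2 i z) ^+ 2).
  apply: tame_sqr; apply: tame_sum => i; apply: tameM => //.
  exact: tame_poincare_grad tZ1.
have tV := tame_sqr tame_step_remainder.
rewrite -Ex_grad_dir -(ExZ _ tB) -(ExZ _ tV) -(ExD (tameZ _ tB) (tameZ _ tV)).
apply: Ex_le; last by move=> z; exact: increment_bound.
  apply: tame_sqr; apply: tameB; first exact: tame_X.
  exact: tame_poincare_fun tZ1.
by apply: tameD; exact: tameZ.
Qed.

(* Take an independent copy [Z'] and rotate [Z] into [Z'] in [m] steps of angle
   [pi / (2 m)]. By rotation invariance all the increments of [F] have the law of
   the first one, whose second moment is that of [h * \sum_i G i Z * Z' i] up to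
   higher order in [h = pi / (2 m)]; then [m] tends to infinity. *)
Lemma poincare_smooth : Var P (fun om => F (Z^~ om)) <=
  4 * (normal_var R * Ex P (fun om => \sum_i G i (Z^~ om) ^+ 2)).
Proof.
set B := normal_var R * _; pose V := Ex PP (fun z => step_remainder z ^+ 2).
have V0 : 0 <= V by apply: Ex_ge0 => z; exact: sqr_ge0.
have tF := tame_poincare_fun tZ.
suff H (m : nat) : (1 < m)%N ->
    Var P (fun om => F (Z^~ om)) <= 4 * B + 16 * V / m%:R.
  apply/ler_addgt0Pr => e e0.
  pose m := (Num.truncn (16 * V / e)).+2.
  apply: le_trans (H m isT) _; rewrite lerD2l ler_pdivrMr ?ltr0n//.
  rewrite -ler_pdivrMl// mulrC; apply: ltW; apply: lt_trans (truncnS_gt _) _.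
  by rewrite ltr_nat.
move=> m1; have m0 : 0 < m%:R :> R by rewrite ltr0n ltnW.
pose h := pi / 2 / m%:R : R.
have p2 := pihalf_lt2 R; have p0 := pi_gt0 R.
have mh : m%:R * h = pi / 2 by rewrite /h mulrC divfK// gt_eqF.
have h0 : 0 <= h by rewrite !divr_ge0 // ltW.
have m2 : 2 <= m%:R :> R by rewrite ler_nat.
have h1 : h <= 1 by nra.
have h01 : 0 <= h <= 1 by rewrite h0 h1.
pose D := Ex PP (fun z => increment h z ^+ 2).
have XM : X (m%:R * h) = fun z => F (Z2^~ z).
  apply/funext => z; rewrite /X mh cos_pihalf sin_pihalf; congr F.
  by apply/funext => i; rewrite mul0r mul1r add0r.
have XO : X 0 = fun z => F (Z1^~ z).
  apply/funext => z; rewrite /X cos0 sin0; congr F.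
  by apply/funext => i; rewrite mul0r mul1r addr0.
(* The end points of the path are two independent copies, and the mean squared difference of
   independent copies is twice the variance. *)
have EV : Ex PP (fun z => (X (m%:R * h) z - X 0 z) ^+ 2) =
    2 * Var P (fun om => F (Z^~ om)).
  rewrite XM XO (VarE tF).
  have t2 := tame_sqr (tame_snd P tF); have t1 := tame_sqr (tame_fst P tF).
  have t12 := tameM (tame_fst P tF) (tame_snd P tF).
  rewrite (_ : (fun z => _) = fun z => (F (Z2^~ z) ^+ 2 + F (Z1^~ z) ^+ 2)
     - 2 * (F (Z1^~ z) * F (Z2^~ z))); last by apply/funext => z; ring.
  rewrite (ExB (tameD t2 t1) (tameZ 2 t12)) (ExD t2 t1) (ExZ 2 t12).
  rewrite (Ex_indep tF tF).
  have tF2 := tame_sqr tF.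
  have e1 : Ex PP (fun z => F (Z1^~ z) ^+ 2) = Ex P (fun om => F (Z^~ om) ^+ 2).
    exact: (Ex_fst P tF2).
  have e2 : Ex PP (fun z => F (Z2^~ z) ^+ 2) = Ex P (fun om => F (Z^~ om) ^+ 2).
    exact: (Ex_snd P tF2).
  by rewrite e1 e2; ring.
have step : 2 * Var P (fun om => F (Z^~ om)) <= m%:R * (m%:R * D).
  rewrite -EV.
  have tS (i : 'I_m) : tame PP (fun z => (X (i.+1%:R * h) z - X (i%:R * h) z) ^+ 2).
    by apply: tame_sqr; apply: tameB; exact: tame_X.
  apply: (@le_trans _ _ (Ex PP (fun z => m%:R * \sum_(i < m)
      (X (i.+1%:R * h) z - X (i%:R * h) z) ^+ 2))).
    apply: Ex_le; first by apply: tame_sqr; apply: tameB; exact: tame_X.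
      by apply: tameZ; exact: tame_sum.
    move=> z; apply: le_trans (sqr_sum_le _).
    rewrite -(big_mkord xpredT (fun i => X (i.+1%:R * h) z - X (i%:R * h) z)).
    by rewrite (telescope_sumr (fun i => X (i%:R * h) z))// mul0r.
  rewrite ExZ; last exact: tame_sum.
  rewrite Ex_sum// ler_wpM2l//.
  rewrite (eq_bigr (fun=> D)) => [|i _]; last first.
    rewrite -natr1 mulrDl mul1r Ex_step// mulr_ge0//=.
    have im : i%:R <= m%:R :> R by rewrite ler_nat ltnW.
    by apply: le_lt_trans (ler_wpM2r h0 im) _; rewrite mh; lra.
  by rewrite sumr_const card_ord mulr_natl.
have DB := Ex_increment h01; rewrite -/B -/D -/V in DB.
have B0 : 0 <= B.
  rewrite mulr_ge0// Ex_ge0// => x; first exact: sqr_ge0.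
  by apply: sumr_ge0 => i _; exact: sqr_ge0.
(* Origin of the factor 4 in the statement: Cauchy-Schwarz over the [m] steps gives
   [2 Var <= m^2 D], where [m^2 D] is at most [2 (pi / 2)^2 B] up to a term vanishing with [1 / m],
   and [(pi / 2)^2 <= 4]. *)
have mh2 : (m%:R * h) ^+ 2 <= 4 by rewrite mh; nra.
have hm : h <= 2 / m%:R by rewrite ler_pdivlMr// mulrC mh ltW.
have E1 : m%:R * (m%:R * D) <= 2 * (m%:R * h) ^+ 2 * B + 2 * (m%:R * h) ^+ 2 * h ^+ 2 * V.
  rewrite mulrA; apply: le_trans (ler_wpM2l _ DB) _; first by rewrite mulr_ge0.
  by rewrite le_eqVlt; apply/orP; left; apply/eqP; ring.
have h2h : h ^+ 2 <= h by nra.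
have E2 : 2 * (m%:R * h) ^+ 2 * h ^+ 2 * V <= 8 * (2 / m%:R) * V.
  have mh0 := sqr_ge0 (m%:R * h).
  apply: ler_wpM2r => //; apply: ler_pM; [lra|exact: sqr_ge0|lra|].
  exact: le_trans hm.
have E3 : 2 * (m%:R * h) ^+ 2 * B <= 8 * B by rewrite ler_wpM2r//; lra.
have -> : 16 * V / m%:R = 8 * (2 / m%:R) * V by field; rewrite gt_eqF.
have : 0 <= 8 * (2 / m%:R) * V by rewrite !mulr_ge0 ?invr_ge0.
lra.
Qed.

End poincare.

Lemma sqr_sum_le_fin (R : realType) (I : finType) (a : I -> R) :
  (\sum_i a i) ^+ 2 <= #|I|%:R * \sum_i a i ^+ 2.
Proof.
rewrite (reindex _ (onW_bij _ (@enum_val_bij I)))/=.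
by rewrite [X in _ * X](reindex _ (onW_bij _ (@enum_val_bij I))) sqr_sum_le.
Qed.

(** * Calculus of functions with polynomial growth *)

Section poly_bounds.
Context (R : realType) (I : finType).
Implicit Types (V : (I -> R) -> (I -> R) -> R) (x y : I -> R).

(* At most polynomial growth. *)
Definition polyb V : Prop := exists K k, forall x y,
  `|V x y| <= K * (wt1 x + wt1 y) ^+ k.

Lemma wt2_ge1 x y : 1 <= wt1 x + wt1 y.
Proof. by have := wt1_ge1 x; have := wt1_ge1 y; lra. Qed.

Lemma polyb_mono V V' : polyb V' -> (forall x y, `|V x y| <= `|V' x y|) -> polyb V.
Proof. by move=> [K [k H]] VV; exists K, k => x y; exact: le_trans (VV x y) _. Qed.

Lemma polyb_cst (c : R) : polyb (fun _ _ => c).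
Proof. by exists `|c|, 0%N => x y; rewrite expr0 mulr1. Qed.

Lemma polybW V : polyb V -> exists K k, 0 <= K /\ forall l x y, (k <= l)%N ->
  `|V x y| <= K * (wt1 x + wt1 y) ^+ l.
Proof.
move=> [K [k H]]; exists `|K|, k; split=> // l x y kl.
apply: le_trans (H x y) _; apply: (@le_trans _ _ (`|K| * (wt1 x + wt1 y) ^+ k)).
  by rewrite ler_wpM2r ?ler_norm// exprn_ge0// (le_trans ler01 (wt2_ge1 x y)).
by rewrite ler_wpM2l// ler_weXn2l// wt2_ge1.
Qed.

Lemma polybD V V' : polyb V -> polyb V' -> polyb (fun x y => V x y + V' x y).
Proof.
move=> /polybW[K [k [_ H]]] /polybW[K' [k' [_ H']]].
exists (K + K'), (k + k')%N => x y; rewrite mulrDl.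
apply: le_trans (ler_normD _ _) _; apply: lerD.
  by apply: H; exact: leq_addr.
by apply: H'; exact: leq_addl.
Qed.

Lemma polybM V V' : polyb V -> polyb V' -> polyb (fun x y => V x y * V' x y).
Proof.
move=> [K [k H]] [K' [k' H']]; exists (K * K'), (k + k')%N => x y.
by rewrite normrM exprD mulrACA; apply: ler_pM.
Qed.

Lemma polybN V : polyb V -> polyb (fun x y => - V x y).
Proof. by move=> pV; apply: polyb_mono pV _ => x y; rewrite normrN. Qed.

Lemma polyb_abs V : polyb V -> polyb (fun x y => `|V x y|).
Proof. by move=> pV; apply: polyb_mono pV _ => x y; rewrite normr_id. Qed.

Lemma polyb_sum (A : Type) (s : seq A) (Q : pred A) (V : A -> (I -> R) -> (I -> R) -> R) :
  (forall a, polyb (V a)) -> polyb (fun x y => \sum_(a <- s | Q a) V a x y).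
Proof.
move=> pV; elim: s => [|a s IH].
  by apply: polyb_mono (polyb_cst 0) _ => x y; rewrite big_nil.
case Qa: (Q a).
  by apply: polyb_mono (polybD (pV a) IH) _ => x y; rewrite big_cons Qa.
by apply: polyb_mono IH _ => x y; rewrite big_cons Qa.
Qed.

Lemma polybX k V : polyb V -> polyb (fun x y => V x y ^+ k).
Proof.
move=> pV; elim: k => [|k IH].
  by apply: polyb_mono (polyb_cst 1) _ => x y.
by apply: polyb_mono (polybM pV IH) _ => x y; rewrite exprS.
Qed.

Lemma polyb_wtl : polyb (fun x y => wt1 x).
Proof.
exists 1, 1%N => x y; rewrite mul1r expr1 ger0_norm ?wt1_ge0//.
by rewrite lerDl wt1_ge0.
Qed.

Lemma polyb_wtr : polyb (fun x y => wt1 y).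
Proof.
exists 1, 1%N => x y; rewrite mul1r expr1 ger0_norm ?wt1_ge0//.
by rewrite lerDr wt1_ge0.
Qed.

Lemma sqr_le_wt1 x i : x i ^+ 2 <= wt1 x.
Proof.
rewrite /wt1 (bigD1 i)//= addrCA lerDl addr_ge0// sumr_ge0// => j _; exact: sqr_ge0.
Qed.

Lemma abs_le_wt1 x i : `|x i| <= wt1 x.
Proof.
have := sqr_le_wt1 x i; have := wt1_ge1 x; rewrite -[x i ^+ 2]real_normK ?num_real//.
have := normr_ge0 (x i); nra.
Qed.

Lemma polyb_l i : polyb (fun x y => x i).
Proof.
apply: polyb_mono polyb_wtl _ => x y.
by apply: le_trans (abs_le_wt1 x i) (ler_norm _).
Qed.

Lemma polyb_r i : polyb (fun x y => y i).
Proof.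
apply: polyb_mono polyb_wtr _ => x y.
by apply: le_trans (abs_le_wt1 y i) (ler_norm _).
Qed.

Definition dist2 x y : R := \sum_i (y i - x i) ^+ 2.

Lemma dist2_ge0 x y : 0 <= dist2 x y.
Proof. by apply: sumr_ge0 => i _; exact: sqr_ge0. Qed.

Lemma polyb_dist2 : polyb dist2.
Proof.
apply: polyb_sum => i; apply: polybX; apply: polybD; first exact: polyb_r.
by apply: polybN; exact: polyb_l.
Qed.

Lemma polyb_flip V : polyb V -> polyb (fun x y => V y x).
Proof. by move=> [K [k H]]; exists K, k => x y; rewrite addrC. Qed.

(* Differentiability with a locally Lipschitz gradient [G], in the form of a
   second-order Taylor bound. *)
Definition C11 (F : (I -> R) -> R) (G : I -> (I -> R) -> R) : Prop :=
  (forall i, polyb (fun x y => G i x)) /\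
  exists2 V, polyb V & forall x y,
    `|F y - F x - \sum_i G i x * (y i - x i)| <= V x y * dist2 x y.

(** Locally Lipschitz, with the increment squared so that it is compared with [dist2] and no square
    root appears. *)
Definition lipP (F : (I -> R) -> R) : Prop :=
  exists2 V, polyb V & forall x y, (F y - F x) ^+ 2 <= V x y * dist2 x y.

End poly_bounds.

Section polyb_comp.
Context (R : realType) (I J : finType).

Lemma polyb_comp (V : (J -> R) -> (J -> R) -> R) (s : J -> (I -> R) -> R) :
  polyb V -> (forall j, polyb (fun x y => s j x)) ->
  polyb (fun x y => V (s^~ x) (s^~ y)).
Proof.
move=> [K [k H]] ps.
have pw : polyb (fun x y : I -> R => wt1 (s^~ x)).
  apply: polybD; first exact: polyb_cst.
  by apply: polyb_sum => j; apply: polybX; exact: ps.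
apply: (polyb_mono (V' := fun x y => K * (wt1 (s^~ x) + wt1 (s^~ y)) ^+ k)).
  apply: polybM; first exact: polyb_cst.
  apply: polybX; apply: polybD => //; exact: (polyb_flip pw).
by move=> x y; apply: le_trans (H _ _) (ler_norm _).
Qed.

Lemma C11_lipP (F : (I -> R) -> R) G : C11 F G -> lipP F.
Proof.
move=> [pG [V pV H]].
exists (fun x y => 2 * #|I|%:R * \sum_i G i x ^+ 2 + 2 * (V x y ^+ 2 * dist2 x y)).
  apply: polybD.
    apply: polybM; first exact: polyb_cst.
    by apply: polyb_sum => i; apply: polybX.
  apply: polybM; first exact: polyb_cst.
  by apply: polybM; [exact: polybX|exact: polyb_dist2].
move=> x y; have D0 := dist2_ge0 x y.
set S := \sum_i G i x * (y i - x i) in H *; have := H x y; rewrite -/S.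
set r := F y - F x - S => Hr.
have -> : F y - F x = S + r by rewrite /r; ring.
have r2 : r ^+ 2 <= V x y ^+ 2 * dist2 x y ^+ 2.
  rewrite -exprMn -[leLHS]real_normK ?num_real//.
  by rewrite -[leRHS]real_normK ?num_real// lerXn2r ?nnegrE// (le_trans Hr)// ler_norm.
have S2 : S ^+ 2 <= #|I|%:R * (\sum_i G i x ^+ 2) * dist2 x y.
  apply: le_trans (sqr_sum_le_fin _) _; rewrite -mulrA ler_wpM2l//.
  rewrite mulr_suml; apply: ler_sum => i _; rewrite exprMn.
  rewrite ler_wpM2l ?sqr_ge0// /dist2 (bigD1 i)//= lerDl.
  by apply: sumr_ge0 => j _; exact: sqr_ge0.
have := sqr_ge0 (S - r); nra.
Qed.

Lemma lipP_polyb (F : (I -> R) -> R) : lipP F -> polyb (fun x y => F x).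
Proof.
move=> [V pV H].
apply: (polyb_mono (V' := fun x y => 1 + 2 * F (fun=> 0) ^+ 2 +
    2 * (`|V (fun=> 0) x| * dist2 (fun=> 0) x))).
  apply: polybD; first exact: polyb_cst.
  apply: polybM; first exact: polyb_cst.
  have p0 (i : I) : polyb (fun x y : I -> R => 0 : R) by exact: polyb_cst.
  have [K [k HV]] := polybM (polyb_abs pV) (@polyb_dist2 R I).
  apply: (polyb_mono (V' := fun x y => K * (wt1 (fun _ : I => 0 : R) + wt1 x) ^+ k)).
    apply: polybM; first exact: polyb_cst.
    apply: polybX; apply: polybD; [exact: polyb_cst|exact: polyb_wtl].
  by move=> x y; apply: le_trans (HV _ _) (ler_norm _).
move=> x y; apply: le_trans (ler_norm _).
have := H (fun=> 0) x; set b := F x; set a := F (fun=> 0) => h.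
have : V (fun=> 0) x * dist2 (fun=> 0) x <= `|V (fun=> 0) x| * dist2 (fun=> 0) x.
  by rewrite ler_wpM2r ?ler_norm ?dist2_ge0.
have := sqr_ge0 (`|b| - 1); have : `|b| ^+ 2 = b ^+ 2 by rewrite real_normK ?num_real.
have v0 : 0 <= `|V (fun=> 0) x| * dist2 (fun=> 0) x by rewrite mulr_ge0// dist2_ge0.
have := sqr_ge0 a; have := sqr_ge0 (b - 2 * a); lra.
Qed.

(** The chain rule. The remainder is that of [F] at the increments of [s], which is of second order
    since these increments are of first order, plus the remainders of the [s j] weighted by the
    gradient of [F]. *)
Lemma C11_comp (F : (J -> R) -> R) G (s : J -> (I -> R) -> R) ds :
  C11 F G -> (forall j, C11 (s j) (ds j)) ->
  C11 (fun x => F (s^~ x)) (fun i x => \sum_j G j (s^~ x) * ds j i x).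
Proof.
move=> [pG [V pV HV]] Cs.
have ps j : polyb (fun x y => s j x) := lipP_polyb (C11_lipP (Cs j)).
have pGs j : polyb (fun x y : I -> R => G j (s^~ x)).
  exact: (polyb_comp (pG j) ps).
split=> [i|].
  by apply: polyb_sum => j; apply: polybM => //; case: (Cs j).
have /choice[L HL] j : exists L, polyb L /\ forall x y, (s j y - s j x) ^+ 2 <= L x y * dist2 x y.
  by have [L pL H] := C11_lipP (Cs j); exists L.
have /choice[M HM] j : exists M, polyb M /\ forall x y,
    `|s j y - s j x - \sum_i ds j i x * (y i - x i)| <= M x y * dist2 x y.
  by have [_ [M pM H]] := Cs j; exists M.
exists (fun x y => `|V (s^~ x) (s^~ y)| * (\sum_j L j x y) +
    \sum_j `|G j (s^~ x)| * M j x y).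
  apply: polybD; first apply: polybM.
  - by apply: polyb_abs; exact: (polyb_comp pV ps).
  - by apply: polyb_sum => j; case: (HL j).
  - apply: polyb_sum => j; apply: polybM; first exact: polyb_abs.
    by case: (HM j).
move=> x y; have D0 := dist2_ge0 x y.
have -> : F (s^~ y) - F (s^~ x) - \sum_i (\sum_j G j (s^~ x) * ds j i x) * (y i - x i) =
  (F (s^~ y) - F (s^~ x) - \sum_j G j (s^~ x) * (s j y - s j x)) +
  \sum_j G j (s^~ x) * (s j y - s j x - \sum_i ds j i x * (y i - x i)).
  have -> : \sum_i (\sum_j G j (s^~ x) * ds j i x) * (y i - x i) =
      \sum_j G j (s^~ x) * \sum_i ds j i x * (y i - x i).
    under eq_bigr do rewrite mulr_suml.
    rewrite exchange_big/=; apply: eq_bigr => j _; rewrite mulr_sumr.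
    by apply: eq_bigr => i _; rewrite mulrA.
  under [X in _ = _ + X]eq_bigr do rewrite mulrBr.
  by rewrite sumrB; ring.
apply: le_trans (ler_normD _ _) _; rewrite mulrDl; apply: lerD.
  apply: le_trans (HV _ _) _; rewrite -mulrA.
  apply: le_trans (ler_wpM2r (dist2_ge0 _ _) (ler_norm _)) _.
  rewrite ler_wpM2l// /dist2 mulr_suml; apply: ler_sum => j _.
  by case: (HL j) => _; apply.
apply: le_trans (ler_norm_sum _ _ _) _; rewrite mulr_suml; apply: ler_sum => j _.
by rewrite normrM -mulrA ler_wpM2l//; case: (HM j) => _; apply.
Qed.

End polyb_comp.

(** * Mollification of Lipschitz functions *)

Section mollification.
Context (R : realType).
Local Notation leb := (@lebesgue_measure R).

Lemma lipschitz_le (l : R) (f : R -> R) :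
  l.-lipschitz f -> forall x y, `|f x - f y| <= l * `|x - y|.
Proof. by move=> lf x y; exact: (lf (x, y)). Qed.

Lemma taylor_continuous (f D : R -> R) (K : R) :
  (forall x y, `|f y - f x - D x * (y - x)| <= K * (y - x) ^+ 2) -> continuous f.
Proof.
move=> H x; apply/cvgrPdist_le => /= e e0.
pose M := `|D x| + `|K| + 1.
have M0 : 0 < M by rewrite /M; have := normr_ge0 (D x); have := normr_ge0 K; lra.
near=> y.
have y1 : `|x - y| <= 1.
  by near: y; apply: (@cvgr_dist_le _ _ _ _ _ idfun); [exact: cvg_id|].
have y2 : `|x - y| <= e / M.
  near: y; apply: (@cvgr_dist_le _ _ _ _ _ idfun); [exact: cvg_id|].
  by rewrite divr_gt0.
rewrite distrC.
have -> : f y - f x = (f y - f x - D x * (y - x)) + D x * (y - x) by ring.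
apply: le_trans (ler_normD _ _) _.
have h1 := H x y.
have n0 := normr_ge0 (x - y).
have e1 : (y - x) ^+ 2 = `|x - y| ^+ 2 by rewrite real_normK ?num_real//; ring.
rewrite normrM [`|y - x|]distrC.
have h2 : K * (y - x) ^+ 2 <= `|K| * `|x - y|.
  rewrite e1; apply: (@le_trans _ _ (`|K| * `|x - y| ^+ 2)).
    by rewrite ler_wpM2r ?sqr_ge0// ler_norm.
  by rewrite ler_wpM2l//; nra.
have h3 : `|x - y| * M <= e by rewrite -ler_pdivlMr.
move: h3; rewrite /M; nra.
Unshelve. all: by end_near. Qed.

Lemma lipschitz_continuous (l : R) (f : R -> R) :
  (forall x y, `|f x - f y| <= l * `|x - y|) -> continuous f.
Proof.
move=> H x; apply/cvgrPdist_le => /= e e0.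
pose M := `|l| + 1.
have M0 : 0 < M by rewrite /M ltr_wpDl.
near=> y.
have y2 : `|x - y| <= e / M.
  near: y; apply: (@cvgr_dist_le _ _ _ _ _ idfun); [exact: cvg_id|].
  by rewrite divr_gt0.
have h3 : `|x - y| * M <= e by rewrite -ler_pdivlMr.
apply: le_trans (H x y) _.
have := normr_ge0 (x - y); have := ler_norm l; rewrite /M in h3; nra.
Unshelve. all: by end_near. Qed.

Lemma lipschitz_measurable (l : R) (f : R -> R) :
  (forall x y, `|f x - f y| <= l * `|x - y|) -> measurable_fun setT f.
Proof.
by move=> H; apply: continuous_measurable_fun; exact: lipschitz_continuous H.
Qed.

(** [A] is a primitive of [f], and the error is the integral of [f t - f x] between [x] and [y]. For
    [x <= y] the constant is [l]; the factor 2 covers [y < x], where changing the base point of the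
    expansion costs another [l (y - x)^2]. *)
Lemma primitive_lipschitz (l : R) (f : R -> R) :
  (forall x y, `|f x - f y| <= l * `|x - y|) ->
  exists A : R -> R, forall x y,
    `|A y - A x - f x * (y - x)| <= 2 * l * (y - x) ^+ 2.
Proof.
move=> lf; have mf := lipschitz_measurable lf.
have l0 : 0 <= l.
  by have := lf 0 1; have := normr_ge0 (f 0 - f 1); rewrite sub0r normrN1; lra.
have mI (x y : R) : measurable_fun setT (fun t : R => \1_(`[x, y[%classic) t : R).
  exact: measurable_indic.
have iI (c x y : R) : leb.-integrable setT (EFin \o (fun t => c * \1_(`[x, y[%classic) t)).
  apply: (@integrableZl _ _ _ leb setT measurableT c (EFin \o (\1_(`[x, y[%classic) : R -> R))).
  exact: integrable_indic_itv.
have ifI (x y : R) : leb.-integrable setT (EFin \o (fun t => f t * \1_(`[x, y[%classic) t)).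
  apply: le_integrable (iI (`|f x| + l * `|y - x|) x y) => //.
    by apply/measurable_EFinP; apply: measurable_funM.
  move=> t _ /=; rewrite lee_fin !normrM; rewrite indicE.
  case: (boolP (t \in _)) => [|_]; last by rewrite normr0 !mulr0.
  rewrite inE/= in_itv/= => /andP[xt ty]; rewrite normr1 !mulr1.
  apply: le_trans (ler_norm _).
  have -> : f t = f x + (f t - f x) by ring.
  apply: le_trans (ler_normD _ _) _; rewrite lerD2l.
  apply: le_trans (lf _ _) _; rewrite ler_wpM2l//.
  by rewrite !ger0_norm; lra.
have indE (x y t : R) : \1_(`[x, y[%classic) t = (x <= t < y)%R%:R :> R.
  by rewrite indicE; congr (nat_of_bool _)%:R; apply/idP/idP; rewrite inE/= in_itv.
pose J (x y : R) := \int[leb]_t (f t * \1_(`[x, y[%classic) t).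
have J0 x y : y <= x -> J x y = 0.
  move=> yx; rewrite /J (_ : (fun t => _) = cst 0).
    by rewrite /Rintegral integral0.
  apply/funext => t /=; rewrite indicE memNset ?mulr0//= in_itv/= => /andP[]; lra.
have JD x y z : x <= y -> y <= z -> J x z = J x y + J y z.
  move=> xy yz; rewrite /J -RintegralD//.
  apply: eq_Rintegral => t _; rewrite -mulrDr; congr (_ * _).
  rewrite !indE; case: (leP x t) => xt; case: (leP y t) => yt;
    case: (ltP t z) => tz; rewrite /= ?addr0 ?add0r ?andbF ?andbT //; lra.
(* [J] vanishes on reversed bounds, so this is the signed integral of [f] from 0 to [x]. *)
pose A x := J 0 x - J x 0.
have AE x y : x <= y -> A y - A x = J x y.
  move=> xy; rewrite /A; case: (leP 0 x) => x0.
    by rewrite (J0 x 0)// (J0 y 0) ?(le_trans x0)// (JD 0 x y)//; ring.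
  case: (leP 0 y) => y0.
    by rewrite (J0 0 x (ltW x0)) (J0 y 0 y0) (JD x 0 y (ltW x0) y0); ring.
  by rewrite (J0 0 x (ltW x0)) (J0 0 y (ltW y0)) (JD x y 0 xy (ltW y0)); ring.
have J1 c x y : x <= y -> \int[leb]_t (c * \1_(`[x, y[%classic) t) = c * (y - x).
  move=> xy; rewrite (_ : (fun t => _) = fun t => c * (\1_(`[x, y[%classic) t)) //.
  have := iI 1 x y; under eq_fun do rewrite mul1r; move=> i1.
  rewrite RintegralZl//; congr (_ * _).
  transitivity (fine (leb `[x, y[%classic)).
    by rewrite /Rintegral integral_indic// setIT.
  rewrite lebesgue_measure_itv/= lte_fin.
  by case: ltgtP xy => //= -> _; rewrite subrr.
have key x y : x <= y -> `|A y - A x - f x * (y - x)| <= l * (y - x) ^+ 2.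
  move=> xy; rewrite AE// -J1// /J -RintegralB//.
  apply: le_trans (le_normr_Rintegral _ _) _ => //.
    by apply: (integrableB measurableT (ifI x y) (iI (f x) x y)).
  apply: (@le_trans _ _ (\int[leb]_t ((l * (y - x)) * \1_(`[x, y[%classic) t))); last first.
    by rewrite J1// expr2 mulrA.
  apply: le_Rintegral => //.
    have := integrable_norm (integrableB measurableT (ifI x y) (iI (f x) x y)).
    exact.
  move=> t _; rewrite -mulrBl normrM indicE.
  case: (boolP (t \in _)) => [|_]; last by rewrite normr0 !mulr0.
  rewrite inE/= in_itv/= => /andP[xt ty]; rewrite normr1 !mulr1.
  apply: le_trans (lf _ _) _; rewrite ler_wpM2l// ger0_norm; lra.
exists A => x y; case: (leP x y) => [xy|/ltW yx].
  by apply: le_trans (key x y xy) _; rewrite -mulrA; have := sqr_ge0 (y - x); nra.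
have h1 := key y x yx; have h2 := lf y x.
have -> : A y - A x - f x * (y - x) =
  - (A x - A y - f y * (x - y)) - (f y - f x) * (x - y) by ring.
apply: le_trans (ler_normB _ _) _; rewrite normrN normrM.
have e1 : `|x - y| = x - y by rewrite ger0_norm ?subr_ge0.
have e2 : `|y - x| = x - y by rewrite distrC.
rewrite e2 in h2; rewrite e1.
have h3 : `|f y - f x| * (x - y) <= l * (x - y) * (x - y).
  by apply: ler_wpM2r; [rewrite subr_ge0|].
have -> : (y - x) ^+ 2 = (x - y) ^+ 2 by ring.
by move: h1; rewrite expr2; lra.
Qed.

(* [g] is the average of [f] over [x - e, x + e]. *)
Lemma mollify (l : R) (f : R -> R) (e : R) : 0 < e ->
  (forall x y, `|f x - f y| <= l * `|x - y|) ->
  exists g D : R -> R, [/\ forall x, `|g x - f x| <= 2 * l * e,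
    forall x, `|D x| <= l, measurable_fun setT g, measurable_fun setT D &
    forall x y, `|g y - g x - D x * (y - x)| <= 2 * l / e * (y - x) ^+ 2].
Proof.
move=> e0 lf; have [A HA] := primitive_lipschitz lf.
pose g x := (A (x + e) - A (x - e)) / (2 * e).
pose D x := (f (x + e) - f (x - e)) / (2 * e).
have e20 : 0 < 2 * e by rewrite mulr_gt0.
have gT x y : `|g y - g x - D x * (y - x)| <= 2 * l / e * (y - x) ^+ 2.
  have -> : g y - g x - D x * (y - x) = ((A (y + e) - A (x + e) - f (x + e) * ((y + e) - (x + e)))
     - (A (y - e) - A (x - e) - f (x - e) * ((y - e) - (x - e)))) / (2 * e).
    by rewrite /g /D; field; rewrite gt_eqF.
  rewrite normrM normfV (gtr0_norm e20) ler_pdivrMr//.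
  apply: le_trans (ler_normB _ _) _.
  have h1 := HA (x + e) (y + e); have h2 := HA (x - e) (y - e).
  apply: le_trans (lerD h1 h2) _.
  rewrite le_eqVlt; apply/orP; left; apply/eqP; field; rewrite gt_eqF//.
exists g, D; split => //.
- move=> x; have -> : g x - f x = ((A (x + e) - A x - f x * ((x + e) - x))
     - (A (x - e) - A x - f x * ((x - e) - x))) / (2 * e).
    by rewrite /g; field; rewrite gt_eqF.
  rewrite normrM normfV (gtr0_norm e20) ler_pdivrMr//.
  apply: le_trans (ler_normB _ _) _.
  have h1 := HA x (x + e); have h2 := HA x (x - e).
  apply: le_trans (lerD h1 h2) _.
  rewrite le_eqVlt; apply/orP; left; apply/eqP; ring.
- move=> x; rewrite normrM normfV (gtr0_norm e20) ler_pdivrMr//.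
  apply: le_trans (lf _ _) _; rewrite (_ : x + e - (x - e) = 2 * e); last by ring.
  by rewrite gtr0_norm.
- by apply: continuous_measurable_fun; exact: taylor_continuous gT.
- have mf := lipschitz_measurable lf; apply: measurable_funM => //.
  by apply: measurable_funB; apply: (measurableT_comp mf); exact: measurable_funD.
Qed.

End mollification.

Section C11_closure.
Context (R : realType) (I : finType).

Lemma C11_ext (F : (I -> R) -> R) (G G' : I -> (I -> R) -> R) :
  C11 F G -> (forall i x, G i x = G' i x) -> C11 F G'.
Proof.
by move=> CF GG; rewrite (_ : G' = G)//; apply/funext => i; apply/funext => x.
Qed.

Lemma C11_coord (i : I) :
  C11 (fun x : I -> R => x i) (fun i' _ => (i' == i)%:R).
Proof.
split=> [i'|]; first exact: polyb_cst.
exists (fun _ _ => 0) => [|x y]; first exact: polyb_cst.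
rewrite (bigD1 i)//= eqxx mul1r big1 => [|j /negbTE ->]; last by rewrite mul0r.
by rewrite addr0 subrr normr0 mul0r.
Qed.

Lemma C11_scalar (g D : R -> R) (l K : R) (s : (I -> R) -> R) ds :
  (forall x, `|D x| <= l) ->
  (forall x y, `|g y - g x - D x * (y - x)| <= K * (y - x) ^+ 2) ->
  C11 s ds -> C11 (fun x => g (s x)) (fun i x => D (s x) * ds i x).
Proof.
move=> Dl gT Cs.
have Cg : C11 (fun h : unit -> R => g (h tt)) (fun _ h => D (h tt)).
  split=> [i|].
    apply: polyb_mono (polyb_cst _ l) _ => x y.
    by apply: le_trans (Dl _) (ler_norm _).
  exists (fun _ _ => K) => [|x y]; first exact: polyb_cst.
  by rewrite /dist2 !(big_pred1 tt)//; case.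
apply: C11_ext (C11_comp Cg (fun _ => Cs)) _ => i x.
by rewrite (big_pred1 tt)//; case.
Qed.

Lemma C11_lin (J : finType) (c : J -> R) (s : J -> (I -> R) -> R) ds :
  (forall j, C11 (s j) (ds j)) ->
  C11 (fun x => \sum_j c j * s j x) (fun i x => \sum_j c j * ds j i x).
Proof.
move=> Cs.
have Cc : C11 (fun h : J -> R => \sum_j c j * h j) (fun j _ => c j).
  split=> [j|]; first exact: polyb_cst.
  exists (fun _ _ => 0) => [|x y]; first exact: polyb_cst.
  by rewrite -!sumrB big1 ?normr0 ?mul0r// => j _; ring.
exact: C11_comp Cc Cs.
Qed.

Lemma poincare_C11 (d : measure_display) (Om : measurableType d)
    (P : probability Om R) (Z : I -> Om -> R) (F : (I -> R) -> R) G :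
  gauss P Z -> mfunI F -> (forall i, mfunI (G i)) -> C11 F G ->
  Var P (fun om => F (Z^~ om)) <=
  4 * (normal_var R * Ex P (fun om => \sum_i G i (Z^~ om) ^+ 2)).
Proof.
move=> gZ mF mG [pG [V pV HV]].
have [K [k [K0 HK]]] := polybW (polyb_sum (index_enum I) xpredT (fun i => polyb_abs (pG i))).
have [K' [k' [K0' HK']]] := polybW pV.
pose l := (k + k')%N.
have W2 (x y : I -> R) := wt2_ge1 x y.
apply: (@poincare_smooth _ _ F G (K * 2 ^+ l + K') l) => //.
- by rewrite addr_ge0// mulr_ge0// exprn_ge0.
- move=> i x; have := HK l x x (leq_addr _ _); rewrite -mulr2n -[wt1 x *+ 2]mulr_natl exprMn mulrA => H.
  apply: (@le_trans _ _ (K * 2 ^+ l * wt1 x ^+ l)); last first.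
    by apply: ler_wpM2r; [exact/exprn_ge0/wt1_ge0|rewrite lerDl].
  apply: le_trans H; apply: le_trans (ler_norm _).
  by rewrite (bigD1 i)//= lerDl sumr_ge0.
- move=> x y; apply: le_trans (HV x y) _; rewrite -/(dist2 x y) ler_wpM2r ?dist2_ge0//.
  apply: le_trans (ler_norm _) _; apply: le_trans (HK' l x y (leq_addl _ _)) _.
  apply: ler_wpM2r; first exact/exprn_ge0/(le_trans ler01)/W2.
  by rewrite lerDr mulr_ge0// exprn_ge0.
Qed.

End C11_closure.

(** * The Poincare inequality for functions of the features *)

Section features_poincare.
Context (R : realType) (n p T : nat) (X : 'M[R]_(p, T)).

Definition feat (phi sigma : R -> R) (g : 'I_n * 'I_p -> R) (aj : 'I_n * 'I_T) : R :=
  sigma (\sum_k X k aj.2 * phi (g (aj.1, k))).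

Lemma mfunI_feat phi sigma aj : measurable_fun setT phi ->
  measurable_fun setT sigma -> mfunI (fun g => feat phi sigma g aj).
Proof.
move=> mp ms d Om Z mZ; apply: (measurableT_comp ms).
apply: measurable_sum => k; apply: measurable_funM => //.
exact: (measurableT_comp mp (mZ _)).
Qed.

Lemma C11_feat (gp Dp gs Ds : R -> R) (lp ls Kp Ks : R) aj :
  (forall x, `|Dp x| <= lp) ->
  (forall x y, `|gp y - gp x - Dp x * (y - x)| <= Kp * (y - x) ^+ 2) ->
  (forall x, `|Ds x| <= ls) ->
  (forall x y, `|gs y - gs x - Ds x * (y - x)| <= Ks * (y - x) ^+ 2) ->
  C11 (fun g => feat gp gs g aj) (fun bk g =>
    Ds (\sum_k X k aj.2 * gp (g (aj.1, k))) *
    (X bk.2 aj.2 * Dp (g bk) * (bk.1 == aj.1)%:R)).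
Proof.
move=> Dpl gpT Dsl gsT.
have C1 (k : 'I_p) := C11_scalar Dpl gpT (@C11_coord R _ (aj.1, k)).
have C2 := C11_lin (fun k => X k aj.2) C1.
apply: C11_ext (C11_scalar Dsl gsT C2) _ => -[b k] g /=; congr (_ * _).
case: eqVneq => [->|ba].
  rewrite (bigD1 k)//= eqxx mulr1 big1 => [|k' kk']; first by rewrite addr0 mulr1.
  by rewrite xpair_eqE eqxx/= eq_sym (negbTE kk') !mulr0.
rewrite mulr0 big1 // => k' _.
by rewrite xpair_eqE (negbTE ba)/= !mulr0.
Qed.

Variables (Psi : ('I_n * 'I_T -> R) -> R) (Gam : 'I_n * 'I_T -> ('I_n * 'I_T -> R) -> R).
Hypotheses (mPsi : mfunI Psi) (mGam : forall j, mfunI (Gam j)).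
Hypotheses (CPsi : C11 Psi Gam) (lGam : forall j, lipP (Gam j)).
Variable (L : R).
Hypothesis XL : forall u : 'I_T -> R,
  \sum_k (\sum_j X k j * u j) ^+ 2 <= L * \sum_j u j ^+ 2.
Context (d : measure_display) (Om : measurableType d) (P : probability Om R)
  (Z : 'I_n * 'I_p -> Om -> R).
Hypothesis gZ : gauss P Z.

Lemma tame_lipP (J : finType) (F : (J -> R) -> R) (Y : J -> Om -> R) :
  mfunI F -> lipP F -> (forall j, tame P (Y j)) -> tame P (fun om => F (Y^~ om)).
Proof.
move=> mF /lipP_polyb[K [k HK]] tY.
have tw := tame_wt1 tY.
apply: tame_dom (tameZ K (tameX k (tameD tw tw))) _.
  by apply: mF => j; exact: tame_measurable.
by move=> om; apply: le_trans (HK _ (Y^~ om)) (ler_norm _).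
Qed.

(** The gradient with respect to row [b] of the Gaussian array is obtained from that of [Psi] with
    respect to row [b] of the features by a diagonal matrix bounded by [ls], then [X], whose squared
    norm is at most [L], then a diagonal matrix bounded by [lp]. No dimension enters the
    constant. *)
Lemma poincare_features_smooth (gp Dp gs Ds : R -> R) (lp ls Kp Ks : R) :
  0 <= L -> 0 <= lp -> 0 <= ls ->
  measurable_fun setT gp -> measurable_fun setT Dp ->
  measurable_fun setT gs -> measurable_fun setT Ds ->
  (forall x, `|Dp x| <= lp) ->
  (forall x y, `|gp y - gp x - Dp x * (y - x)| <= Kp * (y - x) ^+ 2) ->
  (forall x, `|Ds x| <= ls) ->
  (forall x y, `|gs y - gs x - Ds x * (y - x)| <= Ks * (y - x) ^+ 2) ->
  Var P (fun om => Psi (feat gp gs (Z^~ om))) <=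
  4 * normal_var R * (lp ^+ 2 * ls ^+ 2 * L) *
    Ex P (fun om => \sum_j Gam j (feat gp gs (Z^~ om)) ^+ 2).
Proof.
move=> L0 lp0 ls0 mgp mDp mgs mDs Dpl gpT Dsl gsT.
have Cf aj := C11_feat aj Dpl gpT Dsl gsT.
pose G (bk : 'I_n * 'I_p) (x : 'I_n * 'I_p -> R) :=
  \sum_aj Gam aj (feat gp gs x) *
    (Ds (\sum_k X k aj.2 * gp (x (aj.1, k))) *
      (X bk.2 aj.2 * Dp (x bk) * (bk.1 == aj.1)%:R)).
have CF : C11 (fun x => Psi (feat gp gs x)) G by exact: (C11_comp CPsi Cf).
have mf aj := mfunI_feat aj mgp mgs.
have mF : mfunI (fun g => Psi (feat gp gs g)) by exact: (mfunI_comp mPsi mf).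
have mG i : mfunI (G i).
  move=> d1 Om1 Z1 mZ1; apply: measurable_sum => aj; apply: measurable_funM.
    exact: (mfunI_comp (@mGam aj) mf mZ1).
  apply: measurable_funM.
    apply: (measurableT_comp mDs); apply: measurable_sum => k.
    by apply: measurable_funM => //; exact: (measurableT_comp mgp (mZ1 _)).
  apply: measurable_funM => //; apply: measurable_funM => //.
  exact: (measurableT_comp mDp (mZ1 _)).
apply: le_trans (poincare_C11 gZ mF mG CF) _.
rewrite mulrA -[leRHS]mulrA ler_wpM2l//.
  by rewrite mulr_ge0// Ex_ge0// => x; exact: sqr_ge0.
have tZ i := tame_coord i gZ.
have tf aj : tame P (fun om => feat gp gs (Z^~ om) aj).
  exact: (tame_lipP (mf aj) (C11_lipP (Cf aj)) tZ).
have tG j : tame P (fun om => Gam j (feat gp gs (Z^~ om))).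
  exact: (tame_lipP (@mGam j) (lGam j) tf).
have tGs : tame P (fun om => \sum_j Gam j (feat gp gs (Z^~ om)) ^+ 2).
  by apply: tame_sum => j; exact: tame_sqr.
rewrite -ExZ//; apply: Ex_le.
- apply: tame_sum => i; apply: tame_sqr.
  have [pG _] := CF; have [K [k HK]] := pG i.
  have tw := tame_wt1 tZ.
  apply: tame_dom (tameZ K (tameX k (tameD tw tw))) _; first by apply: mG; case: gZ.
  by move=> om; apply: le_trans (HK _ (Z^~ om)) (ler_norm _).
- exact: tameZ.
move=> om; set g := Z^~ om.
pose u b j := Ds (\sum_k X k j * gp (g (b, k))) * Gam (b, j) (feat gp gs g).
have GE b k : G (b, k) g = Dp (g (b, k)) * \sum_j X k j * u b j.
  rewrite /G.
  transitivity (\sum_(a < n) \sum_(j < T) Gam (a, j) (feat gp gs g) *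
     (Ds (\sum_k0 X k0 j * gp (g (a, k0))) * (X k j * Dp (g (b, k)) * (b == a)%:R))).
    by rewrite pair_big/=; apply: eq_bigr => -[a j] _.
  rewrite (bigD1 b)//= [X in _ + X]big1 => [|a ab]; last first.
    by rewrite big1// => j _; rewrite eq_sym (negbTE ab) !mulr0.
  rewrite addr0 mulr_sumr; apply: eq_bigr => j _; rewrite eqxx /u /=; ring.
have -> : \sum_i G i g ^+ 2 = \sum_b \sum_k G (b, k) g ^+ 2.
  by rewrite pair_big/=; apply: eq_bigr => -[b k] _.
have -> : \sum_j Gam j (feat gp gs g) ^+ 2 = \sum_b \sum_j Gam (b, j) (feat gp gs g) ^+ 2.
  by rewrite pair_big/=; apply: eq_bigr => -[b k] _.
rewrite mulr_sumr; apply: ler_sum => b _.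
apply: (@le_trans _ _ (lp ^+ 2 * \sum_k (\sum_j X k j * u b j) ^+ 2)).
  rewrite mulr_sumr; apply: ler_sum => k _; rewrite GE exprMn ler_wpM2r ?sqr_ge0//.
  by rewrite -[leLHS]real_normK ?num_real// lerXn2r ?nnegrE.
rewrite -mulrA -mulrA ler_wpM2l ?sqr_ge0//; apply: le_trans (XL (u b)) _.
rewrite [leRHS]mulrCA ler_wpM2l// mulr_sumr; apply: ler_sum => j _.
rewrite /u exprMn ler_wpM2r ?sqr_ge0//.
by rewrite -[leLHS]real_normK ?num_real// lerXn2r ?nnegrE.
Qed.

Lemma feat_mollify_dist (phi sigma gp gs : R -> R) (lp ls e : R) g aj :
  (forall x y, `|sigma x - sigma y| <= ls * `|x - y|) ->
  (forall x, `|gp x - phi x| <= 2 * lp * e) ->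
  (forall x, `|gs x - sigma x| <= 2 * ls * e) -> 0 <= ls ->
  `|feat gp gs g aj - feat phi sigma g aj| <=
    (2 * ls + ls * \sum_k `|X k aj.2| * (2 * lp)) * e.
Proof.
move=> sl gpe gse ls0.
rewrite /feat; set ze := \sum_k _; set z := \sum_k X k aj.2 * phi _.
have -> : gs ze - sigma z = (gs ze - sigma ze) + (sigma ze - sigma z) by ring.
apply: le_trans (ler_normD _ _) _; rewrite mulrDl; apply: lerD => //.
apply: le_trans (sl _ _) _; rewrite -mulrA; apply: ler_wpM2l => //.
rewrite /ze /z -sumrB; apply: le_trans (ler_norm_sum _ _ _) _.
rewrite mulr_suml; apply: ler_sum => k _.
by rewrite -mulrBr normrM -mulrA; apply: ler_wpM2l.
Qed.

Lemma lipP_le (J : finType) (F : (J -> R) -> R) : lipP F ->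
  exists K k, 0 <= K /\ forall x y, (F y - F x) ^+ 2 <=
    K * (wt1 x + wt1 y) ^+ k * dist2 x y.
Proof.
move=> [V pV HV]; have [K [k [K0 HK]]] := polybW pV.
exists K, k; split=> // x y; apply: le_trans (HV x y) _.
apply: ler_wpM2r; first exact: dist2_ge0.
exact: le_trans (ler_norm _) (HK k x y (leqnn k)).
Qed.

(* [phi] and [sigma] are mollified at scale [e], and [e] tends to 0: the bound
   sees only their Lipschitz constants. *)
Lemma poincare_features (phi sigma : R -> R) (lp ls : R) :
  0 <= L -> (forall x y, `|phi x - phi y| <= lp * `|x - y|) ->
  (forall x y, `|sigma x - sigma y| <= ls * `|x - y|) ->
  (forall aj, tame P (fun om => feat phi sigma (Z^~ om) aj)) /\
  Var P (fun om => Psi (feat phi sigma (Z^~ om))) <=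
  4 * normal_var R * (lp ^+ 2 * ls ^+ 2 * L) *
    Ex P (fun om => \sum_j Gam j (feat phi sigma (Z^~ om)) ^+ 2).
Proof.
move=> L0 lphi lsig.
have lip0 (l : R) (f : R -> R) : (forall x y : R, `|f x - f y| <= l * `|x - y|) -> 0 <= l.
  by move=> /(_ 0 1); have := normr_ge0 (f 0 - f 1); rewrite sub0r normrN1; lra.
have lp0 := lip0 _ _ lphi; have ls0 := lip0 _ _ lsig.
have mphi := lipschitz_measurable lphi; have msig := lipschitz_measurable lsig.
have tZ i := tame_coord i gZ.
have mf aj := mfunI_feat aj mphi msig.
pose S := fun om => feat phi sigma (Z^~ om).
have mS aj : measurable_fun setT (fun om => S om aj).
  by apply: mf; case: gZ.
have tS aj : tame P (fun om => S om aj).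
  have tt (f : R -> R) l (s : Om -> R) : (forall x y : R, `|f x - f y| <= l * `|x - y|) ->
      tame P s -> tame P (fun om => f (s om)).
    move=> lf ts; have l0 := lip0 _ _ lf.
    apply: tame_dom (tameD (tame_cst P `|f 0|) (tameZ l (tame_abs ts))) _.
      exact: (measurableT_comp (lipschitz_measurable lf) (tame_measurable ts)).
    move=> om; apply: le_trans (ler_norm _).
    have -> : f (s om) = f 0 + (f (s om) - f 0) by ring.
    apply: le_trans (ler_normD _ _) _; rewrite lerD2l.
    by apply: le_trans (lf _ _) _; rewrite subr0.
  apply: (tt _ ls) => //; apply: tame_sum => k; apply: tameZ.
  exact: (tt _ lp).
split=> //.
(* The squared distance between the features and their mollification at scale [e] is at most
   [e ^+ 2 * C]. *)
pose C := \sum_(aj : 'I_n * 'I_T) (2 * ls + ls * \sum_k `|X k aj.2| * (2 * lp)) ^+ 2.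
have C0 : 0 <= C by apply: sumr_ge0 => aj _; exact: sqr_ge0.
have tw := tame_wt1 tS.
have lPsi := C11_lipP CPsi.
pose FS om := Psi (S om).
pose A := fun om => \sum_j Gam j (S om) ^+ 2.
have tFS : tame P FS by exact: (tame_lipP mPsi lPsi tS).
have tGS j : tame P (fun om => Gam j (S om)) by exact: (tame_lipP (@mGam j) (lGam j) tS).
have tA : tame P A by apply: tame_sum => j; exact: tame_sqr.
have domin (F : ('I_n * 'I_T -> R) -> R) : lipP F ->
    exists2 B : R, 0 <= B & forall e : R, 0 < e <= 1 -> forall gp gs : R -> R,
    measurable_fun setT gp -> measurable_fun setT gs ->
    (forall x, `|gp x - phi x| <= 2 * lp * e) ->
    (forall x, `|gs x - sigma x| <= 2 * ls * e) ->
    mfunI F -> tame P (fun om => F (feat gp gs (Z^~ om))) /\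
    Ex P (fun om => (F (feat gp gs (Z^~ om)) - F (S om)) ^+ 2) <= e ^+ 2 * B.
  move=> lF; have [K [k [K0 HK]]] := lipP_le lF.
  (* A single tame bound serves every [e <= 1], because the weight of the mollified features is at
     most [2 * wt1 (S om) + 2 * C]. *)
  pose b om := K * (3 * wt1 (S om) + 2 * C) ^+ k * C.
  have b0 om : 0 <= b om.
    rewrite /b mulr_ge0// mulr_ge0// exprn_ge0//.
    by have := wt1_ge1 (S om); lra.
  have tb : tame P b.
    apply: tameM; last exact: tame_cst.
    apply: tameZ; apply: tameX; apply: tameD; last exact: tame_cst.
    exact: tameZ.
  exists (Ex P b); first exact: Ex_ge0.
  move=> e /andP[e0 e1] gp gs mgp mgs gpe gse mF.
  pose Se om := feat gp gs (Z^~ om).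
  have dS om : dist2 (S om) (Se om) <= e ^+ 2 * C.
    rewrite /dist2 mulr_sumr; apply: ler_sum => aj _.
    rewrite -exprMn mulrC -[leLHS]real_normK ?num_real//.
    have H := feat_mollify_dist (Z^~ om) aj lsig gpe gse ls0.
    by rewrite lerXn2r ?nnegrE// (le_trans _ H).
  have e2 : e ^+ 2 <= 1 by rewrite exprn_ile1// ltW.
  have wS om : wt1 (Se om) <= 2 * wt1 (S om) + 2 * C.
    have h1 : dist2 (S om) (Se om) <= C by apply: le_trans (dS om) _; nra.
    have : wt1 (Se om) <= 1 + \sum_j (2 * S om j ^+ 2 + 2 * (Se om j - S om j) ^+ 2).
      rewrite lerD2l; apply: ler_sum => j _.
      by have := sqr_ge0 (Se om j - 2 * S om j); nra.
    rewrite big_split/= -!mulr_sumr -/(dist2 (S om) (Se om)).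
    by rewrite [X in _ -> _ <= 2 * X + _]/wt1; lra.
  have tSe aj : tame P (fun om => Se om aj).
    apply: tame_dom (tameD (tameZ 2 tw) (tame_cst P (2 * C))) _.
      by apply: mfunI_feat => //; case: gZ.
    move=> om; apply: le_trans (abs_le_wt1 (Se om) aj) _.
    by apply: le_trans (wS om) (ler_norm _).
  have tFe := tame_lipP mF lF tSe.
  split=> //; rewrite -ExZ//; apply: Ex_le.
  - by apply: tame_sqr; apply: tameB => //; exact: (tame_lipP mF lF tS).
  - exact: tameZ.
  move=> om; apply: le_trans (HK (S om) (Se om)) _.
  rewrite /b [leRHS]mulrCA.
  have w0 := wt1_ge1 (S om); have w1 := wt1_ge1 (Se om); have w2 := wS om.
  apply: ler_pM.
  - by rewrite mulr_ge0// exprn_ge0//; lra.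
  - exact: dist2_ge0.
  - apply: ler_wpM2l => //; apply: lerXn2r; rewrite ?nnegrE; lra.
  - exact: dS.
have [B B0 HB] := domin _ lPsi.
have /choice[D HD] j : exists D : R, 0 <= D /\ forall e : R, 0 < e <= 1 -> forall gp gs : R -> R,
    measurable_fun setT gp -> measurable_fun setT gs ->
    (forall x, `|gp x - phi x| <= 2 * lp * e) ->
    (forall x, `|gs x - sigma x| <= 2 * ls * e) ->
    mfunI (Gam j) -> tame P (fun om => Gam j (feat gp gs (Z^~ om))) /\
    Ex P (fun om => (Gam j (feat gp gs (Z^~ om)) - Gam j (S om)) ^+ 2) <= e ^+ 2 * D.
  by have [D D0 HD] := domin _ (lGam j); exists D.
pose c := 4 * normal_var R * (lp ^+ 2 * ls ^+ 2 * L).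
have c0 : 0 <= c.
  rewrite /c !mulr_ge0 ?sqr_ge0//; apply: Ex_ge0 => x; exact: sqr_ge0.
pose DD := \sum_j D j.
have DD0 : 0 <= DD by apply: sumr_ge0 => j _; case: (HD j).
have A0 : 0 <= Ex P A by apply: Ex_ge0 => om; apply: sumr_ge0 => j _; exact: sqr_ge0.
have step e : 0 < e <= 1 ->
   Var P FS <= (1 + e) * (c * ((1 + e) * Ex P A + 2 * e * DD)) + 2 * e * B.
  move=> /[dup] e01 /andP[e0 e1].
  have [gp [Dp [gpe Dpl mgp mDp gpT]]] := mollify e0 lphi.
  have [gs [Ds [gse Dsl mgs mDs gsT]]] := mollify e0 lsig.
  have H := poincare_features_smooth L0 lp0 ls0 mgp mDp mgs mDs Dpl gpT Dsl gsT.
  have [tFe HFe] := HB e e01 gp gs mgp mgs gpe gse mPsi.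
  pose Fe om := Psi (feat gp gs (Z^~ om)).
  (* The mollification error is multiplied by [1 + e^-1] but is itself of order [e ^ 2], so it ends
     up of order [e], while the leading term only gains the factor [1 + e]. *)
  have young (u v : R) : (u + v) ^+ 2 <= (1 + e) * u ^+ 2 + (1 + e^-1) * v ^+ 2.
    have ee : e * e^-1 = 1 by rewrite divff// gt_eqF.
    have ei : 0 < e^-1 by rewrite invr_gt0.
    have : 0 <= e^-1 * (e * u - v) ^+ 2 by rewrite mulr_ge0 ?sqr_ge0// ltW.
    have -> : e^-1 * (e * u - v) ^+ 2 = (e * e^-1) * e * u ^+ 2 - 2 * (e * e^-1) * u * v + e^-1 * v ^+ 2 by ring.
    by rewrite ee; lra.
  have ye x : 0 <= x -> (1 + e^-1) * (e ^+ 2 * x) <= 2 * e * x.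
    move=> x0; rewrite mulrA; apply: ler_wpM2r => //.
    have -> : (1 + e^-1) * e ^+ 2 = e ^+ 2 + e by field; rewrite gt_eqF.
    by nra.
  have i1 : 0 <= 1 + e^-1 by rewrite addr_ge0// invr_ge0 ltW.
  apply: le_trans (Var_le (Ex P Fe) tFS) _.
  have t1 : tame P (fun om => (Fe om - Ex P Fe) ^+ 2).
    by apply: tame_sqr; apply: tameB => //; exact: tame_cst.
  have t2 : tame P (fun om => (Fe om - FS om) ^+ 2).
    by apply: tame_sqr; exact: tameB.
  apply: (@le_trans _ _ ((1 + e) * Var P Fe + (1 + e^-1) * Ex P (fun om => (Fe om - FS om) ^+ 2))).
    rewrite /Var -(ExZ _ t1) -(ExZ _ t2) -(ExD (tameZ _ t1) (tameZ _ t2)).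
    apply: Ex_le.
    - by apply: tame_sqr; apply: tameB => //; exact: tame_cst.
    - by apply: tameD; exact: tameZ.
    move=> om; have := young (Fe om - Ex P Fe) (FS om - Fe om).
    by rewrite (_ : _ + _ = FS om - Ex P Fe); last (by ring);
       rewrite -(sqrrN (FS om - Fe om)) opprB.
  apply: lerD; last by apply: le_trans (ler_wpM2l i1 HFe) _; exact: ye.
  apply: ler_wpM2l; first by rewrite addr_ge0// ltW.
  apply: le_trans H _; rewrite -/c; apply: ler_wpM2l => //.
  have tGe j : tame P (fun om => Gam j (feat gp gs (Z^~ om))).
    by have [_ HDj] := HD j; have [] := HDj e e01 gp gs mgp mgs gpe gse (@mGam j).
  rewrite Ex_sum; last by move=> j; exact: tame_sqr.
  rewrite Ex_sum; last by move=> j; exact: tame_sqr.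
  rewrite /DD !mulr_sumr -big_split/=; apply: ler_sum => j _.
  have [D0j HDj] := HD j.
  have [_ HE] := HDj e e01 gp gs mgp mgs gpe gse (@mGam j).
  have t3 := tame_sqr (tGS j); have t4 := tame_sqr (tameB (tGe j) (tGS j)).
  apply: (@le_trans _ _ ((1 + e) * Ex P (fun om => Gam j (S om) ^+ 2) +
     (1 + e^-1) * Ex P (fun om => (Gam j (feat gp gs (Z^~ om)) - Gam j (S om)) ^+ 2))).
    rewrite -(ExZ _ t3) -(ExZ _ t4) -(ExD (tameZ _ t3) (tameZ _ t4)).
    apply: Ex_le; [exact: tame_sqr|by apply: tameD; exact: tameZ|].
    move=> om; apply: le_trans (young _ _).
    by rewrite addrC subrK.
  by rewrite lerD2l; apply: le_trans (ler_wpM2l i1 HE) _; exact: ye.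
apply/ler_addgt0Pr => r r0.
(* [M] collects the coefficients of [e] in [step], with [e ^ 2] bounded by [e]; the 1 makes it
   positive. *)
pose M := 3 * c * Ex P A + 4 * c * DD + 2 * B + 1.
have cA : 0 <= c * Ex P A by rewrite mulr_ge0.
have cD : 0 <= c * DD by rewrite mulr_ge0.
have M0 : 0 < M by rewrite /M; lra.
pose e := Num.min 1 (r / M).
have e0 : 0 < e by rewrite lt_min ltr01 divr_gt0.
have e1 : e <= 1 by rewrite ge_min lexx.
have eM : e * M <= r by rewrite -ler_pdivlMr// ge_min lexx orbT.
have e01 : 0 < e <= 1 by rewrite e0 e1.
apply: le_trans (step e e01) _; rewrite -/c.
have ee : e * e <= e by rewrite ger_pMl.
have e3 : e * e * (c * Ex P A) <= e * (c * Ex P A) by rewrite ler_wpM2r.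
have e4 : e * e * (c * DD) <= e * (c * DD) by rewrite ler_wpM2r.
have -> : Ex P (fun om => \sum_j Gam j (feat phi sigma (Z^~ om)) ^+ 2) = Ex P A by [].
move: eM; rewrite /M.
have -> : (1 + e) * (c * ((1 + e) * Ex P A + 2 * e * DD)) + 2 * e * B =
  c * Ex P A + 2 * e * (c * Ex P A) + e * e * (c * Ex P A) + 2 * e * (c * DD)
   + 2 * (e * e * (c * DD)) + 2 * (e * B) by ring.
have -> : e * (3 * c * Ex P A + 4 * c * DD + 2 * B + 1) =
  3 * (e * (c * Ex P A)) + 4 * (e * (c * DD)) + 2 * (e * B) + e by ring.
lra.
Qed.

End features_poincare.

(** * Quadratic forms and ridge inverses *)

Section dot_product.
Context (R : realType).

Definition dotv (m : nat) (u v : 'cV[R]_m) : R := (u^T *m v) 0 0.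

Lemma dotvE m (u v : 'cV[R]_m) : dotv u v = \sum_i u i 0 * v i 0.
Proof. by rewrite /dotv mxE; apply: eq_bigr => i _; rewrite mxE. Qed.

Lemma dotvC m (u v : 'cV[R]_m) : dotv u v = dotv v u.
Proof. by rewrite !dotvE; apply: eq_bigr => i _; rewrite mulrC. Qed.

Lemma dotvDl m (u v w : 'cV[R]_m) : dotv (u + v) w = dotv u w + dotv v w.
Proof. by rewrite /dotv linearD/= mulmxDl mxE. Qed.

Lemma dotvDr m (u v w : 'cV[R]_m) : dotv w (u + v) = dotv w u + dotv w v.
Proof. by rewrite /dotv mulmxDr mxE. Qed.

Lemma dotvNl m (u w : 'cV[R]_m) : dotv (- u) w = - dotv u w.
Proof. by rewrite /dotv linearN/= mulNmx mxE. Qed.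

Lemma dotvNr m (u w : 'cV[R]_m) : dotv w (- u) = - dotv w u.
Proof. by rewrite /dotv mulmxN mxE. Qed.

Lemma dotvBl m (u v w : 'cV[R]_m) : dotv (u - v) w = dotv u w - dotv v w.
Proof. by rewrite dotvDl dotvNl. Qed.

Lemma dotvBr m (u v w : 'cV[R]_m) : dotv w (u - v) = dotv w u - dotv w v.
Proof. by rewrite dotvDr dotvNr. Qed.

Lemma dotvZl m a (u w : 'cV[R]_m) : dotv (a *: u) w = a * dotv u w.
Proof. by rewrite /dotv linearZ/= -scalemxAl mxE. Qed.

Lemma dotvZr m a (u w : 'cV[R]_m) : dotv w (a *: u) = a * dotv w u.
Proof. by rewrite /dotv -scalemxAr mxE. Qed.

Lemma dotv_mulmx m k (A : 'M[R]_(m, k)) u v : dotv u (A *m v) = dotv (A^T *m u) v.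
Proof. by rewrite /dotv trmx_mul trmxK mulmxA. Qed.

Lemma dotv_ge0 m (u : 'cV[R]_m) : 0 <= dotv u u.
Proof. by rewrite dotvE sumr_ge0// => i _; rewrite -expr2 sqr_ge0. Qed.

Lemma dotvv m (u : 'cV[R]_m) : dotv u u = \sum_i u i 0 ^+ 2.
Proof. by rewrite dotvE; apply: eq_bigr => i _; rewrite expr2. Qed.

Lemma dotvv_eq0 m (u : 'cV[R]_m) : dotv u u = 0 -> u = 0.
Proof.
rewrite dotvv => /eqP; rewrite psumr_eq0 => [/allP H|i _]; last exact: sqr_ge0.
apply/colP => i; rewrite mxE; apply/eqP.
by have := H i (mem_index_enum _); rewrite /= sqrf_eq0.
Qed.

Lemma dotv0l m (u : 'cV[R]_m) : dotv 0 u = 0.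
Proof. by rewrite /dotv linear0 mul0mx mxE. Qed.

Lemma quad_discr (a b c : R) : 0 <= a -> 0 <= c ->
  (forall t u : R, 0 <= t ^+ 2 * a - 2 * t * u * b + u ^+ 2 * c) ->
  b ^+ 2 <= a * c.
Proof.
move=> a0 c0 H; have [c0'|cn0] := eqVneq c 0.
  have ab := mulr_ge0 a0 (sqr_ge0 b); have := H b (a + 1).
  by rewrite c0' !mulr0 addr0; nra.
have cp : 0 < c by rewrite lt_def cn0.
have Hc := H c b; rewrite -(ler_pM2l cp); nra.
Qed.

Lemma psd_CS m (A : 'M[R]_m) (u v : 'cV[R]_m) : A^T = A ->
  (forall w : 'cV[R]_m, 0 <= dotv w (A *m w)) ->
  dotv u (A *m v) ^+ 2 <= dotv u (A *m u) * dotv v (A *m v).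
Proof.
move=> As Ap; apply: quad_discr => // t s.
have := Ap (t *: u - s *: v).
rewrite mulmxBr -!scalemxAr dotvBl !dotvBr !dotvZl !dotvZr.
have -> : dotv v (A *m u) = dotv u (A *m v) by rewrite dotv_mulmx As dotvC.
by congr (_ <= _); ring.
Qed.

Lemma dotv_CS m (u v : 'cV[R]_m) : dotv u v ^+ 2 <= dotv u u * dotv v v.
Proof.
have := @psd_CS m 1%:M u v; rewrite !mul1mx; apply; first by rewrite trmx1.
by move=> w; rewrite mul1mx dotv_ge0.
Qed.

Lemma l2norm_sqr m (u : 'cV[R]_m) : l2norm u ^+ 2 = dotv u u.
Proof. by rewrite /l2norm sqr_sqrtr -?dotvv ?dotv_ge0. Qed.

Lemma l2norm_ge0 m (u : 'cV[R]_m) : 0 <= l2norm u.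
Proof. exact: sqrtr_ge0. Qed.

Lemma l2norm_le m (u : 'cV[R]_m) c : 0 <= c -> dotv u u <= c ^+ 2 -> l2norm u <= c.
Proof.
move=> c0 H; rewrite -(@ler_pXn2r _ 2) ?nnegrE ?l2norm_ge0//.
by rewrite l2norm_sqr.
Qed.

Lemma opnorm_le m k (A : 'M[R]_(m, k)) c : 0 <= c ->
  (forall v, dotv (A *m v) (A *m v) <= c ^+ 2 * dotv v v) -> opnorm A <= c.
Proof.
move=> c0 H; apply: ge_sup.
  by exists (l2norm (A *m 0)), 0 => //=; rewrite /l2norm big1 ?sqrtr0// => i _; rewrite mxE expr0n.
move=> _ [v /= v1 <-]; apply: l2norm_le => //; apply: le_trans (H v) _.
rewrite -l2norm_sqr ler_piMr ?sqr_ge0// exprn_ile1//; exact: l2norm_ge0.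
Qed.

Lemma opnorm_has_ubound m k (A : 'M[R]_(m, k)) :
  has_ubound [set l2norm (A *m v) | v in [set v : 'cV[R]_k | l2norm v <= 1]].
Proof.
pose C := \sum_i \sum_j `|A i j|.
have C0 : 0 <= C by apply: sumr_ge0 => i _; apply: sumr_ge0.
exists (Num.sqrt (m%:R * C ^+ 2)) => _ [v /= v1 <-].
rewrite /l2norm ler_wsqrtr//.
have vj j : `|v j 0| <= 1.
  apply: le_trans v1; rewrite -[leLHS]ger0_norm//.
  rewrite -(@ler_pXn2r _ 2) ?nnegrE ?l2norm_ge0// l2norm_sqr dotvv.
  rewrite real_normK ?num_real// real_normK ?num_real// (bigD1 j)//= lerDl.
  by apply: sumr_ge0 => i _; exact: sqr_ge0.
apply: (@le_trans _ _ (\sum_(i < m) C ^+ 2)); last first.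
  by rewrite sumr_const card_ord mulr_natl.
apply: ler_sum => i _; rewrite -[leLHS]real_normK ?num_real// lerXn2r ?nnegrE//.
rewrite mxE; apply: le_trans (ler_norm_sum _ _ _) _.
apply: (@le_trans _ _ (\sum_j `|A i j|)).
  by apply: ler_sum => j _; rewrite normrM ler_piMr.
by rewrite /C (bigD1 i)//= lerDl sumr_ge0// => k' _; exact: sumr_ge0.
Qed.

Lemma opnorm_ge0 m k (A : 'M[R]_(m, k)) : 0 <= opnorm A.
Proof.
apply: (@le_trans _ _ (l2norm (A *m 0))); first exact: l2norm_ge0.
apply: ub_le_sup; first exact: opnorm_has_ubound.
by exists 0 => //=; rewrite /l2norm big1 ?sqrtr0// => i _; rewrite mxE expr0n.
Qed.

Lemma opnorm_bound m k (A : 'M[R]_(m, k)) (v : 'cV[R]_k) :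
  dotv (A *m v) (A *m v) <= opnorm A ^+ 2 * dotv v v.
Proof.
have [v0|v0] := eqVneq (dotv v v) 0.
  by rewrite (dotvv_eq0 v0) mulmx0 !dotv0l mulr0.
have vp : 0 < dotv v v by rewrite lt_def v0 dotv_ge0.
have lp : 0 < l2norm v.
  rewrite lt_def l2norm_ge0 andbT; apply/eqP => l0.
  by move: vp; rewrite -l2norm_sqr l0 expr0n ltxx.
have H : l2norm (A *m ((l2norm v)^-1 *: v)) <= opnorm A.
  apply: ub_le_sup; first exact: opnorm_has_ubound.
  exists ((l2norm v)^-1 *: v) => //=; apply: l2norm_le => //.
  by rewrite dotvZl dotvZr -l2norm_sqr expr2 mulKf ?gt_eqF// mulVf ?gt_eqF// expr1n.
have := H; rewrite -(@ler_pXn2r _ 2) ?nnegrE ?l2norm_ge0 ?opnorm_ge0//.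
rewrite l2norm_sqr -scalemxAr dotvZl dotvZr mulrA -expr2 exprVn l2norm_sqr.
by rewrite mulrC ler_pdivrMr.
Qed.

(** With [w = A^T v], [|w|^2] is the inner product of [v] and [A w], hence
    [|w|^4 <= |v|^2 |A|^2 |w|^2]. *)
Lemma opnorm_tr_bound m k (A : 'M[R]_(m, k)) (v : 'cV[R]_m) :
  dotv (A^T *m v) (A^T *m v) <= opnorm A ^+ 2 * dotv v v.
Proof.
set w := A^T *m v; have [w0|w0] := eqVneq (dotv w w) 0.
  by rewrite w0 mulr_ge0 ?sqr_ge0 ?dotv_ge0.
have wp : 0 < dotv w w by rewrite lt_def w0 dotv_ge0.
have E : dotv w w = dotv v (A *m w) by rewrite dotv_mulmx.
have := dotv_CS v (A *m w); rewrite -E => H.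
have := le_trans H (ler_wpM2l (dotv_ge0 v) (opnorm_bound A w)).
by rewrite expr2 mulrCA mulrA ler_pM2r// mulrC.
Qed.

Lemma opnorm_bilin m k (A : 'M[R]_(m, k)) c : 0 <= c ->
  (forall u v, dotv u (A *m v) ^+ 2 <= c ^+ 2 * dotv u u * dotv v v) -> opnorm A <= c.
Proof.
move=> c0 H; apply: opnorm_le => // v.
have := H (A *m v) v; set a := dotv (A *m v) _ => h.
have a0 : 0 <= a by exact: dotv_ge0.
have [->|an0] := eqVneq a 0; first by rewrite mulr_ge0 ?sqr_ge0 ?dotv_ge0.
have ap : 0 < a by rewrite lt_def an0.
by move: h; rewrite expr2 mulrAC ler_pM2r.
Qed.

End dot_product.

(** * Inverse of a nonnegative matrix shifted by a positive scalar *)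

Section posdef_inverse.
Context (R : realType) (m : nat) (gamma : R) (B : 'M[R]_m).
Hypotheses (g0 : 0 < gamma) (Bs : B^T = B)
  (Bp : forall v : 'cV[R]_m, 0 <= dotv v (B *m v)).
Local Notation M := (B + gamma%:M).

Lemma ridge_dot (v : 'cV[R]_m) : dotv v (M *m v) = dotv v (B *m v) + gamma * dotv v v.
Proof. by rewrite mulmxDl mul_scalar_mx dotvDr dotvZr. Qed.

Lemma ridge_sym : M^T = M.
Proof. by rewrite linearD/= Bs tr_scalar_mx. Qed.

Lemma ridge_unit : M \in unitmx.
Proof.
rewrite -row_free_unit -kermx_eq0; apply/eqP/row_matrixP => i; rewrite row0.
set r := row i _.
have rM : r *m M = 0 by rewrite /r -row_mul mulmx_ker row0.
have Mr : M *m r^T = 0 by rewrite -[M]ridge_sym -trmx_mul rM trmx0.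
have := ridge_dot r^T; rewrite Mr dotvC dotv0l => /esym/eqP.
rewrite paddr_eq0// ?mulr_ge0 ?dotv_ge0 ?(ltW g0)// => /andP[_].
rewrite mulf_eq0 gt_eqF//= => /eqP/dotvv_eq0 r0.
by rewrite -[r]trmxK r0 trmx0.
Qed.

Local Notation N := (invmx M).

Lemma ridge_inv_sym : N^T = N.
Proof. by rewrite trmx_inv ridge_sym. Qed.

Lemma ridge_invK : M *m N = 1%:M. Proof. exact: mulmxV ridge_unit. Qed.
(** With [x = N v] one has [v = B x + gamma x]; the bounds on [N] that follow come from dropping one
    of the two nonnegative terms. *)
Lemma ridge_inv_dot (v : 'cV[R]_m) :
  dotv v (N *m v) = dotv (N *m v) (B *m (N *m v)) + gamma * dotv (N *m v) (N *m v).
Proof.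
by rewrite -ridge_dot !mulmxA ridge_invK mul1mx dotvC.
Qed.

Lemma ridge_inv_ge0 (v : 'cV[R]_m) : 0 <= dotv v (N *m v).
Proof. by rewrite ridge_inv_dot addr_ge0 ?mulr_ge0 ?dotv_ge0// ltW. Qed.

Lemma ridge_inv_norm_dot (v : 'cV[R]_m) :
  dotv (N *m v) (N *m v) <= gamma^-1 * dotv v (N *m v).
Proof. by rewrite ler_pdivlMl// ridge_inv_dot lerDr. Qed.

Lemma ridge_inv_B_le (v : 'cV[R]_m) :
  dotv (N *m v) (B *m (N *m v)) <= dotv v (N *m v).
Proof. by rewrite [leRHS]ridge_inv_dot lerDl mulr_ge0 ?dotv_ge0// ltW. Qed.

Lemma ridge_inv_le (v : 'cV[R]_m) : dotv v (N *m v) <= gamma^-1 * dotv v v.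
Proof.
set a := dotv v (N *m v).
have a0 : 0 <= a by exact: ridge_inv_ge0.
have [->|an0] := eqVneq a 0.
  by rewrite mulr_ge0 ?dotv_ge0// invr_ge0 ltW.
have ap : 0 < a by rewrite lt_def an0.
have := dotv_CS v (N *m v); rewrite -/a => H.
have := le_trans H (ler_wpM2l (dotv_ge0 v) (ridge_inv_norm_dot v)).
by rewrite -/a expr2 mulrA ler_pM2r// mulrC.
Qed.

Lemma ridge_inv_norm (v : 'cV[R]_m) :
  dotv (N *m v) (N *m v) <= gamma^-1 ^+ 2 * dotv v v.
Proof.
apply: le_trans (ridge_inv_norm_dot v) _; rewrite expr2 -mulrA ler_wpM2l//.
  by rewrite invr_ge0 ltW.
exact: ridge_inv_le.
Qed.

End posdef_inverse.

(** * Measurability of matrix-valued maps *)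

Section measurable_matrix.
Context (R : realType) (d : measure_display) (Om : measurableType d).

Definition mmx (m k : nat) (M : Om -> 'M[R]_(m, k)) : Prop :=
  forall i j, measurable_fun setT (fun om => M om i j).

Lemma mmx_mul m k l (A : Om -> 'M[R]_(m, k)) (B : Om -> 'M[R]_(k, l)) :
  mmx A -> mmx B -> mmx (fun om => A om *m B om).
Proof.
move=> mA mB i j; under eq_fun do rewrite mxE.
by apply: measurable_sum => a; exact: measurable_funM.
Qed.

Lemma mmx_add m k (A B : Om -> 'M[R]_(m, k)) :
  mmx A -> mmx B -> mmx (fun om => A om + B om).
Proof. by move=> mA mB i j; under eq_fun do rewrite mxE; exact: measurable_funD. Qed.

Lemma mmx_cst m k (A : 'M[R]_(m, k)) : mmx (fun _ => A).
Proof. by move=> i j; exact: measurable_cst. Qed.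

Lemma mmx_scale m k (a : R) (A : Om -> 'M[R]_(m, k)) :
  mmx A -> mmx (fun om => a *: A om).
Proof. by move=> mA i j; under eq_fun do rewrite mxE; exact: measurable_funM. Qed.

Lemma mmx_tr m k (A : Om -> 'M[R]_(m, k)) : mmx A -> mmx (fun om => (A om)^T).
Proof. by move=> mA i j; under eq_fun do rewrite mxE; exact: mA. Qed.

Lemma measurable_bigprod (A : Type) (s : seq A) (F : A -> Om -> R) :
  (forall a, measurable_fun setT (F a)) ->
  measurable_fun setT (fun om => \prod_(a <- s) F a om).
Proof.
move=> mF; elim: s => [|a s IH].
  by under eq_fun do rewrite big_nil; exact: measurable_cst.
by under eq_fun do rewrite big_cons; exact: measurable_funM.
Qed.

Lemma measurable_det m (A : Om -> 'M[R]_m) :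
  mmx A -> measurable_fun setT (fun om => \det (A om)).
Proof.
move=> mA; apply: measurable_sum => s; apply: measurable_funM => //.
by apply: measurable_bigprod => i; exact: mA.
Qed.

(** Cramer's rule: each entry is a polynomial in the entries divided by a determinant that does not
    vanish. *)
Lemma mmx_inv m (A : Om -> 'M[R]_m) :
  mmx A -> (forall om, A om \in unitmx) -> mmx (fun om => invmx (A om)).
Proof.
move=> mA uA i j.
have -> : (fun om => invmx (A om) i j) =
    (fun om => (\det (A om))^-1 * \adj (A om) i j).
  by apply/funext => om; rewrite /invmx uA mxE.
apply: measurable_funM.
  apply: (@measurable_comp _ _ _ _ _ _ [set r : R | r != 0%R]) => //.
  + exact: open_measurable.
  + by move=> _ [om _ <-] /=; rewrite -unitfE -unitmxE.
  + apply: open_continuous_measurable_fun => //; apply/in_setP => x /= x0.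
    exact: inv_continuous.
  + exact: measurable_det.
under eq_fun do rewrite mxE /cofactor.
apply: measurable_funM => //; apply: measurable_det => a b.
by under eq_fun do rewrite !mxE; exact: mA.
Qed.

End measurable_matrix.

(** * Leave-one-out resolvents *)

Section resolvent.
Context (R : realType) (gamma : R) (g0 : 0 < gamma) (n T : nat).
Implicit Types (S : 'M[R]_(n, T)) (v : 'cV[R]_T).

Definition srow S (a : 'I_n) : 'cV[R]_T := (row a S)^T.

Lemma dotv_srow S a v : dotv (srow S a) v = (S *m v) a 0.
Proof. by rewrite /dotv /srow trmxK -row_mul mxE. Qed.

Lemma gram_sym S : (T%:R^-1 *: (S^T *m S))^T = T%:R^-1 *: (S^T *m S).
Proof. by rewrite linearZ/= trmx_mul trmxK. Qed.

Lemma gram_dot S v : dotv v (T%:R^-1 *: (S^T *m S) *m v) =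
  T%:R^-1 * dotv (S *m v) (S *m v).
Proof. by rewrite -scalemxAl dotvZr -mulmxA [dotv v (S^T *m _)]dotv_mulmx trmxK. Qed.

Lemma gram_ge0 S v : 0 <= dotv v (T%:R^-1 *: (S^T *m S) *m v).
Proof. by rewrite gram_dot mulr_ge0 ?invr_ge0 ?dotv_ge0. Qed.

Lemma res_unit S : T%:R^-1 *: (S^T *m S) + gamma%:M \in unitmx.
Proof. exact: ridge_unit g0 (gram_sym S) (@gram_ge0 S). Qed.

Lemma res_sym S : (resolvent gamma S)^T = resolvent gamma S.
Proof. exact: ridge_inv_sym (gram_sym S). Qed.

Lemma res_ge0 S v : 0 <= dotv v (resolvent gamma S *m v).
Proof. exact: ridge_inv_ge0 g0 (gram_sym S) (@gram_ge0 S) v. Qed.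

Lemma res_le S v : dotv v (resolvent gamma S *m v) <= gamma^-1 * dotv v v.
Proof. exact: ridge_inv_le g0 (gram_sym S) (@gram_ge0 S) v. Qed.

Lemma res_norm_dot S v :
  dotv (resolvent gamma S *m v) (resolvent gamma S *m v) <=
  gamma^-1 * dotv v (resolvent gamma S *m v).
Proof. exact: ridge_inv_norm_dot g0 (gram_sym S) (@gram_ge0 S) v. Qed.

Lemma res_norm S v :
  dotv (resolvent gamma S *m v) (resolvent gamma S *m v) <=
  gamma^-1 ^+ 2 * dotv v v.
Proof. exact: ridge_inv_norm g0 (gram_sym S) (@gram_ge0 S) v. Qed.

Lemma res_entry S j k : `|resolvent gamma S j k| <= gamma^-1.
Proof.
have gi : 0 <= gamma^-1 by rewrite invr_ge0 ltW.
pose e (i : 'I_T) : 'cV[R]_T := delta_mx i 0.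
have ee i : dotv (e i) (e i) = 1.
  by rewrite /dotv /e trmx_delta mul_delta_mx mxE !eqxx.
have -> : resolvent gamma S j k = dotv (e j) (resolvent gamma S *m e k).
  by rewrite /dotv /e trmx_delta mulmxA -rowE -colE !mxE.
rewrite -(@ler_pXn2r _ 2) ?nnegrE// real_normK ?num_real//.
apply: le_trans (psd_CS _ _ (res_sym S) (@res_ge0 S)) _.
rewrite expr2; apply: ler_pM; rewrite ?res_ge0//.
  by apply: le_trans (res_le S (e j)) _; rewrite ee mulr1.
by apply: le_trans (res_le S (e k)) _; rewrite ee mulr1.
Qed.

Lemma mmx_res (d : measure_display) (Om : measurableType d)
    (S : Om -> 'M[R]_(n, T)) :
  mmx S -> mmx (fun om => resolvent gamma (S om)).
Proof.
move=> mS; apply: mmx_inv => [|om]; last exact: res_unit.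
apply: mmx_add; last exact: mmx_cst.
by apply: mmx_scale; apply: mmx_mul => //; exact: mmx_tr.
Qed.

Lemma res_diff S S' :
  resolvent gamma S - resolvent gamma S' =
  - (T%:R^-1 *: (resolvent gamma S *m (S^T *m S - S'^T *m S') *m resolvent gamma S')).
Proof.
set Q := resolvent gamma S; set Q' := resolvent gamma S'.
have uS := res_unit S; have uS' := res_unit S'.
set M := T%:R^-1 *: (S^T *m S) + gamma%:M in uS.
set M' := T%:R^-1 *: (S'^T *m S') + gamma%:M in uS'.
have QM : Q *m M = 1%:M by exact: mulVmx.
have MQ : M' *m Q' = 1%:M by exact: mulmxV.
have -> : Q - Q' = - (Q *m (M - M') *m Q').
  by rewrite mulmxBr mulmxBl QM -mulmxA MQ mulmx1 mul1mx opprB.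
congr (- _); rewrite /M /M' opprD addrACA subrr addr0 -scalerBr.
by rewrite -scalemxAr -scalemxAl.
Qed.

(** The sum is [|S Q v|^2], and [S^T S / T] is below the inverse of [Q] as a quadratic form. A sum
    over all [n] rows thus costs [T] times a bounded quantity, with no bound on the rows
    themselves. *)
Lemma res_rows_le S v : (0 < T)%N ->
  \sum_a dotv (srow S a) (resolvent gamma S *m v) ^+ 2 <=
  T%:R * dotv v (resolvent gamma S *m v).
Proof.
move=> T0; have T1 : 0 < T%:R :> R by rewrite ltr0n.
have := ridge_inv_B_le g0 (gram_sym S) (@gram_ge0 S) v.
rewrite -/(resolvent gamma S) gram_dot ler_pdivrMl// dotvv => H.
by apply: le_trans H; under eq_bigr do rewrite dotv_srow.
Qed.

(** The row is zeroed rather than deleted: the type is unchanged and the Gram matrices differ by a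
    rank-one term. *)
Definition zrow (i : 'I_n) S : 'M[R]_(n, T) :=
  \matrix_(a, j) if a == i then 0 else S a j.

Lemma gram_zrow i S :
  S^T *m S - (zrow i S)^T *m zrow i S = srow S i *m (srow S i)^T.
Proof.
apply/matrixP => j k; rewrite !mxE big_ord1 !mxE -sumrB (bigD1 i)//=.
rewrite !mxE eqxx mul0r subr0 big1 ?addr0// => a ai.
by rewrite !mxE (negbTE ai) subrr.
Qed.

Section leave_one_out.
Variables (S : 'M[R]_(n, T)) (i : 'I_n).
Local Notation Q := (resolvent gamma S).
Local Notation Qi := (resolvent gamma (zrow i S)).
Local Notation s := (srow S i).
Definition loo_quad : R := T%:R^-1 * dotv s (Qi *m s).

Lemma loo_quad_ge0 : 0 <= loo_quad.
Proof. by rewrite mulr_ge0 ?invr_ge0 ?res_ge0. Qed.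

Lemma loo_diff : Qi - Q = T%:R^-1 *: (Q *m s *m (s^T *m Qi)).
Proof.
by rewrite -opprB res_diff opprK gram_zrow !mulmxA.
Qed.

Lemma loo_mul : Qi *m s = (1 + loo_quad) *: (Q *m s).
Proof.
have -> : Qi *m s = Q *m s + (Qi - Q) *m s by rewrite mulmxBl addrC subrK.
rewrite loo_diff -scalemxAl -!mulmxA scalerDl scale1r; congr (_ + _).
rewrite (mx11_scalar (s^T *m (Qi *m s))) mul_mx_scalar -scalemxAr scalerA.
by rewrite -/(dotv s (Qi *m s)).
Qed.

(** Sherman-Morrison on the second factor too, so that only [Q] is left in the rank-one term; its
    sums over [i] are then controlled by [res_rows_le]. *)
Lemma loo_diff2 : Qi - Q = (T%:R^-1 * (1 + loo_quad)) *: (Q *m s *m (s^T *m Q)).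
Proof.
have sQ : s^T *m Qi = (1 + loo_quad) *: (s^T *m Q).
  by apply: trmx_inj; rewrite !linearZ/= !trmx_mul !trmxK !res_sym loo_mul.
by rewrite loo_diff sQ -scalemxAr scalerA.
Qed.

End leave_one_out.

End resolvent.

Lemma col_mulmx (R : realType) m k l (A : 'M[R]_(m, k)) (B : 'M[R]_(k, l)) j :
  col j (A *m B) = A *m col j B.
Proof. by rewrite !colE mulmxA. Qed.

(** * First- and second-order increments, for scalars and for matrices *)

Section small_orders.
Context (R : realType) (I : finType).
Implicit Types f g : (I -> R) -> (I -> R) -> R.

(* First and second order in [y - x], up to polynomial growth. *)
Definition incr1 f : Prop := exists2 V, polyb V &
  forall x y, f x y ^+ 2 <= V x y * dist2 x y.

Definition incr2 f : Prop := exists2 V, polyb V &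
  forall x y, `|f x y| <= V x y * dist2 x y.

Lemma incr1_0 : incr1 (fun _ _ => 0).
Proof.
by exists (fun _ _ => 0) => [|x y]; [exact: polyb_cst|rewrite expr0n mul0r].
Qed.

Lemma incr2_0 : incr2 (fun _ _ => 0).
Proof.
by exists (fun _ _ => 0) => [|x y]; [exact: polyb_cst|rewrite normr0 mul0r].
Qed.

Lemma incr1_coord i : incr1 (fun x y => y i - x i).
Proof.
exists (fun _ _ => 1) => [|x y]; first exact: polyb_cst.
rewrite mul1r /dist2 (bigD1 i)//= lerDl.
by apply: sumr_ge0 => j _; exact: sqr_ge0.
Qed.

Lemma incr1D f g : incr1 f -> incr1 g -> incr1 (fun x y => f x y + g x y).
Proof.
move=> [V pV HV] [W pW HW]; exists (fun x y => 2 * (V x y + W x y)) => [|x y].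
  by apply: polybM; [exact: polyb_cst|exact: polybD].
have := HV x y; have := HW x y; have := sqr_ge0 (f x y - g x y); lra.
Qed.

Lemma incr2D f g : incr2 f -> incr2 g -> incr2 (fun x y => f x y + g x y).
Proof.
move=> [V pV HV] [W pW HW]; exists (fun x y => V x y + W x y) => [|x y].
  exact: polybD.
by apply: le_trans (ler_normD _ _) _; rewrite mulrDl; exact: lerD.
Qed.

Lemma incr1_sum (J : finType) (F : J -> (I -> R) -> (I -> R) -> R) :
  (forall j, incr1 (F j)) -> incr1 (fun x y => \sum_j F j x y).
Proof.
move=> oF; rewrite (_ : (fun x y => _) = fun x y => \sum_(j <- enum J) F j x y).
  elim: (enum J) => [|j s IH].
    by under eq_fun do under eq_fun do rewrite big_nil; exact: incr1_0.
  by under eq_fun do under eq_fun do rewrite big_cons; exact: incr1D.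
by apply/funext => x; apply/funext => y; rewrite big_enum.
Qed.

Lemma incr2_sum (J : finType) (F : J -> (I -> R) -> (I -> R) -> R) :
  (forall j, incr2 (F j)) -> incr2 (fun x y => \sum_j F j x y).
Proof.
move=> oF; rewrite (_ : (fun x y => _) = fun x y => \sum_(j <- enum J) F j x y).
  elim: (enum J) => [|j s IH].
    by under eq_fun do under eq_fun do rewrite big_nil; exact: incr2_0.
  by under eq_fun do under eq_fun do rewrite big_cons; exact: incr2D.
by apply/funext => x; apply/funext => y; rewrite big_enum.
Qed.

Lemma incr1Ml f g : polyb f -> incr1 g -> incr1 (fun x y => f x y * g x y).
Proof.
move=> pf [V pV HV]; exists (fun x y => f x y ^+ 2 * V x y) => [|x y].
  by apply: polybM => //; exact: polybX.
by rewrite exprMn -mulrA ler_wpM2l ?sqr_ge0.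
Qed.

Lemma incr2Ml f g : polyb f -> incr2 g -> incr2 (fun x y => f x y * g x y).
Proof.
move=> pf [V pV HV]; exists (fun x y => `|f x y| * V x y) => [|x y].
  by apply: polybM => //; exact: polyb_abs.
by rewrite normrM -mulrA ler_wpM2l.
Qed.

Lemma incr11 f g : incr1 f -> incr1 g -> incr2 (fun x y => f x y * g x y).
Proof.
move=> [V pV HV] [W pW HW]; exists (fun x y => V x y + W x y) => [|x y].
  exact: polybD.
have h1 := HV x y; have h2 := HW x y; rewrite normrM mulrDl.
have n1 : `|f x y| ^+ 2 = f x y ^+ 2 by rewrite real_normK ?num_real.
have n2 : `|g x y| ^+ 2 = g x y ^+ 2 by rewrite real_normK ?num_real.
have := sqr_ge0 (`|f x y| - `|g x y|); have := normr_ge0 (f x y).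
have := normr_ge0 (g x y); have := sqr_ge0 (f x y); have := sqr_ge0 (g x y); nra.
Qed.

Lemma incr1_lipP (F : (I -> R) -> R) : incr1 (fun x y => F y - F x) -> lipP F.
Proof. by []. Qed.

End small_orders.

Section small_matrix.
Context (R : realType) (I : finType).
Local Notation fn A := ((I -> R) -> (I -> R) -> A).

Definition mpolyb m k (A : fn 'M[R]_(m, k)) := forall i j, polyb (fun x y => A x y i j).
Definition mincr1 m k (A : fn 'M[R]_(m, k)) := forall i j, incr1 (fun x y => A x y i j).
Definition mincr2 m k (A : fn 'M[R]_(m, k)) := forall i j, incr2 (fun x y => A x y i j).

Lemma mpolyb_mul m k l (A : fn 'M[R]_(m, k)) (B : fn 'M[R]_(k, l)) :
  mpolyb A -> mpolyb B -> mpolyb (fun x y => A x y *m B x y).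
Proof.
move=> pA pB i j; under eq_fun do under eq_fun do rewrite mxE.
by apply: polyb_sum => a; exact: polybM.
Qed.

Lemma mincr1_mull m k l (A : fn 'M[R]_(m, k)) (B : fn 'M[R]_(k, l)) :
  mpolyb A -> mincr1 B -> mincr1 (fun x y => A x y *m B x y).
Proof.
move=> pA pB i j; under eq_fun do under eq_fun do rewrite mxE.
by apply: incr1_sum => a; exact: incr1Ml.
Qed.

Lemma mincr1_mulr m k l (A : fn 'M[R]_(m, k)) (B : fn 'M[R]_(k, l)) :
  mincr1 A -> mpolyb B -> mincr1 (fun x y => A x y *m B x y).
Proof.
move=> pA pB i j; under eq_fun do under eq_fun do rewrite mxE.
apply: incr1_sum => a; under eq_fun do under eq_fun do rewrite mulrC.
exact: incr1Ml.
Qed.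

Lemma mincr2_mull m k l (A : fn 'M[R]_(m, k)) (B : fn 'M[R]_(k, l)) :
  mpolyb A -> mincr2 B -> mincr2 (fun x y => A x y *m B x y).
Proof.
move=> pA pB i j; under eq_fun do under eq_fun do rewrite mxE.
by apply: incr2_sum => a; exact: incr2Ml.
Qed.

Lemma mincr2_mulr m k l (A : fn 'M[R]_(m, k)) (B : fn 'M[R]_(k, l)) :
  mincr2 A -> mpolyb B -> mincr2 (fun x y => A x y *m B x y).
Proof.
move=> pA pB i j; under eq_fun do under eq_fun do rewrite mxE.
apply: incr2_sum => a; under eq_fun do under eq_fun do rewrite mulrC.
exact: incr2Ml.
Qed.

Lemma mincr11 m k l (A : fn 'M[R]_(m, k)) (B : fn 'M[R]_(k, l)) :
  mincr1 A -> mincr1 B -> mincr2 (fun x y => A x y *m B x y).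
Proof.
move=> pA pB i j; under eq_fun do under eq_fun do rewrite mxE.
by apply: incr2_sum => a; exact: incr11.
Qed.

Lemma mincr1D m k (A B : fn 'M[R]_(m, k)) : mincr1 A -> mincr1 B ->
  mincr1 (fun x y => A x y + B x y).
Proof.
move=> pA pB i j; under eq_fun do under eq_fun do rewrite mxE.
exact: incr1D.
Qed.

Lemma mincr1Z m k (a : R) (A : fn 'M[R]_(m, k)) : mincr1 A ->
  mincr1 (fun x y => a *: A x y).
Proof.
move=> pA i j; under eq_fun do under eq_fun do rewrite mxE.
by apply: incr1Ml => //; exact: polyb_cst.
Qed.

Lemma mincr1_tr m k (A : fn 'M[R]_(m, k)) : mincr1 A -> mincr1 (fun x y => (A x y)^T).
Proof. by move=> pA i j; under eq_fun do under eq_fun do rewrite mxE. Qed.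

Lemma mpolyb_tr m k (A : fn 'M[R]_(m, k)) : mpolyb A -> mpolyb (fun x y => (A x y)^T).
Proof. by move=> pA i j; under eq_fun do under eq_fun do rewrite mxE. Qed.

Lemma mpolyb_cst m k (A : 'M[R]_(m, k)) : mpolyb (fun _ _ => A).
Proof. by move=> i j; exact: polyb_cst. Qed.

Lemma incr2_tr m (A : fn 'M[R]_m) : mincr2 A -> incr2 (fun x y => \tr (A x y)).
Proof. by move=> pA; apply: incr2_sum => i. Qed.

End small_matrix.

(** * The trace of the resolvent as a function of the features *)

Section trace_resolvent.
Context (R : realType) (gamma : R) (g0 : 0 < gamma) (n T : nat) (T0 : (0 < T)%N).
Variables (Phi : 'M[R]_T) (i : 'I_n).
Hypothesis (Phis : Phi^T = Phi).
Local Notation I := ('I_n * 'I_T)%type.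

Definition arr_mx (x : 'I_n * 'I_T -> R) : 'M[R]_(n, T) := \matrix_(a, j) x (a, j).

Local Notation S x := (zrow i (arr_mx x)).
Local Notation Q x := (resolvent gamma (S x)).

Definition tr_res (x : 'I_n * 'I_T -> R) : R := T%:R^-1 * \tr (Phi *m Q x).

(** From [dQ = - T^-1 Q (dS^T S + S^T dS) Q]: the two terms have equal traces against the symmetric
    [Phi], whence the 2. Row [i] of the gradient is zero, as it is for [S x]. *)
Definition tr_res_grad (aj : 'I_n * 'I_T) (x : 'I_n * 'I_T -> R) : R :=
  - (2 * T%:R^-1 ^+ 2) * (S x *m (Q x *m Phi *m Q x)) aj.1 aj.2.

Let mS : forall (d : measure_display) (Om : measurableType d) (Z : I -> Om -> R),
  (forall j, measurable_fun setT (Z j)) -> mmx (fun om => S (Z^~ om)).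
Proof.
move=> d Om Z mZ a j; under eq_fun do rewrite !mxE.
by case: (a == i); [exact: measurable_cst|exact: mZ].
Qed.

Lemma mfunI_tr_res : mfunI tr_res.
Proof.
move=> d Om Z mZ; apply: measurable_funM => //.
apply: measurable_sum => j.
apply: mmx_mul; first exact: mmx_cst.
by apply: mmx_res => //; exact: mS.
Qed.

Lemma mfunI_tr_res_grad aj : mfunI (tr_res_grad aj).
Proof.
move=> d Om Z mZ; apply: measurable_funM => //.
have mQ : mmx (fun om => Q (Z^~ om)) by apply: mmx_res => //; exact: mS.
have mM : mmx (fun om => S (Z^~ om) *m (Q (Z^~ om) *m Phi *m Q (Z^~ om))).
  apply: mmx_mul; first exact: mS.
  by apply: mmx_mul => //; apply: mmx_mul => //; exact: mmx_cst.
exact: mM.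
Qed.

Let pS : mpolyb (fun x y : I -> R => S x).
Proof.
move=> a j; under eq_fun do under eq_fun do rewrite !mxE.
by case: (a == i); [exact: polyb_cst|exact: polyb_l].
Qed.

Let pS' : mpolyb (fun x y : I -> R => S y).
Proof.
move=> a j; under eq_fun do under eq_fun do rewrite !mxE.
by case: (a == i); [exact: polyb_cst|exact: polyb_r].
Qed.

Let pQ : mpolyb (fun x y : I -> R => Q x).
Proof.
move=> a j; apply: polyb_mono (polyb_cst _ gamma^-1) _ => x y.
by apply: le_trans (res_entry g0 _ _ _) (ler_norm _).
Qed.

Let pQ' : mpolyb (fun x y : I -> R => Q y).
Proof.
move=> a j; apply: polyb_mono (polyb_cst _ gamma^-1) _ => x y.
by apply: le_trans (res_entry g0 _ _ _) (ler_norm _).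
Qed.

Let oD : mincr1 (fun x y : I -> R => S y - S x).
Proof.
move=> a j; under eq_fun do under eq_fun do rewrite !mxE.
case: (a == i); last exact: incr1_coord.
by under eq_fun do under eq_fun do rewrite subrr; exact: incr1_0.
Qed.

Let gram_diff x y : (S y)^T *m S y - (S x)^T *m S x =
  ((S y - S x)^T *m S x + (S x)^T *m (S y - S x)) + (S y - S x)^T *m (S y - S x).
Proof.
set A := S y; set B := S x; rewrite !linearB/= !mulmxBl ?mulmxBr.
move: (A^T *m A) (A^T *m B) (B^T *m A) (B^T *m B) => a b c d.
by apply/matrixP => j k; rewrite !mxE; ring.
Qed.

Let oQ : mincr1 (fun x y : I -> R => Q y - Q x).
Proof.
have E x y : Q y - Q x = (- T%:R^-1) *: (Q y *m ((S y - S x)^T *m S y + (S x)^T *m (S y - S x)) *m Q x).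
  rewrite (res_diff g0) scaleNr; congr (- (_ *: (_ *m _ *m _))).
  set A := S y; set B := S x; rewrite !linearB/= !mulmxBl.
  by rewrite addrA subrK.
under [X in mincr1 X]eq_fun do under eq_fun do rewrite E.
apply: mincr1Z; apply: mincr1_mulr pQ; apply: mincr1_mull pQ' _.
apply: mincr1D; first by apply: mincr1_mulr => //; exact: mincr1_tr.
by apply: mincr1_mull => //; exact: mpolyb_tr.
Qed.

Lemma C11_tr_res : C11 tr_res tr_res_grad.
Proof.
split=> [aj|].
  apply: polybM; first exact: polyb_cst.
  exact: (mpolyb_mul pS (mpolyb_mul (mpolyb_mul pQ (mpolyb_cst _ Phi)) pQ) aj.1 aj.2).
(* What the resolvent identity leaves beyond the gradient: the linear part of the change of the Gram
   matrix with [Q y - Q x] in place of [Q x], and its quadratic part. *)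
pose rem (x y : I -> R) := - T%:R^-1 ^+ 2 *
  (\tr (Phi *m (Q y - Q x) *m ((S y - S x)^T *m S x + (S x)^T *m (S y - S x)) *m Q x) +
   \tr (Phi *m Q y *m ((S y - S x)^T *m (S y - S x)) *m Q x)).
have [V pV HV] : incr2 rem.
  apply: incr2Ml; first exact: polyb_cst.
  apply: incr2D; apply: incr2_tr; apply: mincr2_mulr pQ.
    apply: mincr11; first by apply: mincr1_mull => //; exact: mpolyb_cst.
    apply: mincr1D; first by apply: mincr1_mulr => //; exact: mincr1_tr.
    by apply: mincr1_mull => //; exact: mpolyb_tr.
  apply: mincr2_mull; first by apply: mpolyb_mul => //; exact: mpolyb_cst.
  by apply: mincr11 => //; exact: mincr1_tr.
exists V => // x y; apply: le_trans (HV x y); rewrite le_eqVlt; apply/orP; left.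
apply/eqP; congr `|_|.
have Qs := res_sym gamma (S x).
set D := S y - S x.
have G : \sum_aj tr_res_grad aj x * (y aj - x aj) =
    - (2 * T%:R^-1 ^+ 2) * \tr ((S x)^T *m D *m (Q x *m Phi *m Q x)).
  transitivity (- (2 * T%:R^-1 ^+ 2) *
      \tr ((S x *m (Q x *m Phi *m Q x))^T *m D)); last first.
    congr (_ * _); rewrite mxtrace_mulC !trmx_mul Qs Phis !mulmxA.
    by rewrite mxtrace_mulC !mulmxA mxtrace_mulC !mulmxA.
  set N := S x *m _.
  have -> : \tr (N^T *m D) = \sum_aj N aj.1 aj.2 * (y aj - x aj).
    rewrite /mxtrace; under eq_bigr do rewrite mxE.
    rewrite exchange_big pair_big/=; apply: eq_bigr => -[a j] _ /=.
    rewrite !mxE; case: eqP => [->|//]; rewrite big1 ?mul0r// => k _.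
    by rewrite !mxE eqxx mul0r.
  by rewrite mulr_sumr; apply: eq_bigr => aj _; rewrite -mulrA.
rewrite G /tr_res -mulrBr -linearB/= -mulmxBr.
have -> : \tr (Phi *m (Q y - Q x)) = - T%:R^-1 * (
    2 * \tr ((S x)^T *m D *m (Q x *m Phi *m Q x)) +
    \tr (Phi *m (Q y - Q x) *m (D^T *m S x + (S x)^T *m D) *m Q x) +
    \tr (Phi *m Q y *m (D^T *m D) *m Q x)).
  have -> : \tr (Phi *m (Q y - Q x)) =
      - T%:R^-1 * \tr (Phi *m (Q y *m ((S y)^T *m S y - (S x)^T *m S x) *m Q x)).
    rewrite [in LHS](res_diff g0) mulmxN -scalemxAr linearN/= linearZ/=.
    by rewrite mulNr.
  rewrite gram_diff; congr (_ * _).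
  have -> : Q y *m (D^T *m S x + (S x)^T *m D + D^T *m D) *m Q x =
     Q x *m (D^T *m S x + (S x)^T *m D) *m Q x +
     (Q y - Q x) *m (D^T *m S x + (S x)^T *m D) *m Q x +
     Q y *m (D^T *m D) *m Q x.
    set E1 := D^T *m S x + _; set E2 := D^T *m D.
    by rewrite mulmxDr mulmxDl !mulmxBl; congr (_ + _); rewrite addrC subrK.
  rewrite [Phi *m _]mulmxDr mxtraceD [Phi *m (_ + _)]mulmxDr mxtraceD.
  congr (_ + _ + _); try by rewrite !mulmxA.
  have -> : \tr (Phi *m (Q x *m (D^T *m S x + (S x)^T *m D) *m Q x)) =
     \tr (Phi *m Q x *m D^T *m S x *m Q x) + \tr (Phi *m Q x *m (S x)^T *m D *m Q x).
    by rewrite mulmxDr mulmxDl mulmxDr linearD/= !mulmxA.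
  have E1 : \tr (Phi *m Q x *m (S x)^T *m D *m Q x) =
      \tr ((S x)^T *m D *m (Q x *m Phi *m Q x)).
    rewrite (_ : _ *m Q x = (Phi *m Q x) *m ((S x)^T *m D *m Q x)); last by rewrite !mulmxA.
    by rewrite mxtrace_mulC !mulmxA.
  have E2 : \tr (Phi *m Q x *m D^T *m S x *m Q x) =
      \tr ((S x)^T *m D *m (Q x *m Phi *m Q x)).
    rewrite -mxtrace_tr !trmx_mul trmxK Qs Phis.
    by rewrite mxtrace_mulC !mulmxA.
  by rewrite E1 E2; ring.
by rewrite /rem; ring.
Qed.

Lemma lipP_tr_res_grad aj : lipP (tr_res_grad aj).
Proof.
apply: incr1_lipP.
pose W (x : I -> R) := S x *m (Q x *m Phi *m Q x).
have oW : mincr1 (fun x y => W y - W x).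
  have E x y : W y - W x = (S y - S x) *m (Q y *m Phi *m Q y) +
     S x *m ((Q y - Q x) *m Phi *m Q y + Q x *m Phi *m (Q y - Q x)).
    have -> : (Q y - Q x) *m Phi *m Q y + Q x *m Phi *m (Q y - Q x) =
        Q y *m Phi *m Q y - Q x *m Phi *m Q x.
      by rewrite !mulmxBl mulmxBr addrA subrK.
    by rewrite /W mulmxBl mulmxBr addrA subrK.
  under [X in mincr1 X]eq_fun do under eq_fun do rewrite E.
  apply: mincr1D.
    apply: mincr1_mulr => //; apply: mpolyb_mul => //; apply: mpolyb_mul => //.
    exact: mpolyb_cst.
  apply: mincr1_mull => //; apply: mincr1D.
    apply: mincr1_mulr => //; apply: mincr1_mulr => //; exact: mpolyb_cst.
  by apply: mincr1_mull => //; apply: mpolyb_mul => //; exact: mpolyb_cst.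
have := incr1Ml (polyb_cst _ (- (2 * T%:R^-1 ^+ 2))) (oW aj.1 aj.2).
move=> [V pV HV]; exists V => // x y; apply: le_trans (HV x y).
rewrite le_eqVlt; apply/orP; left; apply/eqP; congr (_ ^+ 2).
by rewrite /tr_res_grad -mulrBr; congr (_ * _); rewrite [RHS]mxE [X in _ = _ + X]mxE.
Qed.

(** Column by column, [|S Q v|^2 <= T v^T Q v] turns [T^-4] into [T^-3], leaving the squared
    Frobenius norm of [Phi]. As the latter is [O(T^2)], the bound is [O(1 / T)]. *)
Lemma tr_res_grad_norm x : \sum_aj tr_res_grad aj x ^+ 2 <=
  4 * T%:R^-1 ^+ 3 * gamma^-1 ^+ 3 * \sum_j dotv (col j Phi) (col j Phi).
Proof.
have T1 : 0 < T%:R :> R by rewrite ltr0n.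
have gi : 0 <= gamma^-1 by rewrite invr_ge0 ltW.
set W := Q x *m Phi *m Q x; set N := S x *m W.
have -> : \sum_aj tr_res_grad aj x ^+ 2 =
    4 * T%:R^-1 ^+ 4 * \sum_j dotv (S x *m col j W) (S x *m col j W).
  transitivity (4 * T%:R^-1 ^+ 4 * \sum_aj N aj.1 aj.2 ^+ 2).
    rewrite mulr_sumr; apply: eq_bigr => aj _.
    by rewrite /tr_res_grad -/W -/N exprMn; congr (_ * _); ring.
  congr (_ * _); under [RHS]eq_bigr do rewrite dotvv.
  rewrite exchange_big pair_big/=; apply: eq_bigr => -[a j] _ /=.
  by rewrite -col_mulmx [in RHS]mxE.
have colW j : col j W = Q x *m col j (Phi *m Q x) by rewrite /W -mulmxA col_mulmx.
apply: (@le_trans _ _ (4 * T%:R^-1 ^+ 4 * \sum_j (T%:R * (gamma^-1 * dotv (col j (Phi *m Q x)) (col j (Phi *m Q x)))))).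
  rewrite ler_wpM2l ?mulr_ge0 ?exprn_ge0 ?invr_ge0//; apply: ler_sum => j _.
  set w := col j (Phi *m Q x); rewrite colW -/w.
  apply: (@le_trans _ _ (T%:R * dotv w (Q x *m w))); last by rewrite ler_wpM2l// res_le.
  apply: le_trans (res_rows_le g0 (S x) w T0); rewrite dotvv.
  by apply: ler_sum => a _; rewrite dotv_srow.
(* The Frobenius norm is invariant under transposition, which exchanges [Phi *m Q x] and
   [Q x *m Phi]; the resolvent is then on the left and is bounded columnwise. *)
have -> : \sum_j T%:R * (gamma^-1 * dotv (col j (Phi *m Q x)) (col j (Phi *m Q x))) =
    T%:R * gamma^-1 * \sum_j dotv (Q x *m col j Phi) (Q x *m col j Phi).
  rewrite mulr_sumr; under eq_bigr do rewrite mulrA.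
  rewrite -!mulr_sumr; congr (_ * _).
  under eq_bigr do rewrite dotvv; rewrite exchange_big/=; apply: eq_bigr => k _.
  rewrite dotvv; apply: eq_bigr => j _; congr (_ ^+ 2).
  rewrite -col_mulmx !mxE; apply: eq_bigr => l _.
  have -> : Phi k l = Phi l k by rewrite -[in LHS]Phis mxE.
  have -> : Q x l j = Q x j l by rewrite -[in LHS](res_sym gamma (S x)) mxE.
  exact: mulrC.
apply: (@le_trans _ _ (4 * T%:R^-1 ^+ 4 * (T%:R * gamma^-1 *
   \sum_j (gamma^-1 ^+ 2 * dotv (col j Phi) (col j Phi))))).
  rewrite ler_wpM2l ?mulr_ge0 ?exprn_ge0 ?invr_ge0//.
  rewrite ler_wpM2l ?mulr_ge0//; apply: ler_sum => j _; exact: res_norm.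
rewrite -mulr_sumr le_eqVlt; apply/orP; left; apply/eqP.
by field; rewrite !gt_eqF.
Qed.

End trace_resolvent.

Lemma normal_var_ge0 (R : realType) : 0 <= normal_var R.
Proof. by apply: Ex_ge0 => x; exact: sqr_ge0. Qed.

(** * Concentration of quadratic forms *)

Section C11_products.
Context (R : realType) (I : finType).

Lemma lipP_mul (F F' : (I -> R) -> R) : lipP F -> lipP F' -> lipP (fun x => F x * F' x).
Proof.
move=> lF lF'.
have p1 := polyb_flip (lipP_polyb lF); have p2 := lipP_polyb lF'.
have [V pV HV] := incr1D (incr1Ml p1 lF') (incr1Ml p2 lF).
exists V => // x y; apply: le_trans (HV x y); rewrite le_eqVlt; apply/orP; left.
by apply/eqP; congr (_ ^+ 2); ring.
Qed.

Lemma lipP_add (F F' : (I -> R) -> R) : lipP F -> lipP F' -> lipP (fun x => F x + F' x).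
Proof.
move=> lF lF'; have [V pV HV] := incr1D lF lF'.
exists V => // x y; apply: le_trans (HV x y); rewrite le_eqVlt; apply/orP; left.
by apply/eqP; congr (_ ^+ 2); ring.
Qed.

Lemma lipP_cst (c : R) : lipP (fun _ : I -> R => c).
Proof.
by exists (fun _ _ => 0) => [|x y]; [exact: polyb_cst|rewrite subrr expr0n mul0r].
Qed.

Lemma C11_mul (F F' : (I -> R) -> R) G G' : C11 F G -> C11 F' G' ->
  C11 (fun x => F x * F' x) (fun i x => G i x * F' x + F x * G' i x).
Proof.
move=> CF CF'; have lF := C11_lipP CF; have lF' := C11_lipP CF'.
have pF := lipP_polyb lF; have pF' := lipP_polyb lF'.
have [pG oF] := CF; have [pG' oF'] := CF'.
split=> [i|].
  by apply: polybD; [exact: (polybM (pG i) pF')|exact: (polybM pF (pG' i))].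
have [V pV HV] := incr2D (incr2D (incr2Ml pF' oF) (incr2Ml pF oF')) (incr11 lF lF').
exists V => // x y; apply: le_trans (HV x y); rewrite le_eqVlt; apply/orP; left.
apply/eqP; congr `|_|.
have -> : \sum_i (G i x * F' x + F x * G' i x) * (y i - x i) =
   F' x * (\sum_i G i x * (y i - x i)) + F x * (\sum_i G' i x * (y i - x i)).
  by rewrite !mulr_sumr -big_split; apply: eq_bigr => i _ /=; ring.
by ring.
Qed.

Lemma C11_addc (F : (I -> R) -> R) G c : C11 F G -> C11 (fun x => F x - c) G.
Proof.
move=> [pG [V pV HV]]; split=> //; exists V => // x y.
by rewrite opprB addrA subrK; exact: HV.
Qed.

End C11_products.

(* A single row is indexed by ['I_1 * 'I_T] so that [poincare_features] applies. *)
Section quadratic_form.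
Context (R : realType) (T : nat) (A : 'M[R]_T) (u : 'cV[R]_T) (m : R).
Hypothesis As : A^T = A.
Local Notation I := ('I_1 * 'I_T)%type.

Definition arr_col (x : I -> R) : 'cV[R]_T := \col_j x (0, j).

Let q (x : I -> R) := dotv (arr_col x) (A *m arr_col x).
Let l (x : I -> R) := dotv (arr_col x) u.
Let Gq (aj : I) (x : I -> R) := 2 * (A *m arr_col x) aj.2 0.
Let Gl (aj : I) (x : I -> R) := u aj.2 0.

Lemma sum_arr (F : I -> R) : \sum_aj F aj = \sum_j F (0, j).
Proof.
transitivity (\sum_(a < 1) \sum_(j < T) F (a, j)); last by rewrite big_ord1.
by rewrite pair_big/=; apply: eq_bigr => -[a j].
Qed.

Lemma mfunI_mmx (F : 'cV[R]_T -> R) :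
  (forall (d : measure_display) (Om : measurableType d) (Y : Om -> 'cV[R]_T),
    mmx Y -> measurable_fun setT (fun om => F (Y om))) ->
  mfunI (fun x : I -> R => F (arr_col x)).
Proof.
move=> mF d Om Z mZ; apply: mF => i j.
by under eq_fun do rewrite mxE; exact: mZ.
Qed.

Lemma mmx_dotv (d : measure_display) (Om : measurableType d) (k : nat)
    (Y Y' : Om -> 'cV[R]_k) : mmx Y -> mmx Y' ->
  measurable_fun setT (fun om => dotv (Y om) (Y' om)).
Proof.
by move=> mY mY'; apply: (mmx_mul (mmx_tr mY) mY').
Qed.

Let mq : mfunI q.
Proof.
apply: (@mfunI_mmx (fun w => dotv w (A *m w))) => d Om Y mY.
by apply: mmx_dotv => //; apply: mmx_mul => //; exact: mmx_cst.
Qed.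

Let ml : mfunI l.
Proof.
apply: (@mfunI_mmx (fun w => dotv w u)) => d Om Y mY.
by apply: mmx_dotv => //; exact: mmx_cst.
Qed.

Let mGq aj : mfunI (Gq aj).
Proof.
apply: (@mfunI_mmx (fun w => 2 * (A *m w) aj.2 0)) => d Om Y mY.
apply: measurable_funM => //.
exact: (mmx_mul (mmx_cst A) mY aj.2 0).
Qed.

Lemma C11_quad : C11 q Gq.
Proof.
have px : mpolyb (fun x y : I -> R => arr_col x).
  by move=> i j; under eq_fun do under eq_fun do rewrite mxE; exact: polyb_l.
have oD : mincr1 (fun x y : I -> R => arr_col y - arr_col x).
  by move=> i j; under eq_fun do under eq_fun do rewrite !mxE; exact: incr1_coord.
split=> [aj|].
  apply: polybM; first exact: polyb_cst.
  exact: (mpolyb_mul (mpolyb_cst _ A) px aj.2 0).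
have [V pV HV] := mincr11 (mincr1_tr oD) (mincr1_mull (mpolyb_cst _ A) oD) 0 0.
exists V => // x y; apply: le_trans (HV x y); rewrite le_eqVlt; apply/orP; left.
apply/eqP; congr `|_|; rewrite -/(dotv _ _).
have -> : \sum_i Gq i x * (y i - x i) = 2 * dotv (arr_col y - arr_col x) (A *m arr_col x).
  rewrite sum_arr dotvE mulr_sumr; apply: eq_bigr => j _.
  by rewrite /Gq !mxE/= -mulrA; congr (_ * _); rewrite mulrC.
rewrite /q mulmxBr !dotvBr !dotvBl.
have -> : dotv (arr_col x) (A *m arr_col y) = dotv (arr_col y) (A *m arr_col x).
  by rewrite dotv_mulmx As dotvC.
ring.
Qed.

Lemma C11_linf : C11 l Gl.
Proof.
split=> [aj|]; first exact: polyb_cst.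
exists (fun _ _ => 0) => [|x y]; first exact: polyb_cst.
rewrite mul0r sum_arr /l !dotvE.
rewrite -!sumrB big1 ?normr0// => j _; rewrite !mxE /Gl/=; ring.
Qed.

Let lipGq aj : lipP (Gq aj).
Proof.
rewrite /Gq; apply: lipP_mul; first exact: lipP_cst.
have oD : mincr1 (fun x y : I -> R => arr_col y - arr_col x).
  by move=> i j; under eq_fun do under eq_fun do rewrite !mxE; exact: incr1_coord.
have [V pV HV] := mincr1_mull (mpolyb_cst _ A) oD aj.2 0.
exists V => // x y; apply: le_trans (HV x y); rewrite le_eqVlt; apply/orP; left.
by apply/eqP; congr (_ ^+ 2); rewrite mulmxBr [RHS]mxE [X in _ = _ + X]mxE.
Qed.

Variables (p : nat) (X : 'M[R]_(p, T)) (L : R) (phi sigma : R -> R) (lp ls : R).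
Hypotheses (L0 : 0 <= L) (XL : forall w : 'I_T -> R,
  \sum_k (\sum_j X k j * w j) ^+ 2 <= L * \sum_j w j ^+ 2).
Hypotheses (lphi : forall x y, `|phi x - phi y| <= lp * `|x - y|)
  (lsig : forall x y, `|sigma x - sigma y| <= ls * `|x - y|).
Context (d : measure_display) (Om : measurableType d) (P : probability Om R)
  (z : 'I_p -> Om -> R).
Hypothesis gz : gauss P z.

Definition row_vec (om : Om) : 'cV[R]_T :=
  \col_j sigma (\sum_k X k j * phi (z k om)).

Local Notation s := row_vec.
Local Notation C := (4 * normal_var R * (lp ^+ 2 * ls ^+ 2 * L)).

Let Z (ak : 'I_1 * 'I_p) := z ak.2.

Let gZ : gauss P Z.
Proof.
apply: (gauss_reindex (f := fun ak : 'I_1 * 'I_p => ak.2)) gz.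
by move=> [a k] [b k'] /= ->; rewrite (ord1 a) (ord1 b).
Qed.

Let sE om : arr_col (feat X phi sigma (Z^~ om)) = s om.
Proof. by apply/colP => j; rewrite !mxE. Qed.

Lemma tame_row j : tame P (fun om => s om j 0).
Proof.
have [H _] := poincare_features mq mGq C11_quad lipGq XL gZ L0 lphi lsig.
by move: (H (0, j)); congr tame; apply/funext => om; rewrite mxE.
Qed.

Lemma tame_dotv (k : nat) (Y Y' : Om -> 'cV[R]_k) : (forall j, tame P (fun om => Y om j 0)) ->
  (forall j, tame P (fun om => Y' om j 0)) -> tame P (fun om => dotv (Y om) (Y' om)).
Proof.
move=> tY tY'; under eq_fun do rewrite dotvE.
by apply: tame_sum => j; exact: tameM.
Qed.

Lemma tame_mulmx (k k' : nat) (B : 'M[R]_(k', k)) (Y : Om -> 'cV[R]_k) :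
  (forall j, tame P (fun om => Y om j 0)) -> forall j, tame P (fun om => (B *m Y om) j 0).
Proof.
move=> tY j; under eq_fun do rewrite mxE.
by apply: tame_sum => a; exact: tameZ.
Qed.

Lemma Var_quad : Var P (fun om => dotv (s om) (A *m s om)) <=
  C * (4 * Ex P (fun om => dotv (A *m s om) (A *m s om))).
Proof.
have [_ H] := poincare_features mq mGq C11_quad lipGq XL gZ L0 lphi lsig.
have E1 : (fun om => q (feat X phi sigma (Z^~ om))) = fun om => dotv (s om) (A *m s om).
  by apply/funext => om; rewrite /q sE.
rewrite E1 in H; apply: le_trans H _; rewrite le_eqVlt; apply/orP; left; apply/eqP.
congr (_ * _).
rewrite -ExZ; last by apply: tame_dotv; apply: tame_mulmx; exact: tame_row.
congr Ex; apply/funext => om; rewrite sum_arr dotvv mulr_sumr.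
by apply: eq_bigr => j _; rewrite /Gq sE exprMn/=; congr (_ * _); ring.
Qed.

(** The gradient of the product is [(q - m) u + 2 l A s], where [l] and [q] are the linear and
    quadratic forms; its square is split by [(a + b)^2 <= 2 a^2 + 2 b^2]. *)
Lemma Var_lin_quad : Var P (fun om => dotv (s om) u * (dotv (s om) (A *m s om) - m)) <=
  C * (2 * (dotv u u * Ex P (fun om => (dotv (s om) (A *m s om) - m) ^+ 2) +
    4 * Ex P (fun om => dotv (s om) u ^+ 2 * dotv (A *m s om) (A *m s om)))).
Proof.
pose f x := l x * (q x - m).
pose Gf aj x := Gl aj x * (q x - m) + l x * Gq aj x.
have Cf : C11 f Gf by apply: C11_mul; [exact: C11_linf|apply: C11_addc; exact: C11_quad].
have mf : mfunI f.
  move=> d1 Om1 Z1 mZ1; apply: measurable_funM; first exact: ml.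
  by apply: measurable_funB => //; exact: mq.
have mGf aj : mfunI (Gf aj).
  move=> d1 Om1 Z1 mZ1; apply: measurable_funD; apply: measurable_funM => //.
  - by apply: measurable_funB => //; exact: mq.
  - exact: ml.
  - exact: mGq.
have lGf aj : lipP (Gf aj).
  apply: lipP_add; apply: lipP_mul => //.
  - exact: lipP_cst.
  - by apply: C11_lipP (C11_addc _ C11_quad).
  - exact: C11_lipP C11_linf.
have [_ H] := poincare_features mf mGf Cf lGf XL gZ L0 lphi lsig.
have E1 : (fun om => f (feat X phi sigma (Z^~ om))) =
    fun om => dotv (s om) u * (dotv (s om) (A *m s om) - m).
  by apply/funext => om; rewrite /f /q /l sE.
rewrite E1 in H; apply: le_trans H _.
have ts := tame_row; have tAs := tame_mulmx A ts.
have tq : tame P (fun om => (dotv (s om) (A *m s om) - m) ^+ 2).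
  by apply: tame_sqr; apply: tameB; [exact: tame_dotv|exact: tame_cst].
have tl : tame P (fun om => dotv (s om) u ^+ 2 * dotv (A *m s om) (A *m s om)).
  apply: tameM; last exact: tame_dotv.
  by apply: tame_sqr; apply: tame_dotv => // j; exact: tame_cst.
apply: ler_wpM2l.
  apply: mulr_ge0; first by apply: mulr_ge0 => //; exact: normal_var_ge0.
  by apply: mulr_ge0 => //; apply: mulr_ge0; exact: sqr_ge0.
rewrite -(ExZ _ tq) -(ExZ _ tl) -(ExD (tameZ _ tq) (tameZ _ tl)) -ExZ; last first.
  by apply: tameD; exact: tameZ.
have E2 om : \sum_j Gf j (feat X phi sigma (Z^~ om)) ^+ 2 =
   \sum_j (u j 0 * (dotv (s om) (A *m s om) - m) + 2 * dotv (s om) u * (A *m s om) j 0) ^+ 2.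
  rewrite sum_arr; apply: eq_bigr => j _; congr (_ ^+ 2).
  by rewrite /Gf /Gl /Gq /q /l sE/=; ring.
under [X in Ex P X <= _]eq_fun do rewrite E2.
apply: Ex_le.
- apply: tame_sum => j; apply: tame_sqr; apply: tameD.
    apply: tameZ; apply: tameB; [exact: tame_dotv|exact: tame_cst].
  apply: tameM => //; apply: tameZ; apply: tame_dotv => // k; exact: tame_cst.
- by apply: tameZ; apply: tameD; exact: tameZ.
move=> om; rewrite !dotvv mulr_suml 2!mulr_sumr -big_split/= mulr_sumr.
apply: ler_sum => j _.
set a := u j 0; set b := _ - m; set c := dotv (s om) u; set e := (A *m s om) j 0.
have := sqr_ge0 (a * b - 2 * c * e); nra.
Qed.

End quadratic_form.

Section quadratic_concentration.
Context (R : realType) (T : nat) (A : 'M[R]_T) (u : 'cV[R]_T) (a : R).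
Hypotheses (As : A^T = A) (a0 : 0 <= a)
  (Ap : forall w : 'cV[R]_T, 0 <= dotv w (A *m w))
  (Aa : forall w : 'cV[R]_T, dotv (A *m w) (A *m w) <= a * dotv w (A *m w)).
Variables (p : nat) (X : 'M[R]_(p, T)) (L : R) (phi sigma : R -> R) (lp ls : R).
Hypotheses (L0 : 0 <= L) (XL : forall w : 'I_T -> R,
  \sum_k (\sum_j X k j * w j) ^+ 2 <= L * \sum_j w j ^+ 2).
Hypotheses (lphi : forall x y, `|phi x - phi y| <= lp * `|x - y|)
  (lsig : forall x y, `|sigma x - sigma y| <= ls * `|x - y|).
Context (d : measure_display) (Om : measurableType d) (P : probability Om R)
  (z : 'I_p -> Om -> R).
Hypothesis gz : gauss P z.

Local Notation s := (row_vec X phi sigma z).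
Local Notation C := (4 * normal_var R * (lp ^+ 2 * ls ^+ 2 * L)).
Local Notation q om := (dotv (s om) (A *m s om)).
Local Notation m := (Ex P (fun om => q om)).
Local Notation v := (Ex P (fun om => dotv (s om) u ^+ 2)).

Let C0 : 0 <= C.
Proof.
apply: mulr_ge0; first by apply: mulr_ge0 => //; exact: normal_var_ge0.
by apply: mulr_ge0 => //; apply: mulr_ge0; exact: sqr_ge0.
Qed.

Let ts j : tame P (fun om => s om j 0).
Proof. exact: (@tame_row R T A As p X L phi sigma lp ls L0 XL lphi lsig d Om P z gz). Qed.

Let tq : tame P (fun om => q om).
Proof. by apply: tame_dotv => //; exact: tame_mulmx. Qed.

Let tl : tame P (fun om => dotv (s om) u).
Proof. by apply: tame_dotv => // j; exact: tame_cst. Qed.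

(** The squared gradient [4 |A s|^2] is at most [4 a] times the form itself, so the variance is
    controlled by the mean of the form and no norm of [s] is involved. *)
Lemma quad_variance : Ex P (fun om => (q om - m) ^+ 2) <= 4 * C * a * m.
Proof.
apply: le_trans (Var_quad As L0 XL lphi lsig gz) _.
have tAA : tame P (fun om => dotv (A *m s om) (A *m s om)).
  by apply: tame_dotv; exact: tame_mulmx.
have : Ex P (fun om => dotv (A *m s om) (A *m s om)) <= a * m.
  by rewrite -ExZ//; apply: Ex_le => //; exact: tameZ.
move=> /(ler_wpM2l C0); set e := Ex _ _; lra.
Qed.

(* Self-bounding: the Poincare bound for the variance of [f = l * (q - m)]
   contains [E (l ^ 2 * q)], which is at most a multiple of [E (l ^ 2)] plus
   [E (f ^ 2) / 2], and the latter is absorbed in the left-hand side. *)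
Lemma lin_quad_moment : Ex P (fun om => (dotv (s om) u * (q om - m)) ^+ 2) <=
  2 * ((v + 2 * C * dotv u u) * (4 * C * a * m) + 8 * C * a * m * v +
       32 * C ^+ 2 * a ^+ 2 * v).
Proof.
pose f om := dotv (s om) u * (q om - m).
have tqm : tame P (fun om => q om - m) by apply: tameB => //; exact: tame_cst.
have tf : tame P f by exact: tameM.
have tf2 := tame_sqr tf; have tl2 := tame_sqr tl.
have V := quad_variance; have qv0 : 0 <= Ex P (fun om => (q om - m) ^+ 2).
  by apply: Ex_ge0 => om; exact: sqr_ge0.
have m0 : 0 <= m by apply: Ex_ge0.
have v0 : 0 <= v by apply: Ex_ge0 => om; exact: sqr_ge0.
have uu := dotv_ge0 u.
set y := Ex P _; have yE : y = Var P f + Ex P f ^+ 2.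
  by rewrite (VarE tf) subrK.
have Ef : Ex P f ^+ 2 <= v * (4 * C * a * m).
  by apply: le_trans (Ex_CS tl tqm) _; rewrite ler_wpM2l.
have tAA : tame P (fun om => dotv (s om) u ^+ 2 * dotv (A *m s om) (A *m s om)).
  by apply: tameM => //; apply: tame_dotv; exact: tame_mulmx.
have H1 : 8 * C * Ex P (fun om => dotv (s om) u ^+ 2 * dotv (A *m s om) (A *m s om)) <=
    8 * C * a * m * v + y / 2 + 32 * C ^+ 2 * a ^+ 2 * v.
  have -> : 8 * C * a * m * v + y / 2 + 32 * C ^+ 2 * a ^+ 2 * v =
      (8 * C * a * m + 32 * C ^+ 2 * a ^+ 2) * v + 2^-1 * y by ring.
  rewrite -(ExZ _ tAA) -(ExZ _ tl2) -(ExZ _ tf2).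
  rewrite -(ExD (tameZ _ tl2) (tameZ _ tf2)); apply: Ex_le.
  - exact: tameZ.
  - by apply: tameD; exact: tameZ.
  move=> om; rewrite /f; set l := dotv (s om) u.
  have l2 := sqr_ge0 l; have h := Aa (s om); have q0 := Ap (s om).
  apply: (@le_trans _ _ (8 * C * (l ^+ 2 * (a * q om)))).
    apply: ler_wpM2l; first by apply: mulr_ge0.
    by apply: ler_wpM2l.
  have := sqr_ge0 (l * (q om - m) - 8 * C * a * l); lra.
have H2 := Var_lin_quad u m As L0 XL lphi lsig gz.
rewrite -/f in H2.
have H3 : 2 * C * dotv u u * Ex P (fun om => (q om - m) ^+ 2) <=
    2 * C * dotv u u * (4 * C * a * m).
  apply: ler_wpM2l => //; apply: mulr_ge0 => //; exact: mulr_ge0.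
move: H1 H2 H3; set e1 := Ex P (fun om => dotv (s om) u ^+ 2 * _).
by move: yE Ef; lra.
Qed.

End quadratic_concentration.

(** * Expectations of random matrices and the second-moment matrix *)

Section tame_matrix.
Context (R : realType) (d : measure_display) (Om : measurableType d)
  (P : probability Om R).

Definition mtame (m k : nat) (M : Om -> 'M[R]_(m, k)) : Prop :=
  forall i j, tame P (fun om => M om i j).

Lemma mtame_mmx m k (A : Om -> 'M[R]_(m, k)) : mtame A -> mmx A.
Proof. by move=> tA i j; exact: tame_measurable. Qed.

Lemma mtame_mul m k l (A : Om -> 'M[R]_(m, k)) (B : Om -> 'M[R]_(k, l)) :
  mtame A -> mtame B -> mtame (fun om => A om *m B om).
Proof.
move=> tA tB i j; under eq_fun do rewrite mxE.
by apply: tame_sum => a; exact: tameM.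
Qed.

Lemma mtame_cst m k (A : 'M[R]_(m, k)) : mtame (fun _ => A).
Proof. by move=> i j; exact: tame_cst. Qed.

Lemma mtame_tr m k (A : Om -> 'M[R]_(m, k)) : mtame A -> mtame (fun om => (A om)^T).
Proof. by move=> tA i j; under eq_fun do rewrite mxE; exact: tA. Qed.

Lemma mtame_dotv k (A B : Om -> 'cV[R]_k) : mtame A -> mtame B ->
  tame P (fun om => dotv (A om) (B om)).
Proof. by move=> tA tB; exact: (mtame_mul (mtame_tr tA) tB 0 0). Qed.

Lemma tame_trace m (A : Om -> 'M[R]_m) : mtame A -> tame P (fun om => \tr (A om)).
Proof. by move=> tA; apply: tame_sum => i. Qed.

Definition Exm (m k : nat) (M : Om -> 'M[R]_(m, k)) : 'M[R]_(m, k) :=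
  \matrix_(i, j) Ex P (fun om => M om i j).

Lemma Exm_mull m k l (A : 'M[R]_(m, k)) (B : Om -> 'M[R]_(k, l)) :
  mtame B -> Exm (fun om => A *m B om) = A *m Exm B.
Proof.
move=> tB; apply/matrixP => i j; rewrite !mxE; under eq_fun do rewrite mxE.
rewrite Ex_sum; last by move=> a; exact: tameZ.
by apply: eq_bigr => a _; rewrite ExZ// mxE.
Qed.

Lemma Exm_mulr m k l (A : Om -> 'M[R]_(m, k)) (B : 'M[R]_(k, l)) :
  mtame A -> Exm (fun om => A om *m B) = Exm A *m B.
Proof.
move=> tA; apply/matrixP => i j; rewrite !mxE; under eq_fun do rewrite mxE.
rewrite Ex_sum; last by move=> a; apply: tameM => //; exact: tame_cst.
by apply: eq_bigr => a _; rewrite ExZr// mxE.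
Qed.

Lemma Ex_bilin m k (u : 'cV[R]_m) (A : Om -> 'M[R]_(m, k)) (v : 'cV[R]_k) :
  mtame A -> Ex P (fun om => dotv u (A om *m v)) = dotv u (Exm A *m v).
Proof.
move=> tA; rewrite /dotv -Exm_mulr// -Exm_mull ?mxE//.
by apply: mtame_mul => //; exact: mtame_cst.
Qed.

Lemma Ex_trace m (A : Om -> 'M[R]_m) (B : 'M[R]_m) : mtame A ->
  Ex P (fun om => \tr (B *m A om)) = \tr (B *m Exm A).
Proof.
move=> tA; rewrite -Exm_mull// /mxtrace Ex_sum.
  by apply: eq_bigr => i _; rewrite mxE.
by move=> i; exact: (mtame_mul (mtame_cst B) tA).
Qed.

Lemma Ex_sum_CS (I : finType) (f g : I -> Om -> R) :
  (forall i, tame P (f i)) -> (forall i, tame P (g i)) ->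
  (\sum_i Ex P (fun om => f i om * g i om)) ^+ 2 <=
  Ex P (fun om => \sum_i f i om ^+ 2) * \sum_i Ex P (fun om => g i om ^+ 2).
Proof.
move=> tf tg.
have tff i := tame_sqr (tf i); have tgg i := tame_sqr (tg i).
have tfg i := tameM (tf i) (tg i).
rewrite Ex_sum//; apply: quad_discr.
- by apply: sumr_ge0 => i _; apply: Ex_ge0 => om; exact: sqr_ge0.
- by apply: sumr_ge0 => i _; apply: Ex_ge0 => om; exact: sqr_ge0.
move=> t u; rewrite !mulr_sumr -sumrB -big_split/=; apply: sumr_ge0 => i _.
have -> : t ^+ 2 * Ex P (fun om => f i om ^+ 2) -
    2 * t * u * Ex P (fun om => f i om * g i om) +
    u ^+ 2 * Ex P (fun om => g i om ^+ 2) = Ex P (fun om => (t * f i om - u * g i om) ^+ 2).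
  rewrite -(ExZ _ (tff i)) -(ExZ _ (tfg i)) -(ExZ _ (tgg i)).
  rewrite -(ExB (tameZ _ (tff i)) (tameZ _ (tfg i))).
  rewrite -(ExD (tameB (tameZ _ (tff i)) (tameZ _ (tfg i))) (tameZ _ (tgg i))).
  by congr Ex; apply/funext => om; ring.
by apply: Ex_ge0 => om; exact: sqr_ge0.
Qed.

Section second_moment.
Context (T : nat) (s : Om -> 'cV[R]_T).
Hypothesis ts : mtame s.

Definition second_moment : 'M[R]_T := Exm (fun om => s om *m (s om)^T).

Local Notation Phi := second_moment.

Let tss : mtame (fun om => s om *m (s om)^T).
Proof. by apply: mtame_mul => //; exact: mtame_tr. Qed.

Lemma second_moment_sym : Phi^T = Phi.
Proof.
apply/matrixP => i j; rewrite !mxE; congr Ex; apply/funext => om.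
by rewrite !mxE !big_ord1 !mxE mulrC.
Qed.

Lemma second_moment_bilin (u v : 'cV[R]_T) :
  dotv u (Phi *m v) = Ex P (fun om => dotv u (s om) * dotv (s om) v).
Proof.
rewrite -Ex_bilin//; congr Ex; apply/funext => om.
by rewrite /dotv -mulmxA mulmxA mxE big_ord1.
Qed.

Lemma second_moment_quad (u : 'cV[R]_T) :
  dotv u (Phi *m u) = Ex P (fun om => dotv (s om) u ^+ 2).
Proof.
rewrite second_moment_bilin; congr Ex; apply/funext => om.
by rewrite [dotv u _]dotvC expr2.
Qed.

Lemma second_moment_ge0 (u : 'cV[R]_T) : 0 <= dotv u (Phi *m u).
Proof. by rewrite second_moment_quad; apply: Ex_ge0 => om; exact: sqr_ge0. Qed.

Lemma second_moment_trace (A : 'M[R]_T) :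
  \tr (Phi *m A) = Ex P (fun om => dotv (s om) (A *m s om)).
Proof.
rewrite mxtrace_mulC -Ex_trace//; congr Ex; apply/funext => om.
by rewrite mulmxA mxtrace_mulC /mxtrace big_ord1.
Qed.

Lemma second_moment_tr1 : \tr Phi = Ex P (fun om => dotv (s om) (s om)).
Proof. by rewrite -[Phi]mulmx1 second_moment_trace; under eq_fun do rewrite mul1mx. Qed.

Lemma second_moment_tr_ge0 : 0 <= \tr Phi.
Proof. by rewrite second_moment_tr1; apply: Ex_ge0 => om; exact: dotv_ge0. Qed.

Lemma second_moment_le (u : 'cV[R]_T) : dotv u (Phi *m u) <= \tr Phi * dotv u u.
Proof.
have td : tame P (fun om => dotv (s om) (s om)) by exact: mtame_dotv.
rewrite second_moment_quad second_moment_tr1 -ExZr//; apply: Ex_le.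
- by apply: tame_sqr; apply: mtame_dotv => //; exact: mtame_cst.
- by apply: tameM => //; exact: tame_cst.
by move=> om; exact: dotv_CS.
Qed.

(** By Cauchy-Schwarz [Phi_kj^2 <= Phi_kk Phi_jj], and these products sum to the squared trace. *)
Lemma second_moment_frob :
  \sum_j dotv (col j Phi) (col j Phi) <= \tr Phi ^+ 2.
Proof.
rewrite expr2 /mxtrace big_distrlr/= exchange_big/=; apply: ler_sum => j _.
rewrite dotvv; apply: ler_sum => k _; rewrite !mxE.
have e a b : (fun om => (s om *m (s om)^T) a b) = fun om => s om a 0 * s om b 0.
  by apply/funext => om; rewrite !mxE big_ord1 mxE.
rewrite !e; have := Ex_CS (ts k 0) (ts j 0).
by under [X in _ <= Ex P X * _]eq_fun do rewrite expr2;
   under [X in _ <= _ * Ex P X]eq_fun do rewrite expr2.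
Qed.

Lemma second_moment_trace_le (A : 'M[R]_T) (c : R) :
  (forall w : 'cV[R]_T, `|dotv w (A *m w)| <= c * dotv w w) ->
  `|\tr (Phi *m A)| <= c * \tr Phi.
Proof.
move=> H; have td : tame P (fun om => dotv (s om) (s om)) by exact: mtame_dotv.
have tA : tame P (fun om => dotv (s om) (A *m s om)).
  by apply: mtame_dotv => //; apply: mtame_mul => //; exact: mtame_cst.
rewrite second_moment_trace second_moment_tr1 -ExZ//.
apply: le_trans (Ex_abs tA) _; apply: Ex_le => //; first exact: tame_abs.
exact: tameZ.
Qed.

End second_moment.

End tame_matrix.

(** * The deterministic equivalent at the mean trace *)

Section decoupling.
Context (R : realType) (n p T : nat) (X : 'M[R]_(p, T)) (phi sigma : R -> R).
Hypotheses (mphi : measurable_fun setT phi) (msig : measurable_fun setT sigma).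
Context (d : measure_display) (Om : measurableType d) (P : probability Om R)
  (W : 'I_n * 'I_p -> Om -> R) (z : 'I_p -> Om -> R).
Hypotheses (gW : gauss P W) (gz : gauss P z).
Variables (i : 'I_n) (G : 'M[R]_(n, T) -> 'cV[R]_T -> R).
Hypothesis mG : forall (d : measure_display) (Om : measurableType d)
  (S : Om -> 'M[R]_(n, T)) (Y : Om -> 'cV[R]_T), mmx S -> mmx Y ->
  measurable_fun setT (fun om => G (S om) (Y om)).

Local Notation S om := (arr_mx (feat X phi sigma (W^~ om))).
Local Notation s := (row_vec X phi sigma z).

Hypothesis tG : tame P (fun om => G (zrow i (S om)) (srow (S om) i)).
Hypothesis tGs : forall x, tame P (fun y => G (zrow i (S x)) (s y)).

Let F (w : 'I_n * 'I_p -> R) :=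
  G (zrow i (arr_mx (feat X phi sigma w))) (srow (arr_mx (feat X phi sigma w)) i).

Let mF : mfunI F.
Proof.
move=> d' Om' Z mZ.
have mf aj : measurable_fun setT (fun om => feat X phi sigma (Z^~ om) aj).
  by apply: (mfunI_feat X aj mphi msig).
apply: mG => [a j|j k].
  under eq_fun do rewrite mxE; case: eqP => _; first exact: measurable_cst.
  by under eq_fun do rewrite mxE; exact: mf (a, j).
by under eq_fun do rewrite !mxE; exact: mf (i, j).
Qed.

(* The family on the product space takes row [i] from the independent copy. *)
Let f (ak : 'I_n * 'I_p) : 'I_n * 'I_p + 'I_p :=
  if ak.1 == i then inr ak.2 else inl ak.

Let f_inj : injective f.
Proof.
move=> [a k] [b l]; rewrite /f /=; case: eqP => [->|_]; case: eqP => [->|_] //.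
- by move=> [->].
- by move=> [-> ->].
Qed.

Let gY := gauss_reindex f_inj (gauss_sum gW gz).

Let FE (xy : Om * Om) : F (fun ak => match f ak with
    | inl i => W i xy.1 | inr j => z j xy.2 end) = G (zrow i (S xy.1)) (s xy.2).
Proof.
rewrite /F; congr (G _ _).
  apply/matrixP => a j; rewrite !mxE; case: eqP => //= /eqP/negbTE ai.
  by rewrite /feat; congr sigma; apply: eq_bigr => k _; rewrite /f/= ai.
apply/colP => j; rewrite !mxE /feat; congr sigma; apply: eq_bigr => k _.
by rewrite /f/= eqxx.
Qed.

Lemma decouple_tame : tame (P \x P)%E (fun xy => G (zrow i (S xy.1)) (s xy.2)).
Proof.
have := tame_law gW gY mF tG; congr tame; apply/funext => xy.
by rewrite -FE; congr F; apply/funext => ak; case: (f ak).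
Qed.

(** Independence of row [i] from the other rows, stated as an equality of laws, so that conditioning
    becomes Fubini. [W] and [z] share the space [P] and no joint law is prescribed for them; on the
    product space [z] is read in the second factor, which makes it independent of [W]. *)
Lemma decoupleE : Ex P (fun om => G (zrow i (S om)) (srow (S om) i)) =
  Ex (P \x P)%E (fun xy => G (zrow i (S xy.1)) (s xy.2)).
Proof.
apply: etrans (Ex_law gW gY mF tG) _; congr Ex; apply/funext => xy.
by rewrite -FE; congr F; apply/funext => ak; case: (f ak).
Qed.

Lemma decouple_le (g : Om -> R) : tame P g ->
  (forall x, Ex P (fun y => G (zrow i (S x)) (s y)) <= g x) ->
  Ex P (fun om => G (zrow i (S om)) (srow (S om) i)) <= Ex P g.
Proof.
move=> tg H; rewrite decoupleE; have tF := decouple_tame.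
have tg1 := tame_fst P tg.
have := @Ex_fubini_le _ _ _ _ _ _ _ _ 0 (tameB tF tg1).
rewrite (ExB tF tg1) (Ex_fst P tg) subr_le0; apply.
  by move=> x /=; apply: tameB => //; exact: tame_cst.
move=> x; have := ExB (tGs x) (tame_cst P (g x)); rewrite Ex_cst => e.
by apply: le_trans (_ : _ <= Ex P (fun y => G (zrow i (S x)) (s y)) - g x) _;
  [rewrite -e|rewrite subr_le0].
Qed.

Lemma decouple_eq (g : Om -> R) : tame P g ->
  (forall x, Ex P (fun y => G (zrow i (S x)) (s y)) = g x) ->
  Ex P (fun om => G (zrow i (S om)) (srow (S om) i)) = Ex P g.
Proof.
move=> tg H; rewrite decoupleE; apply: etrans (Ex_fubini decouple_tame tGs).2 _.
by congr Ex; apply/funext => x /=; exact: H.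
Qed.

End decoupling.

(** The squared bilinear form for unit vectors is at most this constant divided by [T]. Here [M]
    bounds [tr Phi / (gamma T)], [c1] bounds [n / T] and [c2] bounds [T / n]; [b] bounds the ratio
    of [Phi] to the matrix inside [Qt], [V] bounds [b'^T Phi b'], and [k3] bounds the sum of the
    biases. The three summands come from the fluctuation of [D_i] about its conditional mean, from
    that of the conditional mean about [alpha], and from the exchange of [Q_i] and [Q]. *)
Definition rate_const (R : realType) (gamma C M c1 c2 : R) : R :=
  let b := c2 * (1 + M) in
  let V := b * gamma^-1 in
  let k1 := 2 * gamma^-1 * ((V + 2 * C * gamma^-1 ^+ 2) * (4 * C * M) +
    8 * C * M * V + 32 * C ^+ 2 * gamma^-1 * V) in
  let k3 := (1 + M) * M + M ^+ 2 / 2 + 2 * C * gamma^-1 * M * c1 in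
  gamma^-1 * (4 * c1 * k1 +
    4 * V * (c1 * (4 * C * gamma^-1 * M ^+ 2) + M * k3) +
    2 * c1 * (M * gamma^-1 * b ^+ 2)).

(** * Fluctuations of the leave-one-out quantities and the bilinear bound *)

Section main_estimate.
Context (R : realType) (gamma : R) (n p T : nat) (X : 'M[R]_(p, T)) (L : R).
Context (phi sigma : R -> R) (lp ls : R).
Hypotheses (g0 : 0 < gamma) (T0 : (0 < T)%N) (L0 : 0 <= L)
  (XL : forall w : 'I_T -> R,
    \sum_k (\sum_j X k j * w j) ^+ 2 <= L * \sum_j w j ^+ 2)
  (lphi : forall x y, `|phi x - phi y| <= lp * `|x - y|)
  (lsig : forall x y, `|sigma x - sigma y| <= ls * `|x - y|).
Context (d : measure_display) (Om : measurableType d) (P : probability Om R)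
  (W : 'I_n * 'I_p -> Om -> R) (z : 'I_p -> Om -> R).
Hypotheses (gW : gauss P W) (gz : gauss P z).

Local Notation S om := (arr_mx (feat X phi sigma (W^~ om))).
Local Notation s := (row_vec X phi sigma z).
Local Notation Phi := (second_moment P s).
Local Notation C := (4 * normal_var R * (lp ^+ 2 * ls ^+ 2 * L)).
Local Notation t := (T%:R^-1 : R).
Local Notation gi := (gamma^-1).
Local Notation Q om := (resolvent gamma (S om)).
Local Notation Qi i om := (resolvent gamma (zrow i (S om))).
Local Notation si i om := (srow (S om) i).
Local Notation D i om := (loo_quad gamma (S om) i).
Local Notation dd i om := (t * \tr (Phi *m Qi i om)).

Let mphi : measurable_fun setT phi. Proof. exact: lipschitz_measurable lphi. Qed.
Let msig : measurable_fun setT sigma. Proof. exact: lipschitz_measurable lsig. Qed.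

Let C0 : 0 <= C.
Proof.
apply: mulr_ge0; first by apply: mulr_ge0 => //; exact: normal_var_ge0.
by apply: mulr_ge0 => //; apply: mulr_ge0; exact: sqr_ge0.
Qed.

Let t0 : 0 < t. Proof. by rewrite invr_gt0 ltr0n. Qed.
Let t1 : t <= 1. Proof. by rewrite invf_le1 ?ltr0n// ler1n. Qed.
Let gi0 : 0 < gi. Proof. by rewrite invr_gt0. Qed.

Let mts : mtame P s.
Proof.
move=> j k; rewrite (ord1 k).
exact: (@tame_row R T 1%:M (trmx1 _ _) p X L phi sigma lp ls L0 XL lphi lsig d Om P z gz).
Qed.

Lemma Phi_sym : Phi^T = Phi. Proof. exact: second_moment_sym. Qed.

Let feat_bound (i : 'I_n) := poincare_features
  (mfunI_tr_res g0 Phi i) (mfunI_tr_res_grad g0 Phi i) (C11_tr_res g0 i Phi_sym)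
  (lipP_tr_res_grad g0 Phi i) XL gW L0 lphi lsig.

Lemma mtame_feat : mtame P (fun om => S om).
Proof.
move=> a j; under eq_fun do rewrite mxE.
by have [] := feat_bound a.
Qed.

Lemma mtame_res (S' : Om -> 'M[R]_(n, T)) : mtame P S' ->
  mtame P (fun om => resolvent gamma (S' om)).
Proof.
move=> /mtame_mmx/(mmx_res g0) mS j k; apply: (@tame_bnd _ _ _ _ _ gi); first exact: mS.
by move=> om; exact: res_entry.
Qed.

Lemma mtame_zrow i : mtame P (fun om => zrow i (S om)).
Proof.
move=> a j; under eq_fun do rewrite mxE.
by case: eqP => _; [exact: tame_cst|exact: mtame_feat].
Qed.

Lemma mtame_srow i : mtame P (fun om => si i om).
Proof. by move=> j k; under eq_fun do rewrite !mxE; have := mtame_feat i j; under eq_fun do rewrite mxE. Qed.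

Let mtQ : mtame P (fun om => Q om). Proof. exact: mtame_res mtame_feat. Qed.
Let mtQi i : mtame P (fun om => Qi i om). Proof. exact: mtame_res (mtame_zrow i). Qed.
Let mtsi := mtame_srow.
Let mtcst := @mtame_cst R d Om P.

Let tD i : tame P (fun om => D i om).
Proof. apply: tameZ; exact: (mtame_dotv (mtsi i) (mtame_mul (mtQi i) (mtsi i))). Qed.
Let tdd i : tame P (fun om => dd i om).
Proof. apply: tameZ; exact: (tame_trace (mtame_mul (mtcst Phi) (mtQi i))). Qed.

Let meas_G (d' : measure_display) (Om' : measurableType d')
  (S' : Om' -> 'M[R]_(n, T)) (Y : Om' -> 'cV[R]_T) : mmx S' -> mmx Y ->
  measurable_fun setT (fun om => t * dotv (Y om) (resolvent gamma (S' om) *m Y om)).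
Proof.
move=> mS mY; apply: measurable_funM => //; apply: mmx_dotv => //.
by apply: mmx_mul => //; exact: mmx_res.
Qed.

Let meas_tr (d' : measure_display) (Om' : measurableType d')
  (S' : Om' -> 'M[R]_(n, T)) : mmx S' ->
  measurable_fun setT (fun om => t * \tr (Phi *m resolvent gamma (S' om))).
Proof.
move=> mS; apply: measurable_funM => //; apply: measurable_sum => i.
by apply: (mmx_mul (mmx_cst Phi) (mmx_res g0 mS) i i).
Qed.

Variable M : R.
Hypothesis tM : t * (gi * \tr Phi) <= M.

Section fixed_sample.
Variable S' : 'M[R]_(n, T).
Local Notation A := (resolvent gamma S').

Lemma tr_res_mean : t * \tr (Phi *m A) = Ex P (fun y => t * dotv (s y) (A *m s y)).
Proof.
rewrite (second_moment_trace mts) -ExZ//.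
exact: (mtame_dotv mts (mtame_mul (mtcst A) mts)).
Qed.

Lemma tr_res_ge0 : 0 <= t * \tr (Phi *m A).
Proof.
rewrite tr_res_mean; apply: Ex_ge0 => y; apply: mulr_ge0; first exact: ltW.
exact: res_ge0.
Qed.

Lemma tr_res_le : t * \tr (Phi *m A) <= t * (gi * \tr Phi).
Proof.
apply: ler_wpM2l; first exact: ltW.
apply: le_trans (second_moment_trace_le mts _); first exact: ler_norm.
by move=> w; rewrite ger0_norm ?res_ge0// res_le.
Qed.

Let tAs : (t *: A)^T = t *: A.
Proof. by rewrite linearZ/= res_sym. Qed.

Let tAE y w : dotv y (t *: A *m w) = t * dotv y (A *m w).
Proof. by rewrite -scalemxAl dotvZr. Qed.

Let tAp (w : 'cV[R]_T) : 0 <= dotv w (t *: A *m w).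
Proof. by rewrite tAE; apply: mulr_ge0; [exact: ltW|exact: res_ge0]. Qed.

Let tAa (w : 'cV[R]_T) :
  dotv (t *: A *m w) (t *: A *m w) <= t * gi * dotv w (t *: A *m w).
Proof.
rewrite tAE -!scalemxAl dotvZr dotvZl.
have := ler_wpM2l (mulr_ge0 (ltW t0) (ltW t0)) (res_norm_dot g0 S' w); lra.
Qed.

Let mean : Ex P (fun y => dotv (s y) (t *: A *m s y)) = t * \tr (Phi *m A).
Proof. by rewrite tr_res_mean; congr Ex; apply/funext => y; exact: tAE. Qed.

Let meanM : t * \tr (Phi *m A) <= M.
Proof. exact: le_trans tr_res_le tM. Qed.

(** The matrix of the quadratic form is the resolvent divided by [T], so the constant [a] of the
    concentration bound is [t / gamma]; the factor [1 / T] is gained here. *)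
Lemma res_quad_var : Ex P (fun y => (t * dotv (s y) (A *m s y) - t * \tr (Phi *m A)) ^+ 2)
  <= t * (4 * C * gi * M).
Proof.
have := quad_variance tAs tAa L0 XL lphi lsig gz; rewrite mean => H.
have E1 : (fun y => (t * dotv (s y) (A *m s y) - t * \tr (Phi *m A)) ^+ 2) =
   fun y => (dotv (s y) (t *: A *m s y) - t * \tr (Phi *m A)) ^+ 2.
  by apply/funext => y; rewrite tAE.
rewrite E1; apply: le_trans H _.
have tg : 0 <= C * (t * gi) by apply: mulr_ge0 => //; apply: mulr_ge0; exact: ltW.
have := ler_wpM2l tg meanM; lra.
Qed.

Lemma res_lin_quad (w : 'cV[R]_T) V U : dotv w (Phi *m w) <= V -> dotv w w <= U ->
  Ex P (fun y => (dotv (s y) w * (t * dotv (s y) (A *m s y) - t * \tr (Phi *m A))) ^+ 2)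
  <= t * (2 * gi * ((V + 2 * C * U) * (4 * C * M) + 8 * C * M * V +
          32 * C ^+ 2 * gi * V)).
Proof.
move=> HV HU.
have := lin_quad_moment w tAs tAp tAa L0 XL lphi lsig gz.
rewrite mean -(second_moment_quad mts) => H.
have E1 : (fun y => (dotv (s y) w * (t * dotv (s y) (A *m s y) - t * \tr (Phi *m A))) ^+ 2) =
   fun y => (dotv (s y) w * (dotv (s y) (t *: A *m s y) - t * \tr (Phi *m A))) ^+ 2.
  by apply/funext => y; rewrite tAE.
rewrite E1; apply: le_trans H _; rewrite -/C.
have v0 := second_moment_ge0 mts w; have w0 := dotv_ge0 w.
have m0 := tr_res_ge0; have mM := meanM.
move: v0 w0 m0 mM HV HU.
set v := dotv w (Phi *m w); set ww := dotv w w; set m := t * \tr _ => v0 w0 m0 mM HV HU.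
have tg : 0 <= t * gi by apply: mulr_ge0; exact: ltW.
have a1 : C * (t * gi) * (v * m) <= C * (t * gi) * (V * M).
  by apply: ler_wpM2l; [exact: mulr_ge0|exact: ler_pM].
have a2 : C * C * (t * gi) * (ww * m) <= C * C * (t * gi) * (U * M).
  apply: ler_wpM2l; last exact: ler_pM.
  by apply: mulr_ge0 => //; exact: mulr_ge0.
have a3 : C * C * (t * gi) * gi * (t * v) <= C * C * (t * gi) * gi * (1 * V).
  apply: ler_wpM2l; last by apply: ler_pM => //; exact: ltW.
  by apply: mulr_ge0; [apply: mulr_ge0 => //; exact: mulr_ge0|exact: ltW].
move: a1 a2 a3; set c := C; lra.
Qed.

End fixed_sample.

Let tq (S' : 'M[R]_(n, T)) : tame P (fun y => t * dotv (s y) (resolvent gamma S' *m s y)).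
Proof. apply: tameZ; exact: (mtame_dotv mts (mtame_mul (mtcst _) mts)). Qed.

Lemma loo_quad_dev i : Ex P (fun om => (D i om - dd i om) ^+ 2) <= t * (4 * C * gi * M).
Proof.
pose G (S' : 'M[R]_(n, T)) (Y : 'cV[R]_T) := (t * dotv Y (resolvent gamma S' *m Y)
  - t * \tr (Phi *m resolvent gamma S')) ^+ 2.
rewrite -[X in _ <= X](Ex_cst P).
apply: (decouple_le mphi msig gW gz (G := G) (i := i)).
- move=> d' Om' S' Y mS mY; apply: measurable_funX; apply: measurable_funB.
    exact: meas_G.
  exact: meas_tr.
- exact: tame_sqr (tameB (tD i) (tdd i)).
- move=> x; exact: tame_sqr (tameB (tq _) (tame_cst P _)).
- exact: tame_cst.
- move=> x; exact: res_quad_var.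
Qed.

Lemma loo_bilin_mean i (u w : 'cV[R]_T) :
  Ex P (fun om => dotv u (Qi i om *m si i om) * dotv (si i om) w) =
  Ex P (fun om => dotv u (Qi i om *m (Phi *m w))).
Proof.
pose G (S' : 'M[R]_(n, T)) (Y : 'cV[R]_T) := dotv u (resolvent gamma S' *m Y) * dotv Y w.
apply: (decouple_eq mphi msig gW gz (G := G) (i := i)).
- move=> d' Om' S' Y mS mY; apply: measurable_funM.
    by apply: mmx_dotv; [exact: mmx_cst|apply: mmx_mul => //; exact: mmx_res].
  by apply: mmx_dotv => //; exact: mmx_cst.
- apply: tameM; last exact: (mtame_dotv (mtsi i) (mtcst w)).
  exact: (mtame_dotv (mtcst u) (mtame_mul (mtQi i) (mtsi i))).
- move=> x; apply: tameM; last exact: (mtame_dotv mts (mtcst w)).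
  exact: (mtame_dotv (mtcst u) (mtame_mul (mtcst _) mts)).
- exact: (mtame_dotv (mtcst u) (mtame_mul (mtQi i) (mtcst _))).
- move=> x; rewrite [RHS]dotv_mulmx res_sym (second_moment_bilin mts).
  by congr Ex; apply/funext => y; rewrite /G dotv_mulmx res_sym.
Qed.

(** The norm of [Phi] is bounded by its trace, a loss of order [T]. It is affordable because this
    second moment is later multiplied by [t ^ 2]. *)
Lemma loo_sqr_mean i (w : 'cV[R]_T) :
  Ex P (fun om => dotv (si i om) (Qi i om *m w) ^+ 2) <= \tr Phi * (gi ^+ 2 * dotv w w).
Proof.
pose G (S' : 'M[R]_(n, T)) (Y : 'cV[R]_T) := dotv Y (resolvent gamma S' *m w) ^+ 2.
rewrite -[X in _ <= X](Ex_cst P).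
apply: (decouple_le mphi msig gW gz (G := G) (i := i)).
- move=> d' Om' S' Y mS mY; apply: measurable_funX; apply: mmx_dotv => //.
  by apply: mmx_mul; [exact: mmx_res|exact: mmx_cst].
- apply: tame_sqr; exact: (mtame_dotv (mtsi i) (mtame_mul (mtQi i) (mtcst _))).
- move=> x; apply: tame_sqr; exact: (mtame_dotv mts (mtcst _)).
- exact: tame_cst.
- move=> x; rewrite /G -(second_moment_quad mts).
  apply: le_trans (second_moment_le mts _) _; apply: ler_wpM2l.
    exact: second_moment_tr_ge0.
  exact: res_norm.
Qed.

(** With the other rows frozen, [D i - c] is the sum of a centred fluctuation and of the constant
    [dd i - c]. The fluctuation is correlated with the linear form and is handled by [res_lin_quad];
    the constant factors out and leaves the mean of the squared linear form, at most [V]. *)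
Lemma loo_lin_dev i (w : 'cV[R]_T) V U c : dotv w (Phi *m w) <= V -> dotv w w <= U ->
  Ex P (fun om => (dotv (si i om) w * (D i om - c)) ^+ 2) <=
  2 * (t * (2 * gi * ((V + 2 * C * U) * (4 * C * M) + 8 * C * M * V +
          32 * C ^+ 2 * gi * V))) + 2 * (V * Ex P (fun om => (dd i om - c) ^+ 2)).
Proof.
move=> HV HU; set K := t * _.
pose G (S' : 'M[R]_(n, T)) (Y : 'cV[R]_T) :=
  (dotv Y w * (t * dotv Y (resolvent gamma S' *m Y) - c)) ^+ 2.
have tdc : tame P (fun om => (dd i om - c) ^+ 2).
  exact: tame_sqr (tameB (tdd i) (tame_cst P c)).
have tVd := tameZ 2 (tameZ V tdc).
rewrite -(ExZ V tdc) -(ExZ 2 (tameZ V tdc)) -(Ex_cst P (2 * K)).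
rewrite -(ExD (tame_cst P (2 * K)) tVd).
have tsw : tame P (fun y => dotv (s y) w) by exact: (mtame_dotv mts (mtcst w)).
apply: (decouple_le mphi msig gW gz (G := G) (i := i)).
- move=> d' Om' S' Y mS mY; apply: measurable_funX; apply: measurable_funM.
    by apply: mmx_dotv => //; exact: mmx_cst.
  by apply: measurable_funB => //; exact: meas_G.
- apply: tame_sqr; apply: tameM; first exact: (mtame_dotv (mtsi i) (mtcst w)).
  exact: (tameB (tD i) (tame_cst P c)).
- move=> x; apply: tame_sqr; apply: (tameM tsw).
  exact: (tameB (tq _) (tame_cst P c)).
- exact: (tameD (tame_cst P _) tVd).
move=> x; rewrite /G; set m := dd i x.
have tf : tame P (fun y => (dotv (s y) w * (t * dotv (s y) (Qi i x *m s y) - m)) ^+ 2).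
  by apply: tame_sqr; apply: (tameM tsw); exact: (tameB (tq _) (tame_cst P m)).
have tg := tame_sqr tsw.
have H := res_lin_quad (zrow i (S x)) HV HU; rewrite -/K -/m in H.
apply: (@le_trans _ _ (2 * Ex P (fun y => (dotv (s y) w *
    (t * dotv (s y) (Qi i x *m s y) - m)) ^+ 2) +
   2 * (m - c) ^+ 2 * Ex P (fun y => dotv (s y) w ^+ 2))).
  rewrite -(ExZ _ tf) -(ExZ _ tg) -(ExD (tameZ _ tf) (tameZ _ tg)); apply: Ex_le.
  - apply: tame_sqr; apply: (tameM tsw); exact: (tameB (tq _) (tame_cst P c)).
  - exact: (tameD (tameZ _ tf) (tameZ _ tg)).
  move=> y; set a := dotv (s y) w; set q := t * dotv _ _.
  have := sqr_ge0 (a * (q - m) - a * (m - c)); lra.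
rewrite -(second_moment_quad mts).
have := ler_wpM2l (sqr_ge0 (m - c)) HV; lra.
Qed.

Local Notation EQ := (Exm P (fun om => Q om)).
Local Notation al := (t * \tr (Phi *m EQ)).

Let ttr (A : Om -> 'M[R]_T) : mtame P A -> tame P (fun om => t * \tr (Phi *m A om)).
Proof. move=> tA; apply: tameZ; exact: (tame_trace (mtame_mul (mtcst Phi) tA)). Qed.

Lemma mean_trE : al = Ex P (fun om => t * \tr (Phi *m Q om)).
Proof.
rewrite -(Ex_trace Phi mtQ) -ExZ//.
exact: (tame_trace (mtame_mul (mtcst Phi) mtQ)).
Qed.

Lemma mean_tr_ge0 : 0 <= al.
Proof. by rewrite mean_trE; apply: Ex_ge0 => om; exact: tr_res_ge0. Qed.

Lemma mean_tr_le : al <= M.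
Proof.
rewrite mean_trE -[X in _ <= X](Ex_cst P); apply: Ex_le.
- exact: ttr mtQ.
- exact: tame_cst.
- by move=> om; apply: le_trans tM; exact: tr_res_le.
Qed.

(* [v i * (1 + D i)] is the change of the trace when row [i] is removed. *)
Let v i om := t ^+ 2 * dotv (Q om *m si i om) (Phi *m (Q om *m si i om)).

Let v0 i om : 0 <= v i om.
Proof. by apply: mulr_ge0; [exact: sqr_ge0|exact: second_moment_ge0]. Qed.

Let tv i : tame P (v i).
Proof.
have tQs := mtame_mul mtQ (mtsi i).
apply: tameZ; exact: (mtame_dotv tQs (mtame_mul (mtcst Phi) tQs)).
Qed.

(** As quadratic forms, the sum of the [Q s_i s_i^T Q / T] is at most [Q]. The changes caused by the
    removal of each of the rows therefore add up to at most [t * \tr (Phi *m Q)], which is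
    bounded. *)
Let sum_v om : \sum_i v i om <= M.
Proof.
apply: le_trans tM; apply: le_trans (tr_res_le (S om)).
rewrite -mulr_sumr second_moment_trace//.
have ts2 i : tame P (fun y => dotv (s y) (Q om *m si i om) ^+ 2).
  apply: tame_sqr; exact: (mtame_dotv mts (mtcst _)).
have -> : \sum_i dotv (Q om *m si i om) (Phi *m (Q om *m si i om)) =
    Ex P (fun y => \sum_i dotv (s y) (Q om *m si i om) ^+ 2).
  rewrite Ex_sum//; apply: eq_bigr => i _.
  by rewrite (second_moment_quad mts).
have tQq : tame P (fun y => dotv (s y) (Q om *m s y)).
  exact: (mtame_dotv mts (mtame_mul (mtcst _) mts)).
apply: (@le_trans _ _ (t ^+ 2 * (T%:R * Ex P (fun y => dotv (s y) (Q om *m s y))))).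
  apply: ler_wpM2l; first exact: sqr_ge0.
  rewrite -(ExZ _ tQq); apply: Ex_le => [| |y].
  - exact: tame_sum.
  - exact: tameZ.
  apply: le_trans (res_rows_le g0 (S om) (s y) T0); rewrite le_eqVlt.
  apply/orP; left; apply/eqP; apply: eq_bigr => i _; congr (_ ^+ 2).
  by rewrite dotv_mulmx res_sym dotvC.
rewrite expr2 mulrA -(mulrA t) mulVf ?mulr1// pnatr_eq0; by case: T T0.
Qed.

Lemma loo_tr_diff i om : dd i om - t * \tr (Phi *m Q om) = v i om * (1 + D i om).
Proof.
rewrite -mulrBr -raddfB/= -mulmxBr (loo_diff2 g0) -scalemxAr mxtraceZ.
have -> : \tr (Phi *m (Q om *m si i om *m ((si i om)^T *m Q om))) =
    dotv (Q om *m si i om) (Phi *m (Q om *m si i om)).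
  rewrite mulmxA mxtrace_mulC /mxtrace big_ord1 /dotv trmx_mul res_sym.
  by rewrite !mulmxA.
by rewrite /v; ring.
Qed.

Let e i := Ex P (fun om => dd i om) - al.

Let tvD i : tame P (fun om => v i om * (1 + D i om)).
Proof. by apply: tameM => //; apply: tameD => //; exact: tame_cst. Qed.

Let eE i : e i = Ex P (fun om => v i om * (1 + D i om)).
Proof.
rewrite /e mean_trE -(ExB (tdd i) (ttr mtQ)); congr Ex; apply/funext => om.
exact: loo_tr_diff.
Qed.

Let e0 i : 0 <= e i.
Proof.
rewrite eE; apply: Ex_ge0 => om; apply: mulr_ge0 => //.
by apply: addr_ge0 => //; exact: loo_quad_ge0.
Qed.

Let eM i : e i <= M.
Proof.
rewrite /e lerBlDr -[X in X <= _]addr0; apply: lerD mean_tr_ge0.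
rewrite -[X in _ <= X](Ex_cst P); apply: Ex_le => [| |om].
- exact: tdd.
- exact: tame_cst.
- by apply: le_trans tM; exact: tr_res_le.
Qed.

Variable c1 : R.
Hypothesis nc1 : n%:R * t <= c1.

Let M0 : 0 <= M.
Proof. exact: le_trans mean_tr_ge0 mean_tr_le. Qed.

Let sum_cst (x : R) : \sum_(i < n) x = n%:R * x.
Proof. by rewrite sumr_const card_ord mulr_natl. Qed.

Let k3 := (1 + M) * M + M ^+ 2 / 2 + 2 * C * gi * M * c1.

Let sum_e : \sum_i e i <= k3.
Proof.
have tDd i : tame P (fun om => (D i om - dd i om) ^+ 2).
  exact: tame_sqr (tameB (tD i) (tdd i)).
under eq_bigr do rewrite eE.
rewrite -Ex_sum//.
apply: (@le_trans _ _ (Ex P (fun om => ((1 + M) * M + M ^+ 2 / 2) +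
   2^-1 * \sum_i (D i om - dd i om) ^+ 2))).
  apply: Ex_le => [| |om].
  - exact: tame_sum.
  - by apply: tameD; [exact: tame_cst|apply: tameZ; exact: tame_sum].
  (* [v (1 + D) = v (1 + dd) + v (D - dd)], with [dd <= M]; the last product is at most half the sum
     of the squares, and [v ^ 2 <= M v]. *)
  apply: (@le_trans _ _ (\sum_i ((1 + M + M / 2) * v i om +
      2^-1 * (D i om - dd i om) ^+ 2))).
    apply: ler_sum => i _.
    have h1 : dd i om <= M by apply: le_trans tM; exact: tr_res_le.
    have h2 : v i om <= M.
      apply: le_trans (sum_v om); rewrite (bigD1 i)//= lerDl.
      by apply: sumr_ge0 => j _.
    have h3 := ler_wpM2l (v0 i om) h1; have h4 := ler_wpM2l (v0 i om) h2.
    have := sqr_ge0 (v i om - (D i om - dd i om)); move: h3 h4.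
    set a := v i om; set x := D i om; set y := dd i om; lra.
  rewrite big_split/= -[X in X + _]mulr_sumr -[X in _ + X]mulr_sumr.
  have h : 0 <= 1 + M + M / 2 by have := M0; lra.
  have := ler_wpM2l h (sum_v om).
  set x := \sum_i v i om; set y := \sum_i (_ ^+ 2); lra.
have tS : tame P (fun om => \sum_i (D i om - dd i om) ^+ 2) by exact: tame_sum.
rewrite (ExD (tame_cst P _) (tameZ _ tS)) Ex_cst (ExZ _ tS) Ex_sum//.
rewrite /k3 lerD2l.
apply: (@le_trans _ _ (2^-1 * (n%:R * (t * (4 * C * gi * M))))).
  rewrite ler_wpM2l ?invr_ge0// -sum_cst; apply: ler_sum => i _.
  exact: loo_quad_dev.
have h : 0 <= C * (gi * M) by apply: mulr_ge0 => //; apply: mulr_ge0 => //; exact: ltW.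
have := ler_wpM2l h nc1; set c := C; lra.
Qed.

Let Ex_sqr_shift (f : Om -> R) c : tame P f ->
  Ex P (fun om => (f om - c) ^+ 2) = Var P f + (Ex P f - c) ^+ 2.
Proof.
move=> tf; have tf2 := tame_sqr tf.
have -> : (fun om => (f om - c) ^+ 2) = fun om => (f om ^+ 2 - (2 * c) * f om) + c ^+ 2.
  by apply/funext => om; ring.
rewrite (ExD (tameB tf2 (tameZ _ tf)) (tame_cst P _)) (ExB tf2 (tameZ _ tf)).
by rewrite (ExZ _ tf) Ex_cst (VarE tf); ring.
Qed.

(** The expected squared gradient is at most [4 t^3 gamma^-3 (tr Phi)^2], that is [4 t gamma^-1]
    times the square of a quantity bounded by [M]. *)
Lemma Var_tr_res i : Var P (fun om => dd i om) <= t * (4 * C * gi * M ^+ 2).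
Proof.
have [_ H] := feat_bound i; apply: le_trans H _.
apply: (@le_trans _ _ (C * (4 * t ^+ 3 * gi ^+ 3 * \tr Phi ^+ 2))).
  apply: ler_wpM2l => //; rewrite -[X in _ <= X](Ex_cst P).
  have tG : tame P (fun om => \sum_j tr_res_grad gamma Phi i j (feat X phi sigma (W^~ om)) ^+ 2).
    apply: (@tame_bnd _ _ _ _ _ (4 * t ^+ 3 * gi ^+ 3 *
        \sum_j dotv (col j Phi) (col j Phi))) => [|om].
      apply: measurable_sum => j; apply: measurable_funX.
      apply: mfunI_tr_res_grad => // aj; exact: tame_measurable (proj1 (feat_bound i) aj).
    rewrite ger0_norm; first exact: (tr_res_grad_norm g0 T0 i Phi_sym).
    by apply: sumr_ge0 => j _; exact: sqr_ge0.
  apply: Ex_le => // [|om]; first exact: tame_cst.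
  apply: le_trans (tr_res_grad_norm g0 T0 i Phi_sym _) _.
  apply: ler_wpM2l; last exact: second_moment_frob.
  by apply: mulr_ge0; [apply: mulr_ge0 => //|]; apply: exprn_ge0; exact: ltW.
have h : (t * (gi * \tr Phi)) ^+ 2 <= M ^+ 2.
  rewrite ler_sqr ?nnegrE//; apply: mulr_ge0; first exact: ltW.
  by apply: mulr_ge0; [exact: ltW|exact: second_moment_tr_ge0].
have h' : 0 <= C * (t * gi) by apply: mulr_ge0 => //; apply: mulr_ge0; exact: ltW.
have := ler_wpM2l h' h; set c := C; set x := T%:R^-1; set y := gi; set w := \tr _.
lra.
Qed.

Lemma sum_tr_res_dev :
  \sum_i Ex P (fun om => (dd i om - al) ^+ 2) <= c1 * (4 * C * gi * M ^+ 2) + M * k3.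
Proof.
apply: (@le_trans _ _ (\sum_(i < n) (t * (4 * C * gi * M ^+ 2) + M * e i))).
  apply: ler_sum => i _; rewrite (Ex_sqr_shift _ (tdd i)); apply: lerD.
    exact: Var_tr_res.
  (* The squared bias is bounded by [M * e i], since it is the sum of the [e i] that is under
     control. *)
  by rewrite expr2; apply: (ler_wpM2r (e0 i)); exact: eM.
rewrite big_split/= sum_cst -mulr_sumr; apply: lerD; last exact: ler_wpM2l.
rewrite mulrA; apply: ler_wpM2r => //.
by apply: mulr_ge0; [apply: mulr_ge0; [exact: mulr_ge0|exact: ltW]|exact: sqr_ge0].
Qed.

Section bilinear.
Variables (B : 'M[R]_T) (u b : 'cV[R]_T).
Hypothesis BE : B = (n%:R / T%:R) *: ((1 + al)^-1 *: Phi).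
Let Qt := invmx (B + gamma%:M).
Let w := Qt *m b.
Let f i om := dotv u (Q om *m si i om).
Let h i om := dotv (si i om) w * (D i om - al) - t * dotv (si i om) (Qi i om *m (Phi *m w)).

Let al1 : 0 < 1 + al.
Proof. by have := mean_tr_ge0; set x := al; lra. Qed.

Let Bs : B^T = B.
Proof. by rewrite BE scalerA linearZ/= Phi_sym. Qed.

Let Bp (x : 'cV[R]_T) : 0 <= dotv x (B *m x).
Proof.
rewrite BE -!scalemxAl !dotvZr; apply: mulr_ge0; first by apply: divr_ge0.
by apply: mulr_ge0; [rewrite invr_ge0 ltW|exact: second_moment_ge0].
Qed.

Let bE : b = B *m w + gamma *: w.
Proof. by rewrite -mul_scalar_mx -mulmxDl /w mulmxA ridge_invK// mul1mx. Qed.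

Let pointwise om : dotv u ((Q om - Qt) *m b) =
  n%:R * (t * (1 + al)^-1) * dotv u (Q om *m (Phi *m w)) -
  t * \sum_i f i om * dotv (si i om) w.
Proof.
have wE : w = Q om *m (t *: ((S om)^T *m S om) *m w + gamma *: w).
  rewrite -[gamma *: w]mul_scalar_mx -mulmxDl mulmxA /resolvent mulVmx ?mul1mx//.
  exact: res_unit.
have -> : (Q om - Qt) *m b = Q om *m (B *m w) - t *: (Q om *m ((S om)^T *m (S om *m w))).
  rewrite mulmxBl -/w {1}bE mulmxDr {3}wE mulmxDr.
  rewrite opprD addrACA subrr addr0 -!scalemxAl -scalemxAr.
  by rewrite !mulmxA.
rewrite dotvBr dotvZr BE -!scalemxAl -!scalemxAr !dotvZr; congr (_ - _ * _).
  by rewrite !mulrA.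
rewrite dotv_mulmx res_sym dotv_mulmx trmxK dotvE; apply: eq_bigr => i _.
by rewrite -!dotv_srow /f; congr (_ * _); rewrite dotvC dotv_mulmx res_sym.
Qed.

Let tf i : tame P (f i).
Proof. exact: (mtame_dotv (mtcst u) (mtame_mul mtQ (mtsi i))). Qed.

Let tsw i : tame P (fun om => dotv (si i om) w).
Proof. exact: (mtame_dotv (mtsi i) (mtcst w)). Qed.

Let tsq i : tame P (fun om => dotv (si i om) (Qi i om *m (Phi *m w))).
Proof. exact: (mtame_dotv (mtsi i) (mtame_mul (mtQi i) (mtcst _))). Qed.

Let th1 i : tame P (fun om => dotv (si i om) w * (D i om - al)).
Proof. exact: (tameM (tsw i) (tameB (tD i) (tame_cst P al))). Qed.

Let th i : tame P (h i).
Proof. exact: (tameB (th1 i) (tameZ t (tsq i))). Qed.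

Let tQw : tame P (fun om => dotv u (Q om *m (Phi *m w))).
Proof. exact: (mtame_dotv (mtcst u) (mtame_mul mtQ (mtcst _))). Qed.

Let tQiw i : tame P (fun om => dotv u (Qi i om *m (Phi *m w))).
Proof. exact: (mtame_dotv (mtcst u) (mtame_mul (mtQi i) (mtcst _))). Qed.

Let tfs i : tame P (fun om => f i om * dotv (si i om) w).
Proof. exact: (tameM (tf i) (tsw i)). Qed.

Let tfh i : tame P (fun om => f i om * h i om).
Proof. exact: (tameM (tf i) (th i)). Qed.

(** Sherman-Morrison gives [(1 + al) f = u^T Q_i s_i - (D - al) f]. Against [s_i^T w], the first
    term has mean [u^T E[Q_i] Phi w], and passing from [Q_i] to [Q] there produces the second part
    of [h]. *)
Let term i : Ex P (fun om => f i om * dotv (si i om) w) =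
  (1 + al)^-1 * (Ex P (fun om => dotv u (Q om *m (Phi *m w))) -
    Ex P (fun om => f i om * h i om)).
Proof.
have E1 om : f i om * dotv (si i om) w =
    (1 + al)^-1 * (dotv u (Qi i om *m si i om) * dotv (si i om) w -
       (dotv u (Qi i om *m (Phi *m w)) - dotv u (Q om *m (Phi *m w)) +
        f i om * h i om)).
  rewrite -dotvBr -mulmxBl (loo_diff g0) (loo_mul g0) dotvZr -scalemxAl dotvZr.
  have -> : Q om *m si i om *m ((si i om)^T *m Qi i om) *m (Phi *m w) =
     dotv (si i om) (Qi i om *m (Phi *m w)) *: (Q om *m si i om).
    rewrite -mulmxA -mul_mx_scalar; congr (_ *m _).
    by rewrite -mulmxA /dotv -mx11_scalar.
  rewrite dotvZr /h -/(f i om).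
  rewrite -[LHS](mulKf (lt0r_neq0 al1)); congr (_ * _); ring.
have /funext E2 := E1; rewrite E2.
have tA : tame P (fun om => dotv u (Qi i om *m si i om) * dotv (si i om) w).
  apply: tameM (tsw i); exact: (mtame_dotv (mtcst u) (mtame_mul (mtQi i) (mtsi i))).
rewrite (ExZ _ (tameB tA (tameD (tameB (tQiw i) tQw) (tfh i)))).
rewrite (ExB tA (tameD (tameB (tQiw i) tQw) (tfh i))).
rewrite (ExD (tameB (tQiw i) tQw) (tfh i)) (ExB (tQiw i) tQw) loo_bilin_mean.
have G (k x y a : R) : k * (y - (y - x + a)) = k * (x - a) by ring.
exact: G.
Qed.

Let identity : dotv u ((EQ - Qt) *m b) =
  t * (1 + al)^-1 * \sum_i Ex P (fun om => f i om * h i om).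
Proof.
rewrite mulmxBl dotvBr -(Ex_bilin _ _ mtQ).
rewrite -[X in _ - X](Ex_cst P) -ExB; last 2 first.
- exact: (mtame_dotv (mtcst u) (mtame_mul mtQ (mtcst _))).
- exact: tame_cst.
rewrite (_ : (fun om => _) = fun om =>
   n%:R * (t * (1 + al)^-1) * dotv u (Q om *m (Phi *m w)) -
   t * \sum_i f i om * dotv (si i om) w); last first.
  by apply/funext => om; rewrite -dotvBr -mulmxBl pointwise.
have tS : tame P (fun om => \sum_i f i om * dotv (si i om) w) by exact: tame_sum.
rewrite (ExB (tameZ _ tQw) (tameZ _ tS)) (ExZ _ tQw) (ExZ _ tS) Ex_sum//.
under eq_bigr do rewrite term.
by rewrite -mulr_sumr sumrB sum_cst; ring.
Qed.

Variable c2 : R.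
Hypothesis Tc2 : T%:R <= c2 * n%:R.

Let n0 : 0 < n%:R :> R.
Proof.
have Tr : 0 < T%:R :> R by rewrite ltr0n.
rewrite lt_def ler0n andbT; apply/eqP => n0.
by move: (lt_le_trans Tr Tc2); rewrite n0 mulr0 ltxx.
Qed.

Let c20 : 0 <= c2.
Proof. by rewrite -(pmulr_lge0 _ n0); apply: le_trans Tc2. Qed.

Let bb := c2 * (1 + M).

(** The scalar is [(T / n) (1 + al)]. It lets the bounds on [B *m w] stand in for a bound on the
    norm of [Phi]. *)
Let PhiwE : exists2 r : R, 0 <= r <= bb & Phi *m w = r *: (B *m w).
Proof.
have h1 := lt0r_neq0 n0; have h2 := lt0r_neq0 al1.
have h3 : T%:R != 0 :> R by rewrite pnatr_eq0 -lt0n.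
exists (T%:R / n%:R * (1 + al)); last first.
  rewrite BE -!scalemxAl !scalerA -[LHS]scale1r; congr (_ *: _).
  move: h1 h2 h3; set x := 1 + al; set y := n%:R; set k := T%:R => h1 h2 h3.
  by field; rewrite h1 h2 h3.
have r1 : T%:R / n%:R <= c2 by rewrite ler_pdivrMr.
have r0 : 0 <= T%:R / n%:R :> R by apply: divr_ge0.
apply/andP; split; first by apply: mulr_ge0 => //; exact: ltW.
by apply: ler_pM => //; [exact: ltW|rewrite lerD2l; exact: mean_tr_le].
Qed.

Let wBw : dotv w (B *m w) <= gi * dotv b b.
Proof. exact: le_trans (ridge_inv_B_le g0 Bs Bp b) (ridge_inv_le g0 Bs Bp b). Qed.

(** Since [B w = b - gamma w], expanding the square gives [|b|^2 - 2 gamma b^T w + gamma^2 |w|^2],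
    and [gamma |w|^2 <= b^T w]. *)
Let Bw_norm : dotv (B *m w) (B *m w) <= dotv b b.
Proof.
have -> : B *m w = b - gamma *: w by rewrite bE addrK.
have := ler_wpM2l (sqr_ge0 gamma) (ridge_inv_norm_dot g0 Bs Bp b); rewrite -/Qt -/w.
have -> : gamma ^+ 2 * (gi * dotv b w) = gamma * dotv b w.
  by rewrite expr2 mulrA -(mulrA gamma) mulfV ?lt0r_neq0// mulr1.
have h0 : 0 <= gamma * dotv b w.
  by apply: mulr_ge0; [exact: ltW|exact: ridge_inv_ge0].
rewrite dotvBr !dotvBl !dotvZl !dotvZr [dotv w b]dotvC.
move: h0; set x := dotv b w; set y := dotv w w; set zz := dotv b b; lra.
Qed.

Let wPw : dotv w (Phi *m w) <= bb * gi * dotv b b.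
Proof.
have [r /andP[r0 r1] ->] := PhiwE.
rewrite dotvZr -mulrA; apply: ler_pM => //; exact: Bp.
Qed.

Let Pw_norm : dotv (Phi *m w) (Phi *m w) <= bb ^+ 2 * dotv b b.
Proof.
have [r /andP[r0 r1] ->] := PhiwE.
rewrite dotvZr dotvZl mulrA -expr2; apply: ler_pM => //; first exact: sqr_ge0.
  exact: dotv_ge0.
by rewrite ler_sqr// nnegrE; exact: le_trans r1.
Qed.

Let V := bb * gi.
Let k1 := 2 * gi * ((V + 2 * C * gi ^+ 2) * (4 * C * M) + 8 * C * M * V +
  32 * C ^+ 2 * gi * V).

Let Eh i : Ex P (fun om => h i om ^+ 2) <=
  dotv b b * (4 * t * k1 + 4 * V * Ex P (fun om => (dd i om - al) ^+ 2) +
    2 * t * (M * gi * bb ^+ 2)).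
Proof.
have u1 := tame_sqr (th1 i); have u2 := tame_sqr (tsq i).
apply: (@le_trans _ _ (2 * Ex P (fun om => (dotv (si i om) w * (D i om - al)) ^+ 2) +
   2 * t ^+ 2 * Ex P (fun om => dotv (si i om) (Qi i om *m (Phi *m w)) ^+ 2))).
  rewrite -(ExZ _ u1) -(ExZ _ u2) -(ExD (tameZ _ u1) (tameZ _ u2)); apply: Ex_le => [| |om].
  - exact: tame_sqr.
  - by apply: tameD; exact: tameZ.
  rewrite /h; set x := dotv _ w * _; set y := dotv _ _.
  have := sqr_ge0 (x + t * y); lra.
have H1 := loo_lin_dev i al wPw (ridge_inv_norm g0 Bs Bp b).
have H2 := loo_sqr_mean i (Phi *m w).
have tr0 : 0 <= t * (gi * \tr Phi).
  by apply: mulr_ge0; [exact: ltW|apply: mulr_ge0; [exact: ltW|exact: second_moment_tr_ge0]].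
have H3 : t * gi * (t * (gi * \tr Phi) * dotv (Phi *m w) (Phi *m w)) <=
    t * gi * (M * (bb ^+ 2 * dotv b b)).
  apply: ler_wpM2l; first by apply: mulr_ge0; exact: ltW.
  by apply: ler_pM => //; exact: dotv_ge0.
have H4 := ler_wpM2l (sqr_ge0 t) H2.
move: H1 H3 H4.
set y1 := Ex P _; set y2 := Ex P _; set y3 := Ex P _; set c := C.
set x1 := dotv (Phi *m w) _; set x2 := dotv b b; set x3 := \tr _.
rewrite /k1 /V -/c; set q1 := T%:R^-1; set q2 := gi; lra.
Qed.

Let K2 := c1 * (4 * C * gi * M ^+ 2) + M * k3.

Lemma bilinear_bound : dotv u ((EQ - Qt) *m b) ^+ 2 <=
  t * rate_const gamma C M c1 c2 * (dotv u u * dotv b b).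
Proof.
pose K := 4 * c1 * k1 + 4 * V * K2 + 2 * c1 * (M * gi * bb ^+ 2).
rewrite -[rate_const _ _ _ _ _]/(gi * K) identity.
have CS := Ex_sum_CS tf th.
have c10 : 0 <= c1 by apply: le_trans nc1; apply: mulr_ge0 => //; exact: ltW.
have b0 := dotv_ge0 b; have u0 := dotv_ge0 u.
have V0 : 0 <= V.
  by apply: mulr_ge0; [apply: mulr_ge0 => //; exact: addr_ge0|exact: ltW].
have A1 : Ex P (fun om => \sum_i f i om ^+ 2) <= T%:R * (gi * dotv u u).
  rewrite -[X in _ <= X](Ex_cst P); apply: Ex_le => [| |om].
  - by apply: tame_sum => i; exact: tame_sqr.
  - exact: tame_cst.
  apply: (@le_trans _ _ (T%:R * dotv u (Q om *m u))); last first.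
    by apply: ler_wpM2l => //; exact: res_le.
  apply: le_trans (res_rows_le g0 (S om) u T0); rewrite le_eqVlt.
  apply/orP; left; apply/eqP; apply: eq_bigr => i _; congr (_ ^+ 2).
  by rewrite /f dotv_mulmx res_sym dotvC.
have A2 : \sum_i Ex P (fun om => h i om ^+ 2) <= dotv b b * K.
  apply: le_trans (ler_sum _ (fun i _ => Eh i)) _.
  rewrite -mulr_sumr; apply: ler_wpM2l => //.
  rewrite !big_split/= !sum_cst -mulr_sumr.
  have k10 : 0 <= k1.
    have g2 := sqr_ge0 gi; have cc := sqr_ge0 C; have gg := ltW gi0.
    have cV : 0 <= C * V by exact: mulr_ge0.
    rewrite /k1; apply: mulr_ge0; first exact: mulr_ge0.
    apply: addr_ge0; first apply: addr_ge0.
    - apply: mulr_ge0; last by apply: mulr_ge0 => //; exact: mulr_ge0.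
      by apply: addr_ge0 => //; apply: mulr_ge0 => //; exact: mulr_ge0.
    - by apply: mulr_ge0 => //; apply: mulr_ge0 => //; exact: mulr_ge0.
    - by apply: mulr_ge0 => //; apply: mulr_ge0 => //; exact: mulr_ge0.
  have m0 : 0 <= M * gi * bb ^+ 2.
    by apply: mulr_ge0; [apply: mulr_ge0 => //; exact: ltW|exact: sqr_ge0].
  have B1 := ler_wpM2l V0 sum_tr_res_dev.
  have B2 := ler_wpM2r k10 nc1; have B3 := ler_wpM2r m0 nc1.
  rewrite -/K2 in B1; rewrite /K; move: B1 B2 B3.
  set y1 := \sum_i _; set y2 := M * gi * _; set y3 := T%:R^-1; lra.
set sm := \sum_i _ in CS *.
have h0 : 0 <= Ex P (fun om => \sum_i f i om ^+ 2).
  by apply: Ex_ge0 => om; apply: sumr_ge0 => i _; exact: sqr_ge0.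
have h1 : 0 <= \sum_i Ex P (fun om => h i om ^+ 2).
  by apply: sumr_ge0 => i _; apply: Ex_ge0 => om; exact: sqr_ge0.
have A3 : sm ^+ 2 <= (T%:R * (gi * dotv u u)) * (dotv b b * K).
  by apply: le_trans CS _; exact: ler_pM.
have r1 : (1 + al)^-1 <= 1.
  by rewrite invf_le1// lerDl; exact: mean_tr_ge0.
have r0 : 0 <= (1 + al)^-1 by rewrite invr_ge0 ltW.
have r2 : (1 + al)^-1 ^+ 2 <= 1 by rewrite expr_le1.
rewrite !exprMn.
(* The prefactor contributes [t ^ 2] and the sum over the rows costs [T]; their product is the
   announced [t]. *)
apply: (@le_trans _ _ (t ^+ 2 * (1 * ((T%:R * (gi * dotv u u)) * (dotv b b * K))))).
  rewrite -mulrA; apply: ler_wpM2l; first exact: sqr_ge0.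
  by apply: ler_pM => //; exact: sqr_ge0.
have : t * T%:R = 1 by rewrite mulVf// pnatr_eq0 -lt0n.
set x := t => hx.
have -> : x ^+ 2 * (1 * (T%:R * (gi * dotv u u) * (dotv b b * K))) =
  x * T%:R * (x * (gi * K) * (dotv u u * dotv b b)) by ring.
by rewrite hx mul1r.
Qed.

End bilinear.

End main_estimate.

(** * The fixed-point equation *)

Section fixed_point.
Context (R : realType) (gamma : R) (n T : nat).
Hypotheses (g0 : 0 < gamma) (T0 : (0 < T)%N).
Context (d : measure_display) (Om : measurableType d) (P : probability Om R)
  (s : Om -> 'cV[R]_T).
Hypothesis mts : mtame P s.

Local Notation Phi := (second_moment P s).
Local Notation t := (T%:R^-1 : R).
Local Notation B := ((n%:R / T%:R) *: Phi).
Local Notation G y := (invmx (B + (gamma * y)%:M)).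
Local Notation g y := (t * \tr (Phi *m G y)).
Local Notation M := (t * (gamma^-1 * \tr Phi)).

Let t0 : 0 < t. Proof. by rewrite invr_gt0 ltr0n. Qed.

Let tr0 : 0 <= \tr Phi. Proof. exact: second_moment_tr_ge0. Qed.

Lemma trace_bound_ge0 : 0 <= M.
Proof. by apply: mulr_ge0; [exact: ltW|apply: mulr_ge0 => //; rewrite invr_ge0 ltW]. Qed.

Let Bs : B^T = B.
Proof. by rewrite linearZ/= second_moment_sym. Qed.

Let Bp (v : 'cV[R]_T) : 0 <= dotv v (B *m v).
Proof.
rewrite -scalemxAl dotvZr; apply: mulr_ge0; first exact: divr_ge0.
exact: second_moment_ge0.
Qed.

Let gy0 y : 1 <= y -> 0 < gamma * y.
Proof. by move=> y1; apply: mulr_gt0 => //; exact: lt_le_trans y1. Qed.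

(** After the rescaling, the parameter occurs in the scalar part only: [trace_map x / (1 + x)]
    becomes a trace against [G (1 + x)], which decreases in [x]. *)
Lemma Qbar_atE x : 0 <= x -> Qbar_at gamma n Phi x = (1 + x) *: G (1 + x).
Proof.
move=> x0; have x1 : 1 <= 1 + x by rewrite lerDl.
have xn : 1 + x != 0 by rewrite lt0r_neq0// (lt_le_trans _ x1).
rewrite -[X in X *: _]invrK -invmxZ; last first.
  by rewrite unitmxZ ?unitfE ?invr_eq0//; apply: ridge_unit => //; exact: gy0.
rewrite /Qbar_at; congr invmx.
rewrite scalerDr !scalerA scale_scalar_mx; congr (_ *: _ + _%:M).
  by rewrite mulrC.
by rewrite mulrCA mulVf// mulr1.
Qed.

Let GE y (v : 'cV[R]_T) : 1 <= y -> v = B *m (G y *m v) + (gamma * y) *: (G y *m v).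
Proof.
by move=> y1; rewrite -[X in _ = _ + X]mul_scalar_mx -mulmxDl mulmxA (ridge_invK (gy0 y1) Bs Bp) mul1mx.
Qed.

Let dotG y y' (u v : 'cV[R]_T) : 1 <= y -> 1 <= y' ->
  dotv u (G y *m v) - dotv u (G y' *m v) =
  gamma * (y' - y) * dotv (G y *m u) (G y' *m v).
Proof.
move=> y1 y'1; rewrite [dotv u (G y *m v)]dotv_mulmx (ridge_inv_sym _ Bs).
have ev := GE v y'1; have eu := GE u y1; move: ev eu.
set a := G y *m u; set r := G y' *m v => ev eu.
rewrite ev eu dotvDr dotvDl !dotvZl !dotvZr [dotv a (B *m r)]dotv_mulmx Bs; ring.
Qed.

Let G_norm y (u : 'cV[R]_T) : 1 <= y ->
  dotv (G y *m u) (G y *m u) <= (gamma * y)^-1 ^+ 2 * dotv u u.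
Proof. by move=> /gy0 yg; exact: (ridge_inv_norm yg Bs Bp). Qed.

Let G_dot y y' (u v : 'cV[R]_T) : 1 <= y -> 1 <= y' ->
  `|dotv (G y *m u) (G y' *m v)| <=
  (gamma * y)^-1 * (gamma * y')^-1 * Num.sqrt (dotv u u * dotv v v).
Proof.
move=> y1 y'1; have gy := gy0 y1; have gy' := gy0 y'1.
have p0 : 0 <= dotv u u * dotv v v by apply: mulr_ge0; exact: dotv_ge0.
have i0 : 0 <= (gamma * y)^-1 by rewrite invr_ge0 ltW.
have i0' : 0 <= (gamma * y')^-1 by rewrite invr_ge0 ltW.
rewrite -ler_sqr ?nnegrE//; last first.
  by apply: mulr_ge0; [exact: mulr_ge0|exact: sqrtr_ge0].
rewrite real_normK ?num_real// !exprMn sqr_sqrtr//.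
apply: le_trans (dotv_CS _ _) _.
have -> : (gamma * y)^-1 ^+ 2 * (gamma * y')^-1 ^+ 2 * (dotv u u * dotv v v) =
   ((gamma * y)^-1 ^+ 2 * dotv u u) * ((gamma * y')^-1 ^+ 2 * dotv v v) by ring.
by apply: ler_pM; [exact: dotv_ge0|exact: dotv_ge0|exact: G_norm|exact: G_norm].
Qed.

(** Formally, the derivative of [y G y] is [G y - gamma y (G y)^2], and for [1 <= y] both terms have
    norm at most [gamma^-1], whatever the size of [B]. *)
Let yG_dist y y' (u v : 'cV[R]_T) : 1 <= y -> 1 <= y' ->
  `|dotv u ((y *: G y - y' *: G y') *m v)| <=
  2 * gamma^-1 * `|y - y'| * Num.sqrt (dotv u u * dotv v v).
Proof.
move=> y1 y'1; have gy := gy0 y1.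
have yp : 0 < y by apply: lt_le_trans y1.
have yp' : 0 < y' by apply: lt_le_trans y'1.
set N := Num.sqrt _; have N0 : 0 <= N by exact: sqrtr_ge0.
have -> : dotv u ((y *: G y - y' *: G y') *m v) =
   (y - y') * dotv u (G y *m v) + y' * (gamma * (y' - y) * dotv (G y *m u) (G y' *m v)).
  by rewrite -dotG// mulmxBl -!scalemxAl dotvBr !dotvZr; ring.
apply: le_trans (ler_normD _ _) _; rewrite !normrM.
have h1 : `|dotv u (G y *m v)| <= gamma^-1 * N.
  rewrite -ler_sqr ?nnegrE//; last by apply: mulr_ge0 => //; rewrite invr_ge0 ltW.
  rewrite real_normK ?num_real// exprMn sqr_sqrtr; last first.
    by apply: mulr_ge0; exact: dotv_ge0.
  apply: le_trans (dotv_CS _ _) _; rewrite mulrCA; apply: ler_wpM2l.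
    exact: dotv_ge0.
  apply: le_trans (G_norm v y1) _; apply: ler_wpM2r; first exact: dotv_ge0.
  have q : (gamma * y)^-1 <= gamma^-1 by rewrite lef_pV2 ?posrE// ler_pMr.
  by apply: lerXn2r => //; rewrite nnegrE invr_ge0 ltW.
have h2 := G_dot u v y1 y'1; rewrite -/N in h2.
have h3 : (gamma * y)^-1 * (gamma * y')^-1 * N <= gamma^-1 * (gamma * y')^-1 * N.
  apply: ler_wpM2r => //; apply: ler_wpM2r; first by rewrite invr_ge0 ltW// gy0.
  by rewrite lef_pV2 ?posrE// ler_pMr.
rewrite (gtr0_norm yp') (gtr0_norm g0) [`|y' - y|]distrC.
have h4 := ler_wpM2l (normr_ge0 (y - y')) h1.
have h5 : y' * (gamma * `|y - y'| * `|dotv (G y *m u) (G y' *m v)|) <=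
   y' * (gamma * `|y - y'| * (gamma^-1 * (gamma * y')^-1 * N)).
  apply: ler_wpM2l; first exact: ltW.
  apply: ler_wpM2l; first by apply: mulr_ge0 => //; exact: ltW.
  exact: le_trans h3.
apply: le_trans (lerD h4 h5) _; rewrite le_eqVlt; apply/orP; left; apply/eqP.
move: (lt0r_neq0 yp') (lt0r_neq0 g0) => a1 a2.
by set x := `|_|; field; rewrite a1 a2.
Qed.

Lemma Qbar_at_dist x x' (u v : 'cV[R]_T) : 0 <= x -> 0 <= x' ->
  `|dotv u ((Qbar_at gamma n Phi x - Qbar_at gamma n Phi x') *m v)| <=
  2 * gamma^-1 * `|x - x'| * Num.sqrt (dotv u u * dotv v v).
Proof.
move=> x0 x'0; rewrite !Qbar_atE//.
have -> : x - x' = (1 + x) - (1 + x') by ring.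
by apply: yG_dist; rewrite lerDl.
Qed.

Definition trace_map x : R := t * \tr (Phi *m Qbar_at gamma n Phi x).

Lemma trace_map_lip x x' : 0 <= x -> 0 <= x' ->
  `|trace_map x - trace_map x'| <= 2 * M * `|x - x'|.
Proof.
move=> x0 x'0; rewrite /trace_map -mulrBr -raddfB/= -mulmxBr normrM (gtr0_norm t0).
have -> : 2 * M * `|x - x'| = t * ((2 * gamma^-1 * `|x - x'|) * \tr Phi) by ring.
apply: ler_wpM2l; first exact: ltW.
apply: second_moment_trace_le => // w; apply: le_trans (Qbar_at_dist w w x0 x'0) _.
by rewrite -expr2 sqrtr_sqr (ger0_norm (dotv_ge0 w)).
Qed.

Let traceE x : 0 <= x -> trace_map x =
  (1 + x) * (t * Ex P (fun om => dotv (s om) (G (1 + x) *m s om))).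
Proof.
move=> x0; rewrite /trace_map Qbar_atE// -scalemxAr mxtraceZ.
by rewrite (second_moment_trace mts) mulrCA.
Qed.

Lemma trace_map_ge0 x : 0 <= x -> 0 <= trace_map x.
Proof.
move=> x0; rewrite traceE//; apply: mulr_ge0; first exact: addr_ge0.
apply: mulr_ge0; first exact: ltW; apply: Ex_ge0 => om.
by apply: (ridge_inv_ge0 _ Bs Bp); apply: gy0; rewrite lerDl.
Qed.

Let tG y : tame P (fun om => dotv (s om) (G y *m s om)).
Proof. exact: (mtame_dotv mts (mtame_mul (mtame_cst P _) mts)). Qed.

Lemma trace_map_le x : 0 <= x -> trace_map x <= M.
Proof.
move=> x0; have x1 : 1 <= 1 + x by rewrite lerDl.
have tss : tame P (fun om => dotv (s om) (s om)) by exact: (mtame_dotv mts mts).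
rewrite traceE// mulrCA; apply: ler_wpM2l; first exact: ltW.
rewrite (second_moment_tr1 mts) -(ExZ _ (tG _)) -(ExZ _ tss); apply: Ex_le => [| |om].
- exact: tameZ.
- exact: tameZ.
have xp : 0 < 1 + x by apply: lt_le_trans x1.
have := ridge_inv_le (gy0 x1) Bs Bp (s om).
rewrite -(ler_pM2l xp); congr (_ <= _).
rewrite invfM; field; by rewrite (lt0r_neq0 g0) (lt0r_neq0 xp).
Qed.

Let slope x : 0 <= x -> trace_map x / (1 + x) =
  t * Ex P (fun om => dotv (s om) (G (1 + x) *m s om)).
Proof. by move=> x0; rewrite traceE// mulrC mulKf// lt0r_neq0// ltr_pwDl. Qed.

(** By the resolvent identity the difference of the two quadratic forms is a nonnegative multiple of
    the inner product of [a = G (1 + x) s] and [r = G (1 + x') s]. A second use of the identity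
    writes it as [|r|^2] plus a nonnegative multiple of [r^T G (1 + x) r]. *)
Lemma trace_map_slope x x' : 0 <= x -> x <= x' ->
  trace_map x' / (1 + x') <= trace_map x / (1 + x).
Proof.
move=> x0 xx'; have x'0 := le_trans x0 xx'.
have x1 : 1 <= 1 + x by rewrite lerDl.
have x'1 : 1 <= 1 + x' by rewrite lerDl.
rewrite !slope//; apply: ler_wpM2l; first exact: ltW.
apply: Ex_le => // om; rewrite -subr_ge0 dotG//.
set a := G (1 + x) *m s om; set r := G (1 + x') *m s om.
have dx : 0 <= 1 + x' - (1 + x) by rewrite subr_ge0 lerD2l.
apply: mulr_ge0; first by apply: mulr_ge0 => //; exact: ltW.
have : dotv r a - dotv r r = gamma * (1 + x' - (1 + x)) * dotv r (G (1 + x) *m r).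
  rewrite /a [dotv r (G _ *m s om)]dotv_mulmx (ridge_inv_sym _ Bs).
  have er := GE r x1; have es := GE (s om) x'1; rewrite -/r in es.
  rewrite es; move: er; set q := G (1 + x) *m r => er.
  rewrite [X in _ - dotv X _ = _]er dotvDr dotvDl !dotvZl !dotvZr [dotv q (B *m r)]dotv_mulmx Bs.
  rewrite [dotv r q]dotvC; ring.
rewrite [dotv r a]dotvC => /eqP; rewrite subr_eq => /eqP ->.
apply: addr_ge0; last exact: dotv_ge0.
apply: mulr_ge0; first by apply: mulr_ge0 => //; exact: ltW.
by apply: (ridge_inv_ge0 _ Bs Bp); exact: gy0.
Qed.

Lemma fixed_point_stability x x' : 0 <= x -> 0 <= x' -> x' = trace_map x' ->
  `|x - x'| <= (1 + M) * `|x - trace_map x|.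
Proof.
move=> x0 x'0 fx.
have xp : 0 < 1 + x by rewrite ltr_pwDl.
have xp' : 0 < 1 + x' by rewrite ltr_pwDl.
have h1 : `|x - x'| <= (1 + x') * `|x - trace_map x|.
  set m := trace_map x.
  have fx' : trace_map x' / (1 + x') = x' / (1 + x') by rewrite -fx.
  (* For [x <= x'], cross-multiplying the slope inequality gives [x' (1 + x) <= m (1 + x')], that is
     [x' - x <= (1 + x') (m - x)]; the other case is symmetric. *)
  have [xx|/ltW xx] := leP x x'.
    have := trace_map_slope x0 xx; rewrite fx' ler_pdivrMr// mulrAC ler_pdivlMr//.
    rewrite -/m => h.
    have k : 0 <= m - x by rewrite -(pmulr_rge0 _ xp'); lra.
    rewrite distrC ger0_norm ?subr_ge0// distrC ger0_norm//; lra.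
  have := trace_map_slope x'0 xx; rewrite fx' ler_pdivlMr// mulrAC ler_pdivrMr//.
  rewrite -/m => h.
  have k : 0 <= x - m by rewrite -(pmulr_rge0 _ xp'); lra.
  rewrite ger0_norm ?subr_ge0// ger0_norm//; lra.
apply: le_trans h1 _; apply: ler_wpM2r => //; rewrite lerD2l fx.
exact: trace_map_le.
Qed.

Lemma fixed_point_unique x x' : 0 <= x -> 0 <= x' ->
  x = trace_map x -> x' = trace_map x' -> x = x'.
Proof.
move=> x0 x'0 fx /(fixed_point_stability x0 x'0); rewrite -fx subrr normr0 mulr0.
by rewrite normr_le0 subr_eq0 => /eqP.
Qed.

Lemma fixed_point_exists : exists2 x, 0 <= x & x = trace_map x.
Proof.
(* The absolute value extends the map to the whole line, where it stays Lipschitz; the values at 0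
   and at the a priori bound have opposite signs. *)
pose f x := x - trace_map `|x|.
have cf : continuous f.
  apply: (@lipschitz_continuous R (1 + 2 * M)) => x y.
  have -> : f x - f y =
     (x - y) + (trace_map `|y| - trace_map `|x|) by rewrite /f; ring.
  apply: le_trans (ler_normD _ _) _; rewrite mulrDl mul1r lerD2l.
  apply: le_trans (trace_map_lip (normr_ge0 _) (normr_ge0 _)) _.
  apply: ler_wpM2l; first by apply: mulr_ge0 => //; exact: trace_bound_ge0.
  by rewrite distrC; exact: ler_dist_dist.
have M0 := trace_bound_ge0.
have f0 : f 0 <= 0 by rewrite /f normr0 sub0r oppr_le0; exact: trace_map_ge0.
have fM : 0 <= f M by rewrite /f ger0_norm// subr_ge0; exact: trace_map_le.
have [x] : exists2 x, x \in `[0, M] & f x = 0.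
  apply: IVT => //; first exact: continuous_subspaceT.
  by rewrite ge_min f0 le_max fM orbT.
rewrite in_itv/= => /andP[x0 _] fx; exists x => //.
by apply/eqP; rewrite -subr_eq0 -fx /f ger0_norm.
Qed.

End fixed_point.

(** * The solution of the fixed-point equation and the passage to [Qbar] *)

Section delta.
Context (R : realType) (gamma : R) (n T : nat).
Hypotheses (g0 : 0 < gamma) (T0 : (0 < T)%N).
Context (d : measure_display) (Om : measurableType d) (P : probability Om R)
  (s : Om -> 'cV[R]_T).
Hypothesis mts : mtame P s.

Local Notation Phi := (second_moment P s).
Local Notation f := (trace_map gamma n P s).

(** A nonnegative fixed point always exists. When no positive one does, it must be 0, which is the
    default value, so the equation holds in both cases. *)
Lemma delta_of_fixed : 0 <= delta_of gamma n Phi /\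
  delta_of gamma n Phi = f (delta_of gamma n Phi).
Proof.
have [x x0 fx] := fixed_point_exists n g0 T0 mts.
have [|nx] := boolp.pselect (exists y, is_delta gamma n Phi y).
  by move=> /(xgetPex 0) [] /ltW.
rewrite /delta_of xgetPN; last by move=> y yd; apply: nx; exists y.
split=> //; move: x0; rewrite le_eqVlt => /predU1P[->//|x0].
by exfalso; apply: nx; exists x.
Qed.

(** If the trace of [Phi *m invmx A] vanished, the lower bound [c^-1] on [invmx A] would make
    [tr Phi] vanish, and then [Phi] itself by the Frobenius bound. *)
Lemma trace_map0_gt0 : Phi <> 0 -> 0 < f 0.
Proof.
move=> Phi0; rewrite lt_def (trace_map_ge0 n g0 T0 mts)// andbT; apply/eqP => f0.
have t0 : 0 < T%:R^-1 :> R by rewrite invr_gt0 ltr0n.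
pose B := (n%:R / T%:R) *: ((1 + 0)^-1 *: Phi).
have k0 : 0 <= n%:R / T%:R :> R by exact: divr_ge0.
have BE : B = (n%:R / T%:R) *: Phi by rewrite /B addr0 invr1 scale1r.
have Bs : B^T = B by rewrite BE linearZ/= second_moment_sym.
have Bp (v : 'cV[R]_T) : 0 <= dotv v (B *m v).
  by rewrite BE -scalemxAl dotvZr; apply: mulr_ge0 => //; exact: second_moment_ge0.
pose A := B + gamma%:M; pose c := n%:R / T%:R * \tr Phi + gamma.
have As : A^T = A by rewrite /A linearD/= Bs tr_scalar_mx.
have AE v : A *m v = B *m v + gamma *: v by rewrite mulmxDl mul_scalar_mx.
have Ap (v : 'cV[R]_T) : 0 <= dotv v (A *m v).
  rewrite AE dotvDr dotvZr; apply: addr_ge0 => //; apply: mulr_ge0; first exact: ltW.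
  exact: dotv_ge0.
have Ac (v : 'cV[R]_T) : dotv v (A *m v) <= c * dotv v v.
  rewrite AE dotvDr dotvZr /c mulrDl lerD2r BE -scalemxAl dotvZr -mulrA.
  by apply: ler_wpM2l => //; exact: second_moment_le.
(* The bound [A <= c] is inverted by Cauchy-Schwarz for the form of [A], applied to [v] and
   [invmx A *m v]. *)
have Gc (v : 'cV[R]_T) : dotv v v <= c * dotv v (invmx A *m v).
  have := psd_CS v (invmx A *m v) As Ap.
  rewrite mulmxA (ridge_invK g0 Bs Bp) mul1mx [dotv (invmx A *m v) v]dotvC => h.
  have g1 : 0 <= dotv v (invmx A *m v) by exact: ridge_inv_ge0 g0 Bs Bp v.
  have h2 : dotv v v ^+ 2 <= dotv v v * (c * dotv v (invmx A *m v)).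
    by apply: le_trans h _; rewrite mulrCA mulrA; apply: ler_wpM2r => //; exact: Ac.
  have := dotv_ge0 v; rewrite le_eqVlt => /predU1P[v0|v0].
    rewrite -v0; apply: mulr_ge0 => //; rewrite /c; apply: addr_ge0; last exact: ltW.
    by apply: mulr_ge0 => //; exact: second_moment_tr_ge0.
  by move: h2; rewrite expr2 ler_pM2l.
have tss : tame P (fun om => dotv (s om) (s om)) by exact: (mtame_dotv mts mts).
have tG : tame P (fun om => dotv (s om) (invmx A *m s om)).
  exact: (mtame_dotv mts (mtame_mul (mtame_cst P _) mts)).
have tr0 : \tr Phi <= 0.
  rewrite (second_moment_tr1 mts).
  apply: (@le_trans _ _ (c * Ex P (fun om => dotv (s om) (invmx A *m s om)))).
    by rewrite -(ExZ _ tG); apply: Ex_le => //; exact: tameZ.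
  have : \tr (Phi *m invmx A) = 0.
    have := f0; rewrite /trace_map => /eqP; rewrite mulf_eq0 (gt_eqF t0)/= => /eqP h.
    exact: h.
  by rewrite (second_moment_trace mts) => ->; rewrite mulr0.
have F := second_moment_frob mts.
have {}tr0 : \tr Phi = 0 by apply/eqP; rewrite eq_le tr0 second_moment_tr_ge0.
rewrite tr0 expr0n/= in F; apply: Phi0; apply/matrixP => i j; rewrite mxE.
have : \sum_j dotv (col j Phi) (col j Phi) == 0.
  by rewrite eq_le F sumr_ge0// => k _; exact: dotv_ge0.
rewrite psumr_eq0 => [/allP/(_ j)|k _]; last exact: dotv_ge0.
rewrite mem_index_enum => /(_ isT)/eqP/dotvv_eq0/colP/(_ i).
by rewrite !mxE.
Qed.

Lemma delta_exists_unique : Phi <> 0 -> exists! delta, is_delta gamma n Phi delta.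
Proof.
move=> Phi0; have [x x0 fx] := fixed_point_exists n g0 T0 mts.
exists x; split.
  split=> //; rewrite lt_def x0 andbT; apply/eqP => xe.
  by move: fx (trace_map0_gt0 Phi0); rewrite xe => <-; rewrite ltxx.
by move=> y [/ltW y0 fy]; exact: (fixed_point_unique g0 T0 mts x0 y0 fx fy).
Qed.

(** The hypothesis compares [A] with the ridge inverse at its own trace [al]. It gives
    [|al - f al| <= gamma M c], then [|al - delta| <= (1 + M) gamma M c] by stability; the Lipschitz
    constant [2 gamma^-1] of [Qbar_at] cancels [gamma] and yields [2 M (1 + M) c]. *)
Lemma Qbar_dist (A : 'M[R]_T) (M c : R) :
  T%:R^-1 * (gamma^-1 * \tr Phi) <= M -> 0 <= c ->
  0 <= T%:R^-1 * \tr (Phi *m A) ->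
  (forall u v : 'cV[R]_T,
    dotv u ((A - Qbar_at gamma n Phi (T%:R^-1 * \tr (Phi *m A))) *m v) ^+ 2 <=
    c ^+ 2 * (dotv u u * dotv v v)) ->
  opnorm (A - Qbar gamma n Phi) <= (1 + 2 * M * (1 + M)) * c.
Proof.
set al := T%:R^-1 * \tr (Phi *m A); set Qt := Qbar_at _ _ _ al => tM c0 al0 H.
have t0 : 0 < T%:R^-1 :> R by rewrite invr_gt0 ltr0n.
have gi0 : 0 < gamma^-1 by rewrite invr_gt0.
have M'0 := trace_bound_ge0 g0 T0 mts.
have M0 : 0 <= M by exact: le_trans tM.
have Hab (u v : 'cV[R]_T) :
    `|dotv u ((A - Qt) *m v)| <= c * Num.sqrt (dotv u u * dotv v v).
  rewrite -ler_sqr ?nnegrE//; last by apply: mulr_ge0 => //; exact: sqrtr_ge0.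
  rewrite real_normK ?num_real// exprMn sqr_sqrtr//.
  by apply: mulr_ge0; exact: dotv_ge0.
have [de0 fde] := delta_of_fixed.
have rho : `|al - f al| <= gamma * M * c.
  rewrite /trace_map {1}/al -mulrBr -raddfB/= -mulmxBr -/Qt normrM (gtr0_norm t0).
  apply: (@le_trans _ _ (T%:R^-1 * (c * \tr Phi))).
    apply: ler_wpM2l; first exact: ltW.
    apply: second_moment_trace_le => // w; apply: le_trans (Hab w w) _.
    by rewrite -expr2 sqrtr_sqr (ger0_norm (dotv_ge0 w)).
  have := ler_wpM2l (mulr_ge0 (ltW g0) c0) tM.
  have -> : gamma * c * (T%:R^-1 * (gamma^-1 * \tr Phi)) = T%:R^-1 * (c * \tr Phi).
    by rewrite -[RHS](mulKf (lt0r_neq0 g0)); ring.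
  by rewrite mulrAC.
have dal := fixed_point_stability g0 T0 mts al0 de0 fde.
have dal2 : `|al - delta_of gamma n Phi| <= (1 + M) * (gamma * M * c).
  apply: le_trans dal _; apply: ler_pM => //; last by rewrite lerD2l.
  exact: addr_ge0.
have cc : 0 <= (1 + 2 * M * (1 + M)) * c.
  apply: mulr_ge0 => //; apply: addr_ge0 => //.
  by apply: mulr_ge0; [exact: mulr_ge0|exact: addr_ge0].
apply: opnorm_bilin => // u v.
have uv : 0 <= dotv u u * dotv v v by apply: mulr_ge0; exact: dotv_ge0.
set N := Num.sqrt (dotv u u * dotv v v).
have N0 : 0 <= N by exact: sqrtr_ge0.
have -> : ((1 + 2 * M * (1 + M)) * c) ^+ 2 * dotv u u * dotv v v =
    ((1 + 2 * M * (1 + M)) * c * N) ^+ 2.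
  by rewrite [in RHS]exprMn /N sqr_sqrtr// mulrA.
rewrite -real_normK ?num_real// ler_sqr ?nnegrE//; last exact: mulr_ge0.
have -> : A - Qbar gamma n Phi = (A - Qt) + (Qt - Qbar gamma n Phi).
  by rewrite addrA subrK.
rewrite mulmxDl dotvDr; apply: le_trans (ler_normD _ _) _.
have h1 := Hab u v; have h2 := Qbar_at_dist n g0 mts u v al0 de0.
have h3 : 2 * gamma^-1 * `|al - delta_of gamma n Phi| * N <=
    2 * gamma^-1 * ((1 + M) * (gamma * M * c)) * N.
  apply: ler_wpM2r => //; apply: ler_wpM2l => //; apply: mulr_ge0 => //; exact: ltW.
have h4 := le_trans h2 h3; apply: le_trans (lerD h1 h4) _.
rewrite le_eqVlt; apply/orP; left; apply/eqP; rewrite -/N; field.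
exact: lt0r_neq0.
Qed.

End delta.

(** * The asymptotic regime *)

Section limits.
Context (R : realType).

(** A real bound is wanted even for [l = +oo]. The supremum over a suitable tail is below [l], so it
    is not [+oo]; it is not [-oo] either, the tail containing real values. *)
Lemma limn_esup_lt (u : nat -> R) (l : \bar R) :
  (limn_esup (fun n => (u n)%:E) < l)%E ->
  exists2 a : R, (a%:E < l)%E & exists N, forall n, (N <= n)%N -> u n <= a.
Proof.
move=> /ereal_inf_lt[_ [V [N _ NV] <-]] sl.
have ub n : (N <= n)%N -> ((u n)%:E <= ereal_sup [set (u k)%:E | k in V])%E.
  by move=> Nn; apply: ereal_sup_ubound; exists n => //; exact: NV.
move: sl ub; case: (ereal_sup _) => [r| |] rl ub.
- by exists r => //; exists N => n /ub; rewrite lee_fin.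
- by move: rl; rewrite ltNge leey.
- by have := ub N (leqnn N); rewrite leeNy_eq.
Qed.

Lemma limn_einf_gt (u : nat -> R) (l : R) :
  (l%:E < limn_einf (fun n => (u n)%:E))%E ->
  exists2 a : R, l < a & exists N, forall n, (N <= n)%N -> a <= u n.
Proof.
rewrite /limn_einf lteNr -EFinN.
have -> : (\- (fun n => (u n)%:E))%E = fun n => (- u n)%:E by [].
move=> /limn_esup_lt[a]; rewrite lte_fin => al [N HN].
exists (- a); first by rewrite ltrNr.
by exists N => n /HN; rewrite lerNl.
Qed.

End limits.

(** * Bounds at a fixed dimension *)

Section fixed_dimension.
Context (R : realType) (gamma : R) (n p T : nat) (X : 'M[R]_(p, T)) (x : R).
Context (phi sigma : R -> R) (lp ls : R).
Hypotheses (Xx : opnorm X <= x)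
  (lphi : forall x y, `|phi x - phi y| <= lp * `|x - y|)
  (lsig : forall x y, `|sigma x - sigma y| <= ls * `|x - y|).
Context (d : measure_display) (Om : measurableType d) (P : probability Om R)
  (z : 'I_p -> Om -> R).
Hypothesis gz : gauss P z.

Local Notation s := (row_vec X phi sigma z).
Local Notation Phi := (second_moment P s).

Let x2 : opnorm X ^+ 2 <= x ^+ 2.
Proof. by apply: lerXn2r => //; rewrite nnegrE; [|apply: le_trans Xx]; exact: opnorm_ge0. Qed.

Lemma sqr_mulmx_le (w : 'I_T -> R) :
  \sum_k (\sum_j X k j * w j) ^+ 2 <= x ^+ 2 * \sum_j w j ^+ 2.
Proof.
have := opnorm_bound X (\col_j w j); rewrite !dotvv.
under eq_bigr do rewrite mxE; under [\sum_j (\col_j0 _) _ _ ^+ 2]eq_bigr do rewrite mxE.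
under eq_bigr do under eq_bigr do rewrite mxE.
move=> /le_trans; apply; apply: ler_wpM2r => //.
by apply: sumr_ge0 => j _; exact: sqr_ge0.
Qed.

Lemma mtame_row_vec : mtame P s.
Proof.
move=> j k; rewrite (ord1 k).
exact: (@tame_row R T 1%:M (trmx1 _ _) p X _ phi sigma lp ls (sqr_ge0 x)
  sqr_mulmx_le lphi lsig d Om P z gz).
Qed.

(** The growth bound [f(a)^2 <= 2 f(0)^2 + 2 l^2 a^2] is used for [sigma] and for [phi], with the
    norm of [X] in between. As [p] and [T] are comparable, this is [tr Phi = O(T)]. *)
Lemma trace_second_moment_le : \tr Phi <= 2 * T%:R * sigma 0 ^+ 2 +
  2 * ls ^+ 2 * x ^+ 2 * (p%:R * (2 * phi 0 ^+ 2 + 2 * lp ^+ 2 * normal_var R)).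
Proof.
have sqr_lip (f : R -> R) l a : (forall y y', `|f y - f y'| <= l * `|y - y'|) ->
    f a ^+ 2 <= 2 * f 0 ^+ 2 + 2 * l ^+ 2 * a ^+ 2.
  move=> fl; have := fl a 0; rewrite subr0 => h.
  have h2 : (f a - f 0) ^+ 2 <= l ^+ 2 * a ^+ 2.
    rewrite -real_normK ?num_real// -(real_normK (num_real a)) -exprMn.
    by apply: lerXn2r => //; rewrite nnegrE// (le_trans _ h).
  have := sqr_ge0 (f a - 2 * f 0); lra.
have tz k : tame P (fun om => z k om ^+ 2) by exact: tame_sqr (tame_coord k gz).
pose Y om := 2 * T%:R * sigma 0 ^+ 2 + 2 * ls ^+ 2 * x ^+ 2 *
    \sum_k (2 * phi 0 ^+ 2 + 2 * lp ^+ 2 * z k om ^+ 2).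
have tS : tame P (fun om => \sum_k (2 * phi 0 ^+ 2 + 2 * lp ^+ 2 * z k om ^+ 2)).
  by apply: tame_sum => k; apply: tameD; [exact: tame_cst|exact: tameZ].
have EY : Ex P Y = 2 * T%:R * sigma 0 ^+ 2 +
  2 * ls ^+ 2 * x ^+ 2 * (p%:R * (2 * phi 0 ^+ 2 + 2 * lp ^+ 2 * normal_var R)).
  rewrite (ExD (tame_cst P _) (tameZ _ tS)) Ex_cst (ExZ _ tS) Ex_sum; last first.
    by move=> k; apply: tameD; [exact: tame_cst|exact: tameZ].
  congr (_ + _ * _).
  under eq_bigr => k _ do
    rewrite (ExD (tame_cst P _) (tameZ _ (tz k))) Ex_cst (ExZ _ (tz k)) (Ex_coord_sqr gz).
  by rewrite sumr_const card_ord [RHS]mulr_natl.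
have ts := mtame_row_vec.
rewrite (second_moment_tr1 ts) -EY; apply: Ex_le => [| |om].
- exact: (mtame_dotv ts ts).
- exact: (tameD (tame_cst P _) (tameZ _ tS)).
pose v : 'cV[R]_p := \col_k phi (z k om).
have XvE j : \sum_k X k j * phi (z k om) = (X^T *m v) j 0.
  by rewrite mxE; apply: eq_bigr => k _; rewrite !mxE.
rewrite dotvv.
apply: (@le_trans _ _ (\sum_j (2 * sigma 0 ^+ 2 + 2 * ls ^+ 2 * (X^T *m v) j 0 ^+ 2))).
  by apply: ler_sum => j _; rewrite mxE XvE; exact: sqr_lip.
rewrite big_split/= sumr_const card_ord -mulr_sumr -dotvv.
have -> : (2 * sigma 0 ^+ 2) *+ T = 2 * T%:R * sigma 0 ^+ 2 by rewrite -[LHS]mulr_natr; ring.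
rewrite /Y lerD2l -[X in _ <= X]mulrA.
apply: ler_wpM2l; first by apply: mulr_ge0 => //; exact: sqr_ge0.
apply: le_trans (opnorm_tr_bound X v) _.
apply: ler_pM => //; [exact: sqr_ge0|exact: dotv_ge0|].
by rewrite dotvv; apply: ler_sum => k _; rewrite mxE; exact: sqr_lip.
Qed.

End fixed_dimension.

Lemma resolvent_mean_bound (R : realType) (gamma : R) (n p T : nat)
    (X : 'M[R]_(p, T)) (x : R) (phi sigma : R -> R) (lp ls : R)
    (d : measure_display) (Om : measurableType d) (P : probability Om R)
    (W : 'I_n * 'I_p -> Om -> R) (z : 'I_p -> Om -> R) (M c1 c2 : R) :
  0 < gamma -> (0 < T)%N -> opnorm X <= x ->
  (forall x y, `|phi x - phi y| <= lp * `|x - y|) ->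
  (forall x y, `|sigma x - sigma y| <= ls * `|x - y|) ->
  gauss P W -> gauss P z ->
  let Phi := second_moment P (row_vec X phi sigma z) in
  T%:R^-1 * (gamma^-1 * \tr Phi) <= M ->
  n%:R * T%:R^-1 <= c1 -> T%:R <= c2 * n%:R ->
  opnorm (Exm P (fun om => resolvent gamma (arr_mx (feat X phi sigma (W^~ om)))) -
    Qbar gamma n Phi) <=
  (1 + 2 * M * (1 + M)) * Num.sqrt (T%:R^-1 *
    `|rate_const gamma (4 * normal_var R * (lp ^+ 2 * ls ^+ 2 * x ^+ 2)) M c1 c2|).
Proof.
move=> g0 T0 Xx lphi lsig gW gz Phi tM nc1 Tc2.
have XL := sqr_mulmx_le Xx.
have t0 : 0 <= T%:R^-1 :> R by rewrite invr_ge0.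
apply: (Qbar_dist g0 T0 (mtame_row_vec Xx lphi lsig gz) tM) => [| |u v].
- exact: sqrtr_ge0.
- exact: (mean_tr_ge0 g0 T0 (sqr_ge0 x) XL lphi lsig gW gz).
apply: le_trans (bilinear_bound g0 T0 (sqr_ge0 x) XL lphi lsig gW gz tM nc1 u v erefl Tc2) _.
rewrite sqr_sqrtr; last exact: mulr_ge0.
apply: ler_wpM2r; first by apply: mulr_ge0; exact: dotv_ge0.
by apply: ler_wpM2l => //; exact: ler_norm.
Qed.

(** * Translation of the statement and conclusion *)

Section encoding.
Context (R : realType) (d : measure_display) (Om : measurableType d)
  (P : probability Om R) (phi sigma : R -> R).

Lemma EmxE (m k : nat) (A : Om -> 'M[R]_(m, k)) : Emx P A = Exm P A.
Proof. by apply/matrixP => i j; rewrite !mxE unlock. Qed.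

Lemma featuresE (n p T : nat) (W : 'I_n -> 'I_p -> {RV P >-> R})
    (X : 'M[R]_(p, T)) om :
  features sigma (weights phi W om) X =
  arr_mx (feat X phi sigma (fun ij => W ij.1 ij.2 om)).
Proof.
apply/matrixP => i j; rewrite !mxE; congr sigma; apply: eq_bigr => k _.
by rewrite !mxE mulrC.
Qed.

Lemma Phi_mxE (p T : nat) (w : 'I_p -> {RV P >-> R}) (X : 'M[R]_(p, T)) :
  Phi_mx phi sigma w X =
  second_moment P (row_vec X phi sigma (fun k => w k : Om -> R)).
Proof.
rewrite /Phi_mx EmxE /second_moment; congr Exm; apply/funext => om.
have -> : features sigma (weight_vec phi w om)^T X = (row_vec X phi sigma (fun k => w k) om)^T.
  apply/matrixP => i j; rewrite !mxE; congr sigma; apply: eq_bigr => k _.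
  by rewrite !mxE mulrC.
by rewrite trmxK.
Qed.

End encoding.

Theorem theorem1 (R : realType)
    (d : measure_display) (Om : measurableType d) (P : probability Om R)
    (phi sigma : R -> R) (lphi lsigma : R)
    (lphi_gt0 : 0 < lphi) (lsigma_gt0 : 0 < lsigma)
    (phi_lip : lphi.-lipschitz phi) (sigma_lip : lsigma.-lipschitz sigma)
    (gamma : R) (gamma_gt0 : 0 < gamma)
    (p T : nat -> nat)
    (X : forall n : nat, 'M[R]_(p n, T n))
    (Wt : forall n : nat, 'I_n -> 'I_(p n) -> {RV P >-> R})
    (Wt_iid : forall n : nat,
       iid_std_normal (fun ij : 'I_n * 'I_(p n) => Wt n ij.1 ij.2))
    (wt : forall n : nat, 'I_(p n) -> {RV P >-> R})
    (wt_iid : forall n : nat, iid_std_normal (wt n))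
    (ratio_liminf : (0 < limn_einf (fun n : nat =>
       (Num.min ((p n)%:R / n%:R) ((T n)%:R / n%:R) : R)%:E))%E)
    (ratio_limsup : (limn_esup (fun n : nat =>
       (Num.max ((p n)%:R / n%:R) ((T n)%:R / n%:R) : R)%:E) < +oo)%E)
    (X_limsup : (limn_esup (fun n : nat => (opnorm (X n))%:E) < +oo)%E) :
  let Phi (n : nat) := Phi_mx phi sigma (wt n) (X n) in
  let Q (n : nat) (om : Om) :=
    resolvent gamma (features sigma (weights phi (Wt n) om) (X n)) in
  (forall n : nat, (0 < n)%N -> Phi n <> 0 ->
     exists! delta : R, is_delta gamma n (Phi n) delta) /\
  (forall eps : R, 0 < eps ->
     exists2 c : R, 0 < c &
       forall n : nat, (0 < n)%N ->
         opnorm (Emx P (Q n) - Qbar gamma n (Phi n))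
           <= c * n%:R `^ (- 2^-1 + eps)).
Proof.
have hphi := lipschitz_le phi_lip; have hsig := lipschitz_le sigma_lip.
have gW n : gauss P (fun ij : 'I_n * 'I_(p n) => Wt n ij.1 ij.2 : Om -> R) :=
  gauss_iid (Wt_iid n).
have gw n : gauss P (fun k : 'I_(p n) => wt n k : Om -> R) := gauss_iid (wt_iid n).
move=> Phi Q; split=> [n n0|eps eps0].
  rewrite /Phi Phi_mxE => Phi0; apply: delta_exists_unique => //; last first.
    exact: (mtame_row_vec (lexx (opnorm (X n))) hphi hsig (gw n)).
  (* For [T n = 0] the matrix is empty, hence equal to 0, which is excluded. *)
  rewrite lt0n; apply/eqP => Tn; apply: Phi0; apply/matrixP => i.
  by have := ltn_ord i; rewrite [X in (_ < X)%N]Tn.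
have [r r0 [N1 Hr]] := limn_einf_gt ratio_liminf.
have [A _ [N2 HA]] := limn_esup_lt ratio_limsup.
have [x _ [N3 Hx]] := limn_esup_lt X_limsup.
(* The bound on the trace of [Phi], divided by [gamma T]; [A / r] bounds [p / T], as [p <= A n] and
   [r n <= T]. Likewise [r^-1] bounds [n / T] and [A] bounds [T / n] in the next constant. *)
pose M := gamma^-1 * (2 * sigma 0 ^+ 2 + 2 * lsigma ^+ 2 * x ^+ 2 *
  (A / r * (2 * phi 0 ^+ 2 + 2 * lphi ^+ 2 * normal_var R))).
pose K := `|rate_const gamma
  (4 * normal_var R * (lphi ^+ 2 * lsigma ^+ 2 * x ^+ 2)) M r^-1 A|.
pose c := `|(1 + 2 * M * (1 + M)) * Num.sqrt (r^-1 * K)|.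
pose N := maxn N1 (maxn N2 N3).
pose e n := opnorm (Emx P (Q n) - Qbar gamma n (Phi n)).
pose q n : R := n%:R `^ (- 2^-1 + eps).
(* Below [N] the ratios are not yet controlled; these finitely many dimensions are absorbed by
   adding up their own errors relative to the rate. *)
pose c' := \sum_(i < N) `|e i / q i|.
have c'0 : 0 <= c' by apply: sumr_ge0.
have q0 n : (0 < n)%N -> 0 < q n by move=> n0; apply: powR_gt0; rewrite ltr0n.
have c0 : 0 <= c by exact: normr_ge0.
exists (c + c' + 1) => [|n n0].
  by rewrite ltr_pwDr// addr_ge0.
have qn := q0 n n0.
have [nN|nN] := ltnP n N.
  rewrite -ler_pdivrMr//; apply: (@le_trans _ _ c').
    rewrite /c' (bigD1 (Ordinal nN))//= (le_trans (ler_norm _))// lerDl.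
    exact: sumr_ge0.
  by rewrite addrAC lerDr addr_ge0.
have nr0 : 0 < n%:R :> R by rewrite ltr0n.
move: nN; rewrite !geq_max => /and3P[nN1 nN2 nN3].
have := Hr n nN1; rewrite le_min => /andP[_ hT].
have := HA n nN2; rewrite ge_max => /andP[hp hT'].
have rnT : r * n%:R <= (T n)%:R by rewrite -ler_pdivlMr.
have Tr0 : 0 < (T n)%:R :> R by apply: lt_le_trans rnT; exact: mulr_gt0.
have T0 : (0 < T n)%N by move: Tr0; rewrite ltr0n.
have TA : (T n)%:R <= A * n%:R by rewrite -ler_pdivrMr.
have pA : (p n)%:R <= A * n%:R by rewrite -ler_pdivrMr.
have nT : n%:R * (T n)%:R^-1 <= r^-1 by rewrite ler_pdivrMr// ler_pdivlMl.
have A0 : 0 <= A by apply: le_trans hp; exact: divr_ge0.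
have Xn := Hx n nN3.
have tM : (T n)%:R^-1 * (gamma^-1 *
    \tr (second_moment P (row_vec (X n) phi sigma (fun k => wt n k : Om -> R)))) <= M.
  rewrite mulrCA /M; apply: ler_wpM2l; first by rewrite invr_ge0 ltW.
  rewrite ler_pdivrMl//; apply: le_trans (trace_second_moment_le Xn hphi hsig (gw n)) _.
  set y := 2 * phi 0 ^+ 2 + _.
  have y0 : 0 <= y.
    by rewrite /y addr_ge0// mulr_ge0 ?sqr_ge0 ?normal_var_ge0// mulr_ge0// sqr_ge0.
  rewrite [X in _ <= X]mulrDr; apply: lerD; first by rewrite [X in _ <= X]mulrCA mulrA.
  rewrite [X in _ <= X]mulrCA; apply: ler_wpM2l.
    by apply: mulr_ge0; [apply: mulr_ge0 => //; exact: sqr_ge0|exact: sqr_ge0].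
  rewrite mulrA; apply: ler_wpM2r => //; apply: le_trans pA _.
  rewrite mulrCA; apply: ler_wpM2l => //.
  by rewrite ler_pdivlMr// mulrC.
have H := resolvent_mean_bound gamma_gt0 T0 Xn hphi hsig (gW n) (gw n) tM nT TA.
rewrite /e EmxE /Phi Phi_mxE.
have -> : Q n = fun om => resolvent gamma (arr_mx (feat (X n) phi sigma
    (fun ij : 'I_n * 'I_(p n) => Wt n ij.1 ij.2 om))).
  by apply/funext => om; rewrite /Q featuresE.
apply: le_trans H _; rewrite -/K.
apply: (@le_trans _ _ (c * q n)); last first.
  by apply: ler_wpM2r; [exact: ltW|rewrite -addrA lerDl addr_ge0].
have K0 : 0 <= K by exact: normr_ge0.
have hK : (T n)%:R^-1 * K <= r^-1 * K * n%:R^-1.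
  rewrite mulrAC; apply: ler_wpM2r => //; rewrite -invfM lef_pV2 ?posrE//.
  exact: mulr_gt0.
apply: le_trans (ler_norm _) _; rewrite normrM /c normrM.
rewrite -[X in _ <= X]mulrA; apply: ler_wpM2l => //; rewrite !ger0_norm ?sqrtr_ge0//.
apply: le_trans (ler_wsqrtr hK) _; rewrite sqrtrM; last first.
  by apply: mulr_ge0 => //; rewrite invr_ge0 ltW.
apply: ler_wpM2l; first exact: sqrtr_ge0.
rewrite -powR12_sqrt; last by rewrite invr_ge0 ltW.
(* The estimate has order [n] to the power [-1/2]; since [1 <= n], raising the exponent by [eps] can
   only increase the right-hand side. *)
rewrite -(powR_inv1 (ltW nr0)) -powRrM mulN1r /q; apply: ler_powR; first by rewrite ler1n.
by rewrite lerDl ltW.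
Qed.
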